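(* Let $K\ge 2$, $A>0$, $p_1,\ldots,p_K>0$ and real numbers $a=z_1<z_2<\cdots<z_K=b$, and let $w(x)=A\prod_{i=1}^K|x-z_i|^{p_i}$ on $[a,b]$; put $Z:=\{z_1,\ldots,z_K\}$ and $p:=\sum_{j=1}^K p_j$. Then there exist an integer $L$ with $1\le L\le K-1$, a monic real polynomial $P$ of degree $K-L-1$, and $L$ intervals $[a_l,b_l]\subset[a,b]\setminus Z$ with $a<a_1<b_1<a_2<b_2<\cdots<a_L<b_L<b$, such that $$S_w=\bigcup_{l=1}^L[a_l,b_l],$$ and, with $R(x):=\prod_{l=1}^L(x-a_l)(x-b_l)$, the equilibrium measure is $$d\mu_w(x)=(-1)^{L+l+1}\,\frac{(1+p)\sqrt{|R(x)|}\,P(x)}{\pi\prod_{j=1}^K(x-z_j)}\,dx,\qquad x\in[a_l,b_l],\ l=1,\ldots,L.$$ Moreover, setting $b_0:=-\infty$ and $a_{L+1}:=+\infty$, $$P(z_j)=(-1)^{L+l}\,\frac{p_j\prod_{m\ne j}(z_j-z_m)}{(1+p)\sqrt{|R(z_j)|}}\quad\text{whenever } z_j\in[b_l,a_{l+1}],\ j=1,\ldots,K,$$ and $$\int_{b_l}^{a_{l+1}}\frac{\sqrt{|R(x)|}\,P(x)}{\prod_{j=1}^K(x-z_j)}\,dx=0,\qquad l=1,\ldots,L-1,$$ where these integrals are Cauchy principal values.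
   Context: For a compact interval $[a,b]\subset\mathbb R$ and a nonnegative weight $w$ on $[a,b]$ (not identically zero), let $\mathcal M([a,b])$ be the set of positive unit Borel measures supported on $[a,b]$, define the weighted energy $I_w(\mu):=\iint \log\frac{1}{|z-t|\,w(z)\,w(t)}\,d\mu(z)\,d\mu(t)$ and $V_w:=\inf_{\mu\in\mathcal M([a,b])} I_w(\mu)$. For the weights considered here $V_w$ is finite and there is a unique $\mu_w\in\mathcal M([a,b])$ with $I_w(\mu_w)=V_w$ (the weighted equilibrium measure); $S_w:=\operatorname{supp}\mu_w$. *)

(* Defs.v *)
From HB Require Import structures.
From mathcomp Require Import all_boot all_order all_algebra.
From mathcomp Require Import all_classical all_reals all_analysis.
Set Implicit Arguments. Unset Strict Implicit. Unset Printing Implicit Defensive.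
Import Order.TTheory GRing.Theory Num.Theory.
Import numFieldNormedType.Exports.
Local Open Scope classical_set_scope.
Local Open Scope ring_scope.

Definition weightw (R : realType) (K : nat) (A : R) (z pw : nat -> R) (x : R) : R :=
  A * \prod_(i < K) powR `|x - z i| (pw i).

Definition log_kernel (R : realType) (w : R -> R) (x t : R) : \bar R :=
  if (x == t) || (w x == 0) || (w t == 0) then +oo%E
  else (- ln (`|x - t| * w x * w t))%:E.

Definition wenergy (R : realType) (w : R -> R)
  (mu : {measure set (measurableTypeR R) -> \bar R}) : \bar R :=
  (\int[mu]_x \int[mu]_t log_kernel w x t)%E.

Definition unit_measure_on (R : realType) (a b : R)
  (mu : {measure set (measurableTypeR R) -> \bar R}) : Prop :=
  mu setT = 1%E /\ mu (~` `[a, b]) = 0%E.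

Definition is_weighted_equilibrium (R : realType) (a b : R) (w : R -> R)
  (mu : {measure set (measurableTypeR R) -> \bar R}) : Prop :=
  unit_measure_on a b mu /\
  forall nu : {measure set (measurableTypeR R) -> \bar R},
    unit_measure_on a b nu -> (wenergy w mu <= wenergy w nu)%E.

Definition open_itv (R : realType) (c d : R) : set R := `]c, d[%classic.

Definition msupport (R : realType)
  (mu : {measure set (measurableTypeR R) -> \bar R}) : set R :=
  [set x | forall e : R, 0 < e -> (0 < mu (open_itv (x - e) (x + e)))%E].

Definition pv_integral_is (R : realType) (K : nat) (z : nat -> R)
  (f : R -> R) (lo hi v : R) : Prop :=
  let D := fun eps : R =>
    `[lo, hi] `\` \bigcup_(j in [set j : nat | (j < K)%N]) open_itv (z j - eps) (z j + eps) in
  (\forall eps \near 0^'+,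
     (lebesgue_measure : set (measurableTypeR R) -> \bar R).-integrable (D eps) (EFin \o f)) /\
  ((fun eps : R =>
      Rintegral (lebesgue_measure : set (measurableTypeR R) -> \bar R) (D eps) f)
     @ 0^'+ --> v).

(* Main.v *)
Require Import Defs.
From HB Require Import structures.
From mathcomp Require Import all_boot all_order all_algebra.
From mathcomp Require Import all_classical all_reals all_analysis.
From mathcomp Require Import measurable_realfun zify ring lra.
From mathcomp.real_closed Require Import complex.

(** Existence: along a minimizing sequence the quantile functions converge
    pointwise off a countable set (Helly), and the energy of the limit is
    controlled by Fatou's lemma.

    Structure: let [mu] be a minimizer, [A(x) = \prod_j (x - z_j)], and let
    [G(y) = \int dmu(t) / (y - t) + \sum_j p_j / (y - z_j)].  Pushing [mu]
    forward by [x |-> x + s h(x)], where [h] vanishes at the [z_j], does not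
    decrease the energy, so the derivative in [s] vanishes.  For
    [h(x) = A(x) / (y - x)] this says that [(A G)^2 = Pi] off the real line, with
    [Pi] a real polynomial of degree [2K - 2], leading coefficient [(1 + p)^2] and
    [Pi(z_j) = (p_j \prod_(m <> j) (z_j - z_m))^2].  By Stieltjes inversion [mu]
    has no atoms and has density [sqrt (max (- Pi) 0) / (pi |A|)].

    Each gap [(z_j, z_{j+1})] contains two roots [al_j <= be_j] of [Pi]: if
    [Pi >= 0] on a gap, then [mu] does not charge it and [A G] is there a continuous
    square root of [Pi] whose boundary values have opposite signs, which forces
    a double root.  Counting degrees,
    [Pi = (1 + p)^2 \prod_j (x - al_j) (x - be_j)]; the gaps with [al_j < be_j]
    carry the support, and the double roots are the zeros of [P].

    Finally [W(x) = \int ln |x - t| dmu(t) + \sum_j p_j ln |x - z_j|] has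
    derivative [Re G] and takes the same value on all components of the support,
    as comparison with the competitors [(1 - s) mu + s mu(E)^-1 mu|_E] shows.  Its
    logarithmic singularities cancel when the [z_j] are approached symmetrically,
    so the integral of [Re G] over a gap of the support, taken as a principal
    value, is zero. *)

Set Implicit Arguments. Unset Strict Implicit. Unset Printing Implicit Defensive.
Import Order.TTheory GRing.Theory Num.Theory.
Import numFieldNormedType.Exports.
Local Open Scope classical_set_scope.
Local Open Scope ring_scope.

(** * Variations of a weighted energy *)

(** The kernel has no sign and equals [+oo] on the diagonal and at the [z_j], so its integrals
    cannot be split or reordered as they stand. It is bounded below on the interval: after adding a
    constant [c] and cutting off outside [D * D] it is nonnegative, Tonelli and Fatou apply, and
    energies are compared in this shifted form.

    Moving points, rather than deriving pointwise inequalities for the potential, asks for no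
    regularity of [mu]: distances are only multiplied by factors [1 + O(s)], and what remains are
    expectations of bounded functions. The distances to the [z_j] must be changed in the same way,
    which is why [h] carries the factor [A]. Division by [y - x] then leaves polynomials in [y]
    whose coefficients are moments of [mu]; this bounds the degree of [Pi].

    The sign of the square root [A G] on an interval without mass is read off at a point [z_j] in
    it, where [A G] equals [p_j \prod_(m <> j) (z_j - z_m)]. A gap of the support may contain
    several [z_j]; the double roots separate them and cut the principal value into pieces with one
    singularity each. *)

Section BoundedFunctions.
Context d (T : measurableType d) (R : realType).
Variables (m : {measure set T -> \bar R}) (D : set T).
Hypotheses (mD : measurable D) (mD1 : m D = 1%E).

(** Boundedness is asked on [D] only: typical integrands are powers of [x], unbounded on the
    line. *)
Definition bfun (D : set T) (f : T -> R) :=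
  measurable_fun setT f /\ exists M, forall x, D x -> `|f x| <= M.

Lemma bfun_integrable f : bfun D f -> m.-integrable D (EFin \o f).
Proof.
move=> [mf [M fM]]; apply: measurable_bounded_integrable => //.
- by rewrite mD1 ltry.
- exact: measurable_funTS.
- exists M; split; first exact: num_real.
  by move=> N MN x Dx; apply: le_trans (ltW MN); exact: fM.
Qed.

Lemma bfun_cst c : bfun D (fun=> c).
Proof. by split; [exact: measurable_cst | exists `|c|]. Qed.

Lemma bfunD f g : bfun D f -> bfun D g -> bfun D (fun x => f x + g x).
Proof.
move=> [mf [M fM]] [mg [N gN]]; split; first exact: measurable_funD.
exists (M + N) => x Dx; apply: (le_trans (ler_normD _ _)).
by rewrite lerD ?fM ?gN.
Qed.

Lemma bfunM f g : bfun D f -> bfun D g -> bfun D (fun x => f x * g x).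
Proof.
move=> [mf [M fM]] [mg [N gN]]; split; first exact: measurable_funM.
by exists (M * N) => x Dx; rewrite normrM ler_pM ?fM ?gN.
Qed.

Lemma bfunZ c f : bfun D f -> bfun D (fun x => c * f x).
Proof. by apply: bfunM; exact: bfun_cst. Qed.

Lemma bfunN f : bfun D f -> bfun D (fun x => - f x).
Proof.
move=> bf; rewrite (_ : (fun x => - f x) = (fun x => -1 * f x)); first exact: bfunZ.
by apply/funext => x; rewrite mulN1r.
Qed.

Lemma bfunB f g : bfun D f -> bfun D g -> bfun D (fun x => f x - g x).
Proof. by move=> bf /bfunN; exact: bfunD. Qed.

Lemma bfun_sum (I : Type) (s : seq I) (P : pred I) (f : I -> T -> R) :
  (forall i, P i -> bfun D (f i)) -> bfun D (fun x => \sum_(i <- s | P i) f i x).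
Proof.
move=> bf; elim: s => [|i s ih].
  rewrite (_ : (fun x => _) = fun=> 0); first exact: bfun_cst.
  by apply/funext => x; rewrite big_nil.
have [Pi|/negbTE Pi] := boolP (P i); under eq_fun do rewrite big_cons Pi //.
  by apply: bfunD => //; exact: bf.
exact: ih.
Qed.

Definition Ex (m : {measure set T -> \bar R}) (D : set T) (f : T -> R) : R :=
  (\int[m]_(x in D) f x)%R.

Lemma ExD f g : bfun D f -> bfun D g ->
  Ex m D (fun x => f x + g x) = Ex m D f + Ex m D g.
Proof. by move=> bf bg; rewrite /Ex RintegralD//; exact: bfun_integrable. Qed.

Lemma ExZ c f : bfun D f -> Ex m D (fun x => c * f x) = c * Ex m D f.
Proof. by move=> bf; rewrite /Ex RintegralZl//; exact: bfun_integrable. Qed.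

Lemma ExN f : bfun D f -> Ex m D (fun x => - f x) = - Ex m D f.
Proof. by move=> bf; under eq_fun do rewrite -mulN1r; rewrite ExZ// mulN1r. Qed.

Lemma ExB f g : bfun D f -> bfun D g ->
  Ex m D (fun x => f x - g x) = Ex m D f - Ex m D g.
Proof. by move=> bf bg; rewrite ExD ?ExN//; exact: bfunN. Qed.

Lemma Ex_cst c : Ex m D (fun=> c) = c.
Proof. by rewrite /Ex Rintegral_cst// mD1 mulr1. Qed.

Lemma Ex_sum (I : Type) (s : seq I) (P : pred I) (f : I -> T -> R) :
  (forall i, P i -> bfun D (f i)) ->
  Ex m D (fun x => \sum_(i <- s | P i) f i x) = \sum_(i <- s | P i) Ex m D (f i).
Proof.
move=> bf; elim: s => [|i s ih].
  by under eq_fun do rewrite big_nil; rewrite Ex_cst big_nil.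
rewrite big_cons.
have [Pi|/negbTE Pi] := boolP (P i); under eq_fun do rewrite big_cons Pi //.
  by rewrite ExD ?ih//; [exact: bf|exact: bfun_sum].
exact: ih.
Qed.

Lemma eq_Ex f g : (forall x, D x -> f x = g x) -> Ex m D f = Ex m D g.
Proof. by move=> fg; apply: eq_Rintegral => x /[!inE]; exact: fg. Qed.

Lemma ler_Ex f g : bfun D f -> bfun D g -> (forall x, D x -> f x <= g x) ->
  Ex m D f <= Ex m D g.
Proof. by move=> bf bg fg; apply: le_Rintegral => //; exact: bfun_integrable. Qed.

Lemma ExE f : bfun D f -> (\int[m]_(x in D) (f x)%:E = (Ex m D f)%:E)%E.
Proof.
move=> bf; rewrite /Ex /Rintegral fineK//.
by apply: integrable_fin_num => //; exact: bfun_integrable.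
Qed.

(** Integrates [f - r <= g - N] without subtracting infinities: [f] and [g] may take the value
    [+oo], so the bounded terms are arranged to keep both sides nonnegative. *)
Lemma le_integral_shift (f g : T -> \bar R) (N : R) (r : T -> R) :
  measurable_fun setT f -> measurable_fun setT g ->
  (forall x, D x -> 0 <= f x)%E -> (forall x, D x -> 0 <= g x)%E ->
  0 <= N -> bfun D r -> (forall x, D x -> 0 <= r x) ->
  (forall x, D x -> f x + N%:E <= g x + (r x)%:E)%E ->
  (\int[m]_(x in D) f x + N%:E <= \int[m]_(x in D) g x + (Ex m D r)%:E)%E.
Proof.
move=> mf' mg' f0 g0 N0 br r0 fg.
have mf : measurable_fun D f by exact: measurable_funTS.
have mg : measurable_fun D g by exact: measurable_funTS.
have mr : measurable_fun D (EFin \o r).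
  by apply/measurable_EFinP/measurable_funTS; exact: br.1.
rewrite -ExE// -{1}(Ex_cst N) -ExE; last exact: bfun_cst.
rewrite -(ge0_integralD _ mD f0 mf _ (measurable_cst _))//.
rewrite -(ge0_integralD _ mD g0 mg _ mr)//.
  apply: ge0_le_integral => //.
  - by move=> x Dx; rewrite adde_ge0 ?f0// lee_fin.
  - exact: emeasurable_funD.
  - exact: emeasurable_funD.
Qed.

Lemma Ex_ge0 f : (forall x, D x -> 0 <= f x) -> 0 <= Ex m D f.
Proof. by move=> f0; exact: Rintegral_ge0. Qed.

End BoundedFunctions.
Arguments bfun {d T R} D f.
Arguments Ex {d T R} m D f.

Section ProductExpectation.
Context d (T : measurableType d) (R : realType).
Variables (mu : probability T R) (D : set T).
Hypotheses (mD : measurable D) (mD1 : mu D = 1%E).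

Lemma prodD1 : (mu \x mu)%E (D `*` D) = 1%E.
Proof.
rewrite product_measure1E//.
by rewrite [X in (X * _)%E]mD1 [X in (_ * X)%E]mD1 mule1.
Qed.

Lemma bfun_fst (f : T -> R) : bfun D f -> bfun (D `*` D) (fun z => f z.1).
Proof.
by move=> [mf [M fM]]; split; [exact: measurableT_comp|exists M => -[x t] [Dx _]; exact: fM].
Qed.

Lemma bfun_snd (f : T -> R) : bfun D f -> bfun (D `*` D) (fun z => f z.2).
Proof.
by move=> [mf [M fM]]; split; [exact: measurableT_comp|exists M => -[x t] [_ Dt]; exact: fM].
Qed.

Lemma Ex_prod (f g : T -> R) : bfun D f -> bfun D g ->
  Ex (mu \x mu)%E (D `*` D) (fun z => f z.1 * g z.2) = Ex mu D f * Ex mu D g.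
Proof.
move=> bf bg.
have bfg : bfun (D `*` D) (fun z => f z.1 * g z.2).
  by apply: bfunM; [exact: bfun_fst|exact: bfun_snd].
have mDD : measurable (D `*` D) by exact: measurableX.
rewrite /Ex /Rintegral integral_mkcond/= -integral12_prod_meas1; last first.
  by apply/(integrable_mkcond _ mDD); apply: bfun_integrable => //; exact: prodD1.
rewrite /fubini_F.
transitivity (fine (\int[mu]_(x in D) (Ex mu D g * f x)%:E)%E); last first.
  by rewrite (ExE mD mD1 (bfunZ _ bf)) (ExZ mD mD1)//= mulrC.
congr fine; rewrite [RHS]integral_mkcond; apply: eq_integral => x _.
rewrite /patch; case: ifPn => Dx.
  rewrite mulrC -(ExZ mD mD1)// -(ExE mD mD1); last exact: bfunZ.
  rewrite [RHS]integral_mkcond; apply: eq_integral => t _; rewrite /patch /=.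
  case: ifPn => [|/negP]; first by rewrite inE => -[_ Dt]; rewrite mem_set.
  case: ifPn => // /[!inE] Dt; case; split => //=; exact: set_mem.
rewrite integral0_eq// => t _; case: ifPn => // /[!inE] -[/= /mem_set].
by rewrite (negbTE Dx).
Qed.

End ProductExpectation.

(** * Energies of kernels that are bounded below *)

Section ShiftedIntegral.
Context d (T : measurableType d) (R : realType).
Variables (P : probability T R) (D : set T).
Hypotheses (mD : measurable D) (PD : P (~` D) = 0%E).

Lemma prob_carrier1 : P D = 1%E.
Proof.
have mDc : measurable (~` D) by exact: measurableC.
by have := probability_setC P mDc; rewrite setCK PD sube0.
Qed.

Lemma ge0_integral_carrier (f : T -> \bar R) : measurable_fun setT f ->
  (forall x, 0 <= f x)%E -> (\int[P]_x f x = \int[P]_(x in D) f x)%E.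
Proof.
move=> mf f0; have mDc : measurable (~` D) by exact: measurableC.
by rewrite (ge0_negligible_integral mDc measurableT mf)// setTD setCK.
Qed.

Lemma integral_carrier (f : T -> \bar R) : measurable_fun setT f ->
  (\int[P]_x f x = \int[P]_(x in D) f x)%E.
Proof.
move=> mf; rewrite integralE [RHS]integralE.
rewrite !ge0_integral_carrier//.
- exact: measurable_funeneg.
- exact: measurable_funepos.
Qed.

(** On [D] the negative part of [f] is at most [c], so its integral is finite and can be added to
    both sides and cancelled, even when the positive part has infinite integral. *)
Lemma integral_shift (f : T -> \bar R) (c : R) : measurable_fun setT f -> 0 <= c ->
  (forall x, D x -> 0 <= f x + c%:E)%E ->
  (\int[P]_x f x + c%:E = \int[P]_(x in D) (f x + c%:E))%E.
Proof.
move=> mf c0 fc.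
have mfD : measurable_fun D f by exact: measurable_funTS.
have mp : measurable_fun D (f^\+)%E by exact: measurable_funepos.
have mn : measurable_fun D (f^\-)%E by exact: measurable_funeneg.
have ce : (\int[P]_(x in D) c%:E = c%:E)%E by rewrite integral_cst// [X in (_ * X)%E]prob_carrier1 mule1.
have nc : (\int[P]_(x in D) (f^\- x) <= c%:E)%E.
  rewrite -ce; apply: ge0_le_integral => //.
  move=> x Dx; rewrite funenegE ge_max lee_fin c0 andbT.
  move: (fc x Dx); case: (f x) => [r| |]; rewrite ?leNye//.
  by rewrite -EFinD !lee_fin; lra.
have n0 : (0 <= \int[P]_(x in D) (f^\- x))%E by apply: integral_ge0.
have nfin : (\int[P]_(x in D) (f^\- x))%E \is a fin_num.
  by rewrite ge0_fin_numE// (le_lt_trans nc)// ltry.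
have mfc : measurable_fun D (fun x => f x + c%:E)%E by exact: emeasurable_funD.
have key : (\int[P]_(x in D) (f x + c%:E) + \int[P]_(x in D) (f^\- x) =
            \int[P]_(x in D) (f^\+ x) + c%:E)%E.
  rewrite -[in RHS]ce -!ge0_integralD//.
  apply: eq_integral => x /[!inE] Dx; have := fc x Dx.
  rewrite funenegE funeposE; case: (f x) => [r| |]//=.
  - move=> _; rewrite -!EFin_max -!EFinD; congr EFin.
    by rewrite /Num.max; case: ifPn; case: ifPn; lra.
  - by rewrite maxNye maxye addye// adde0.
rewrite integral_carrier// integralE addeAC -key addeK//.
Qed.

End ShiftedIntegral.

Section ShiftedEnergy.
Context d (T : measurableType d) (R : realType).
Variables (P : probability T R) (D : set T).
Hypotheses (mD : measurable D) (PD : P (~` D) = 0%E).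
Variables (k : T * T -> \bar R) (c : R).
Hypotheses (mk : measurable_fun setT k) (c0 : 0 <= c).
Hypothesis kc : forall x t, D x -> D t -> (0 <= k (x, t) + c%:E)%E.

(** The inner integral is shifted for each [x] in [D], and then the outer one. An iterated integral
    of a kernel without sign becomes one of a nonnegative function on the whole product, to which
    Tonelli applies. *)
Lemma energy_shift_patch :
  (\int[P]_x \int[P]_t k (x, t) + c%:E =
   \int[P]_x \int[P]_t ((fun z => k z + c%:E) \_ (D `*` D)) (x, t))%E.
Proof.
have mDD : measurable (D `*` D) by exact: measurableX.
have mF : measurable_fun setT (fun x => \int[P]_t k (x, t))%E.
  (* Tonelli gives measurability of the inner integrals of the positive and negative parts
     separately. *)
  rewrite (_ : (fun x => _) = (fun x => fubini_F P (k^\+) x - fubini_F P (k^\-) x)%E).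
    apply: emeasurable_funB; apply: measurable_fun_fubini_tonelli_F => //.
      exact: measurable_funepos.
    exact: measurable_funeneg.
  apply/funext => x; rewrite integralE /fubini_F; congr (_ - _)%E.
    by apply: eq_integral => t _; rewrite !funeposE.
  by apply: eq_integral => t _; rewrite !funenegE.
have kx x : measurable_fun setT (fun t => k (x, t)) by exact: measurableT_comp.
have shiftx x : D x -> (\int[P]_t k (x, t) + c%:E = \int[P]_(t in D) (k (x, t) + c%:E))%E.
  by move=> Dx; apply: integral_shift => // t Dt; exact: kc.
rewrite (integral_shift mD PD)//; last first.
  by move=> x Dx; rewrite shiftx//; apply: integral_ge0 => t Dt; exact: kc.
rewrite integral_mkcond; apply: eq_integral => x _; rewrite patchE.
case: ifPn => [|nDx].
  rewrite inE => Dx; rewrite shiftx// integral_mkcond; apply: eq_integral => t _.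
  rewrite !patchE; congr (if _ then _ else _).
  by apply/idP/idP => [/set_mem Dt|/set_mem[_ Dt]]; exact: mem_set.
rewrite integral0_eq// => t _; rewrite patchE; case: ifPn => // /set_mem[/= /mem_set].
by rewrite (negbTE nDx).
Qed.

Lemma measurable_shifted : measurable_fun setT ((fun z => k z + c%:E)%E \_ (D `*` D)).
Proof.
apply/(measurable_restrictT _ _).1; first exact: measurableX.
by apply: measurable_funTS; exact: emeasurable_funD.
Qed.

Lemma shifted_ge0 z : (0 <= ((fun z => k z + c%:E) \_ (D `*` D)) z)%E.
Proof.
by rewrite patchE; case: ifPn => // /set_mem; case: z => x t [/= Dx Dt]; exact: kc.
Qed.

Lemma energy_shift :
  (\int[P]_x \int[P]_t k (x, t) + c%:E =
   \int[(P \x P)]_(z in D `*` D) (k z + c%:E))%E.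
Proof.
rewrite energy_shift_patch [RHS]integral_mkcond fubini_tonelli1//.
- exact: measurable_shifted.
- exact: shifted_ge0.
Qed.

End ShiftedEnergy.

(** * The weight and a lower bound for the kernel *)

Section Weight.
Context (R : realType) (K : nat) (A : R) (z pw : nat -> R).
Hypotheses (hK : (2 <= K)%N) (hA : 0 < A).
Hypothesis hp : forall i : nat, (i < K)%N -> 0 < pw i.
Hypothesis hz : forall i : nat, (i.+1 < K)%N -> z i < z i.+1.
Local Notation w := (weightw K A z pw).
Local Notation D := (`[z 0%N, z K.-1]%classic : set R).

Lemma z_lt i j : (i < j < K)%N -> z i < z j.
Proof.
move=> /andP[ij jK]; rewrite -(subnK ij) addnC; move: jK; rewrite -{1}(subnK ij) addnC.
elim: (j - i.+1)%N => [|n ih]; first by rewrite addn0; exact: hz.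
rewrite addnS => h; apply: lt_trans (hz h); apply: ih; exact: ltn_trans h.
Qed.

Lemma z_le i j : (i <= j < K)%N -> z i <= z j.
Proof.
move=> /andP[]; rewrite leq_eqVlt => /predU1P[->//|ij] jK.
by rewrite ltW// z_lt// ij.
Qed.

Lemma z_inj i j : (i < K)%N -> (j < K)%N -> z i = z j -> i = j.
Proof.
move=> iK jK zij; case: (ltngtP i j) => // h.
  by have := z_lt (i := i) (j := j); rewrite h jK zij ltxx => /(_ isT).
by have := z_lt (i := j) (j := i); rewrite h iK zij ltxx => /(_ isT).
Qed.

Lemma z_in i : (i < K)%N -> D (z i).
Proof.
by move=> iK; rewrite /= in_itv/=; apply/andP; split; apply: z_le; lia.
Qed.

Lemma weightw_ge0 x : 0 <= w x.
Proof. by rewrite mulr_ge0 ?(ltW hA)// prodr_ge0// => i _; exact: powR_ge0. Qed.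

Lemma weightw_gt0 x : w x != 0 -> 0 < w x.
Proof. by rewrite lt_neqAle weightw_ge0 andbT eq_sym. Qed.

Lemma weightw_eq0 x : w x = 0 -> exists2 i, (i < K)%N & x = z i.
Proof.
move=> /eqP; rewrite mulf_eq0 (gt_eqF hA)/= prodf_seq_eq0.
move=> /hasP[i _ /=]; rewrite powR_eq0 normr_eq0 subr_eq0 => /andP[/eqP xz _].
by exists i.
Qed.

Lemma weightw_z i : (i < K)%N -> w (z i) = 0.
Proof.
move=> iK; rewrite /weightw (bigD1 (Ordinal iK))//= subrr normr0 powR0 ?mul0r ?mulr0//.
by rewrite gt_eqF// hp.
Qed.

Lemma measurable_weightw : measurable_fun setT w.
Proof.
apply: measurable_funM => //; apply: measurable_prod => i _.
apply: (measurableT_comp (measurable_powR _)).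
by apply: measurableT_comp => //; exact: measurable_funB.
Qed.

Lemma measurable_log_kernel :
  measurable_fun (setT : set (measurableTypeR R * measurableTypeR R))
    (fun y => log_kernel w y.1 y.2).
Proof.
have mw1 : measurable_fun (setT : set (measurableTypeR R * measurableTypeR R)) (fun y => w y.1).
  exact: measurableT_comp measurable_weightw _.
have mw2 : measurable_fun (setT : set (measurableTypeR R * measurableTypeR R)) (fun y => w y.2).
  exact: measurableT_comp measurable_weightw _.
apply: measurable_fun_ifT => //.
  apply: measurable_or; first apply: measurable_or.
  - exact: measurable_fun_eqr.
  - exact: measurable_fun_eqr.
  - exact: measurable_fun_eqr.
apply/measurable_EFinP; apply: measurableT_comp => //.
apply: measurableT_comp => //; apply: measurable_funM => //; apply: measurable_funM => //.
by apply: measurableT_comp => //; exact: measurable_funB.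
Qed.

Lemma weightw_ubound : exists2 M, 0 < M & forall x, D x -> w x <= M.
Proof.
exists (A * \prod_(i < K) (powR (z K.-1 - z 0%N) (pw i))).
  apply: mulr_gt0 => //; apply: prodr_gt0 => i _; apply: powR_gt0.
  by rewrite subr_gt0 z_lt//; lia.
move=> x Dx; rewrite ler_pM2l//; apply: ler_prod => i _; rewrite powR_ge0/=.
apply: ge0_ler_powR; rewrite ?nnegrE//; first by rewrite ltW// hp.
  by rewrite subr_ge0 z_le//; lia.
have := z_in (ltn_ord i); move: Dx; rewrite /= !in_itv/= ler_norml.
by move=> /andP[? ?] /andP[? ?]; apply/andP; split; lra.
Qed.

(** On [D] the product [|x - t| w(x) w(t)] is bounded, so minus its logarithm is bounded below. *)
Lemma log_kernel_lbound :
  exists2 c, 0 <= c & forall x t, D x -> D t -> (0 <= log_kernel w x t + c%:E)%E.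
Proof.
have [M M0 wM] := weightw_ubound.
(* The summand [1] gives [N >= 1], hence a nonnegative shift [ln N]. *)
pose N := (z K.-1 - z 0%N) * M * M + 1.
have N1 : 1 <= N.
  rewrite lerDr !mulr_ge0 ?(ltW M0)// subr_ge0 z_le//; lia.
exists (ln N); first exact: ln_ge0.
move=> x t Dx Dt; rewrite /log_kernel; case: ifPn => [_|]; first by rewrite addye// leey.
rewrite !negb_or => /andP[/andP[xt wx] wt].
rewrite -EFinD lee_fin addrC subr_ge0 ler_ln ?posrE.
- apply: (@le_trans _ _ ((z K.-1 - z 0%N) * M * M)); last by rewrite lerDl.
  have xtb : `|x - t| <= z K.-1 - z 0%N.
    move: Dx Dt; rewrite /= !in_itv/= ler_norml.
    by move=> /andP[? ?] /andP[? ?]; apply/andP; split; lra.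
  apply: ler_pM (wM _ Dt); rewrite ?weightw_ge0//.
    by rewrite mulr_ge0 ?weightw_ge0.
  by apply: ler_pM (wM _ Dx); rewrite ?weightw_ge0.
- by apply: mulr_gt0 (weightw_gt0 wt); apply: mulr_gt0 (weightw_gt0 wx); rewrite normr_gt0 subr_eq0.
- exact: lt_le_trans N1.
Qed.

End Weight.

Section PushEnergy.
Context d d' (T : measurableType d) (T' : measurableType d') (R : realType).
Variables (P : probability T R) (X : {mfun T >-> T'}) (D : set T').
Hypotheses (mD : measurable D) (PD : P (X @^-1` ~` D) = 0%E).
Variables (k : T' * T' -> \bar R) (c : R).
Hypotheses (mk : measurable_fun setT k) (c0 : 0 <= c).
Hypothesis kc : forall x t, D x -> D t -> (0 <= k (x, t) + c%:E)%E.

(** With the energy of an image measure written over [P \x P], it can be compared pointwise with the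
    energy of [P] under one integral sign. *)
Lemma energy_push :
  (\int[distribution P X]_x \int[distribution P X]_t k (x, t) + c%:E =
   \int[(P \x P)]_(z in (X @^-1` D) `*` (X @^-1` D)) (k (X z.1, X z.2) + c%:E))%E.
Proof.
have mE : measurable (X @^-1` D) by rewrite -(setTI (_ @^-1` _)); exact: measurable_funP.
have mEE : measurable ((X @^-1` D) `*` (X @^-1` D)) by exact: measurableX.
rewrite (@energy_shift_patch _ _ _ (distribution P X) D mD PD k c mk c0 kc).
set kt := (_ \_ _).
have mkt : measurable_fun setT kt by exact: measurable_shifted.
have kt0 y : (0 <= kt y)%E by exact: shifted_ge0.
rewrite ge0_integral_distribution; last 2 first.
- by apply: measurable_fun_fubini_tonelli_F.
- by move=> x; apply: integral_ge0.
transitivity (\int[P]_x \int[P]_t kt (X x, X t))%E.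
  apply: eq_integral => x _ /=; rewrite ge0_integral_distribution//.
  exact: measurableT_comp.
have mX : measurable_fun setT (fun y : T * T => kt (X y.1, X y.2)).
  by apply: measurableT_comp => //; apply/measurable_fun_pair => /=; exact: measurableT_comp.
rewrite [RHS]integral_mkcond; transitivity (\int[(P \x P)]_y kt (X y.1, X y.2))%E.
  by rewrite fubini_tonelli1.
apply: eq_integral => -[x t] _; rewrite /kt !patchE/=.
congr (if _ then _ else _).
Qed.

End PushEnergy.

(** * First variation of the energy *)

Section RealLemmas.
Context (R : realType).

(** [ln (1 + u) <= u] is applied to [u = - y / (1 + y)], for which [1 + u = (1 + y)^-1]; the factor
    [2] bounds [(1 + y)^-1]. *)
Lemma opp_ln1D_le (y : R) : - 2^-1 <= y -> - ln (1 + y) <= - y + 2 * y ^+ 2.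
Proof.
move=> y2; have y0 : 0 < 1 + y by lra.
rewrite -lnV ?posrE//.
have -> : (1 + y)^-1 = 1 + (- y / (1 + y)) by field; rewrite gt_eqF.
have e : - y / (1 + y) = - y + y ^+ 2 / (1 + y) by field; rewrite gt_eqF.
apply: le_trans (le_ln1Dx _) _.
  rewrite -subr_gt0; have -> : - y / (1 + y) - -1 = (1 + y)^-1.
    by field; rewrite gt_eqF.
  by rewrite invr_gt0.
rewrite e lerD2l mulrC ler_wpM2r ?sqr_ge0//.
by rewrite invf_ple ?posrE//; lra.
Qed.

(* A quantity whose multiples by both signs of small [s] are O(s^2) vanishes. *)
Lemma eq0_first_order (X C s0 : R) : 0 < s0 ->
  (forall s, `|s| <= s0 -> s * X <= C * s ^+ 2) -> X = 0.
Proof.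
move=> s00 H; apply/eqP; rewrite -normr_le0 leNgt; apply/negP => X0.
pose C' := `|C| + 1.
have C'0 : 0 < C' by rewrite ltr_wpDl.
(* Taking [s] of absolute value [r] with the sign of [X], the hypothesis would give
   [|X| <= C r <= |X| / 2]. *)
pose r := Num.min s0 (`|X| / (2 * C')).
have r0 : 0 < r by rewrite lt_min s00/= divr_gt0 ?mulr_gt0.
have rX : r * C' <= `|X| / 2.
  have : r <= `|X| / (2 * C') by rewrite ge_min lexx orbT.
  by rewrite ler_pdivlMr ?mulr_gt0//; nra.
have rs0 : r <= s0 by rewrite ge_min lexx.
have CC' : C <= C' by rewrite /C' (le_trans (ler_norm C))// lerDl.
have [Xp|Xn] := leP 0 X.
  have := H r; rewrite (ger0_norm (ltW r0)) => /(_ rs0).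
  by rewrite expr2 mulrCA ler_pM2l//; move: rX X0; rewrite ger0_norm//; nra.
have := H (- r); rewrite normrN (ger0_norm (ltW r0)) => /(_ rs0).
by move: rX X0; rewrite ltr0_norm//; nra.
Qed.

End RealLemmas.

Section Variation.
Context (R : realType) (K : nat) (A : R) (z pw : nat -> R).
Hypotheses (hK : (2 <= K)%N) (hA : 0 < A).
Hypothesis hp : forall i : nat, (i < K)%N -> 0 < pw i.
Hypothesis hz : forall i : nat, (i.+1 < K)%N -> z i < z i.+1.
Local Notation w := (weightw K A z pw).

Lemma ln_prod (n : nat) (f : nat -> R) : (forall i, (i < n)%N -> 0 < f i) ->
  ln (\prod_(i < n) f i) = \sum_(i < n) ln (f i).
Proof.
elim: n => [|n ih] f0; first by rewrite !big_ord0 ln1.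
rewrite !big_ord_recr/= lnM ?posrE ?ih//; first by move=> i /ltnW; exact: f0.
- by apply: prodr_gt0 => i _; apply: f0; rewrite ltnS ltnW.
- exact: f0.
Qed.

Lemma weightw_neq0 x : (forall j, (j < K)%N -> x != z j) -> w x != 0.
Proof.
move=> xz; apply/eqP => /(weightw_eq0 hA)[i iK xi].
by have := xz i iK; rewrite xi eqxx.
Qed.

Lemma ln_weightw x : (forall j, (j < K)%N -> x != z j) ->
  ln (w x) = ln A + \sum_(j < K) pw j * ln `|x - z j|.
Proof.
move=> xz; have xz0 j : (j < K)%N -> 0 < `|x - z j| by move=> jK; rewrite normr_gt0 subr_eq0 xz.
rewrite /weightw lnM ?posrE//; last first.
  by apply: prodr_gt0 => j _; apply: powR_gt0; exact: xz0.
congr (_ + _); rewrite (ln_prod (f := fun i => powR `|x - z i| (pw i))).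
  by apply: eq_bigr => i _; rewrite ln_powR.
by move=> i iK; apply: powR_gt0; exact: xz0.
Qed.

(** The displacement multiplies [|x - t|] by [1 + s g] and [|x - z_j|] by [1 + s u_j]. Each
    logarithm changes by a linear term and an error of at most [2 B ^ 2 s ^ 2]; the distance
    contributes one logarithm, the two weights a total multiplicity [2 \sum_j p_j]. *)
Lemma log_kernel_variation (x t hx ht g B s : R) (u v : nat -> R) :
  (forall j, (j < K)%N -> hx = (x - z j) * u j) ->
  (forall j, (j < K)%N -> ht = (t - z j) * v j) ->
  hx - ht = (x - t) * g ->
  `|g| <= B -> (forall j, (j < K)%N -> `|u j| <= B) ->
  (forall j, (j < K)%N -> `|v j| <= B) -> `|s| * B <= 2^-1 ->
  (log_kernel w (x + s * hx) (t + s * ht) <= log_kernel w x t +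
   (- (s * (g + \sum_(j < K) pw j * (u j + v j))) +
    2 * (1 + 2 * \sum_(j < K) pw j) * B ^+ 2 * s ^+ 2)%:E)%E.
Proof.
move=> hu hv hg gB uB vB sB.
rewrite {2}/log_kernel; case: ifPn => [_|]; first by rewrite addye// leey.
rewrite !negb_or => /andP[/andP[xt wx] wt].
have xz j : (j < K)%N -> x != z j.
  by move=> jK; apply: contra wx => /eqP ->; rewrite weightw_z.
have tz j : (j < K)%N -> t != z j.
  by move=> jK; apply: contra wt => /eqP ->; rewrite weightw_z.
(* The ratios [1 + s y] stay at least [1 / 2], so no point crosses another point or a [z_j]. *)
have s2 y : `|y| <= B -> - 2^-1 <= s * y.
  move=> yB; have : `|s * y| <= 2^-1.
    by rewrite normrM (le_trans _ sB)// ler_wpM2l.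
  by rewrite ler_norml => /andP[].
have s1 y : `|y| <= B -> 0 < 1 + s * y by move=> /s2; lra.
have quad y : `|y| <= B -> - ln (1 + s * y) <= - (s * y) + 2 * B ^+ 2 * s ^+ 2.
  move=> yB; apply: le_trans (opp_ln1D_le (s2 _ yB)) _.
  rewrite lerD2l -mulrA ler_pM2l// exprMn mulrC ler_wpM2r ?sqr_ge0//.
  by move: yB; rewrite ler_norml => /andP[? ?]; nra.
have dz (x0 hx0 : R) (u0 : nat -> R) (j : nat) : (j < K)%N -> hx0 = (x0 - z j) * u0 j -> `|u0 j| <= B ->
    `|x0 + s * hx0 - z j| = `|x0 - z j| * (1 + s * u0 j).
  move=> jK -> ub; rewrite -[in RHS](gtr0_norm (s1 _ ub)) -normrM; congr `|_|; ring.
have nz (x0 hx0 : R) (u0 : nat -> R) : (forall j, (j < K)%N -> x0 != z j) ->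
    (forall j, (j < K)%N -> hx0 = (x0 - z j) * u0 j) -> (forall j, (j < K)%N -> `|u0 j| <= B) ->
    forall j, (j < K)%N -> x0 + s * hx0 != z j.
  move=> x0z h0 ub j jK; rewrite -subr_eq0 -normr_eq0 (dz _ _ u0)//; last 2 first.
  - exact: h0.
  - exact: ub.
  by rewrite mulf_neq0 ?normr_eq0 ?subr_eq0 ?x0z// gt_eqF// s1// ub.
have lnw (x0 hx0 : R) (u0 : nat -> R) : (forall j, (j < K)%N -> x0 != z j) ->
    (forall j, (j < K)%N -> hx0 = (x0 - z j) * u0 j) -> (forall j, (j < K)%N -> `|u0 j| <= B) ->
    - ln (w (x0 + s * hx0)) <= - ln (w x0) - s * (\sum_(j < K) pw j * u0 j) +
       2 * B ^+ 2 * s ^+ 2 * \sum_(j < K) pw j.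
  move=> x0z h0 ub; rewrite !ln_weightw//; last exact: nz h0 ub.
  rewrite !opprD -!sumrN -!addrA lerD2l !mulr_sumr -!sumrN -!big_split/=.
  apply: ler_sum => j _; rewrite (dz _ _ u0)//; last 2 first.
  - exact: h0.
  - exact: ub.
  rewrite lnM ?posrE ?normr_gt0 ?subr_eq0 ?x0z//; last exact/s1/ub.
  have := quad _ (ub _ (ltn_ord j)); have := hp (ltn_ord j); nra.
have e1 : x + s * hx - (t + s * ht) = (x - t) * (1 + s * g).
  have -> : x + s * hx - (t + s * ht) = x - t + s * (hx - ht) by ring.
  by rewrite hg; ring.
have n1 : x + s * hx != t + s * ht.
  by rewrite -subr_eq0 e1 mulf_neq0 ?subr_eq0// gt_eqF// s1.
have wx' : w (x + s * hx) != 0 by apply: weightw_neq0; exact: nz hu uB.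
have wt' : w (t + s * ht) != 0 by apply: weightw_neq0; exact: nz hv vB.
rewrite /log_kernel (negbTE n1) (negbTE wx') (negbTE wt')/= -EFinD lee_fin.
have ln3 (y p q : R) : y != 0 -> p != 0 -> 0 <= p -> q != 0 -> 0 <= q ->
    ln (`|y| * p * q) = ln `|y| + ln p + ln q.
  move=> y0 p0 p1 q0 q1; rewrite !lnM ?posrE ?mulr_gt0 ?normr_gt0//;
  by rewrite lt_neqAle eq_sym ?p0 ?q0.
rewrite !ln3 ?subr_eq0 ?weightw_ge0// e1 normrM (gtr0_norm (s1 _ gB)).
rewrite lnM ?posrE ?normr_gt0 ?subr_eq0 ?s1//.
have := lnw _ _ _ xz hu uB; have := lnw _ _ _ tz hv vB; have := quad _ gB.
have -> : \sum_(j < K) pw j * (u j + v j) = \sum_(j < K) pw j * u j + \sum_(j < K) pw j * v j.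
  by rewrite -big_split/=; apply: eq_bigr => j _; ring.
set p := \sum_(j < K) pw j; set pu := \sum_(j < K) _; set pv := \sum_(j < K) _.
set B2 := B ^+ 2; set s2' := s ^+ 2; lra.
Qed.

End Variation.

Section FirstVariation.
Context (R : realType) (K : nat) (A : R) (z pw : nat -> R).
Hypotheses (hK : (2 <= K)%N) (hA : 0 < A).
Hypothesis hp : forall i : nat, (i < K)%N -> 0 < pw i.
Hypothesis hz : forall i : nat, (i.+1 < K)%N -> z i < z i.+1.
Local Notation w := (weightw K A z pw).
Local Notation T := (measurableTypeR R).
Local Notation D := (`[z 0%N, z K.-1]%classic : set T).
Variable P : probability T R.
Hypothesis PD : P (~` D) = 0%E.
Hypothesis Pmin : forall nu : {measure set T -> \bar R},
  unit_measure_on (z 0%N) (z K.-1) nu -> (wenergy w P <= wenergy w nu)%E.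
Hypothesis Pfin : (wenergy w P < +oo)%E.

Let mD : measurable D.
Proof. exact: measurable_itv. Qed.
Let mDD : measurable (D `*` D).
Proof. exact: measurableX. Qed.
Let P1 : P D = 1%E.
Proof. exact: prob_carrier1. Qed.
Let PP1 : (P \x P)%E (D `*` D) = 1%E.
Proof. exact: prodD1. Qed.

Let kern (y : T * T) := log_kernel w y.1 y.2.

Let mkern : measurable_fun setT kern.
Proof. exact: measurable_log_kernel. Qed.

Lemma wenergy_fin_num : wenergy w P \is a fin_num.
Proof.
have [c c0 kc] := log_kernel_lbound hK hA hp hz.
have : (0 <= wenergy w P + c%:E)%E.
  rewrite (energy_shift mD PD mkern c0 kc); apply: integral_ge0 => -[x t] [Dx Dt].
  exact: kc.
by move: Pfin; case: (wenergy w P).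
Qed.

(** The image of [P] under [x + s h(x)] is a competitor for small [s] of either sign, and its energy
    exceeds that of [P] by at most [- s] times the left-hand side plus [O(s ^ 2)]. The factor [2]
    comes from the weights [w(x)] and [w(t)]. *)
Lemma first_variation (h : T -> R) (hj : nat -> T -> R) (g : T * T -> R) :
  bfun D h -> (forall j, (j < K)%N -> bfun D (hj j)) -> bfun (D `*` D) g ->
  (forall x j, D x -> (j < K)%N -> h x = (x - z j) * hj j x) ->
  (forall x t, D x -> D t -> h x - h t = (x - t) * g (x, t)) ->
  Ex (P \x P)%E (D `*` D) g + 2 * \sum_(j < K) pw j * Ex P D (hj j) = 0.
Proof.
have arith1 (x y u v : R) : - x + y + (u + v) <= u + (y + v + - x) by lra.
have arith2 (e u v y x : R) : e + u + v <= e + u + (y + v - x) -> x <= y by lra.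
move=> bh bhj bg hhj hg.
have [c c0 kc] := log_kernel_lbound hK hA hp hz.
(* One bound for [g] and all quotients: absolute values keep the sum above each term, and [1] makes
   it positive. *)
have [B B0 [gB hB]] : exists2 B, 0 < B & (forall y, (D `*` D) y -> `|g y| <= B) /\
    (forall j x, (j < K)%N -> D x -> `|hj j x| <= B).
  have [_ [B1 gB1]] := bg.
  have /choice[B2 hB2] : forall j, exists B, (j < K)%N -> forall x, D x -> `|hj j x| <= B.
    move=> j; have [jK|jK] := boolP (j < K)%N; last by exists 0.
    by have [_ [B hB]] := bhj j jK; exists B.
  exists (1 + `|B1| + \sum_(j < K) `|B2 j|).
    by rewrite ltr_pwDl ?sumr_ge0// ltr_pwDl.
  split=> [y Dy|j x jK Dx].
    apply: le_trans (gB1 y Dy) _; apply: le_trans (ler_norm _) _.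
    rewrite addrAC lerDr addr_ge0 ?sumr_ge0//.
  apply: le_trans (hB2 j jK x Dx) _; apply: le_trans (ler_norm _) _.
  rewrite (bigD1 (Ordinal jK))//= addrCA lerDl !addr_ge0// sumr_ge0//.
pose m (y : T * T) := g y + \sum_(j < K) pw j * (hj j y.1 + hj j y.2).
have bm : bfun (D `*` D) m.
  apply: bfunD => //; apply: bfun_sum => j _; apply: bfunZ.
  by apply: bfunD; [exact/bfun_fst/bhj|exact/bfun_snd/bhj].
have Em : Ex (P \x P)%E (D `*` D) m = Ex (P \x P)%E (D `*` D) g + 2 * \sum_(j < K) pw j * Ex P D (hj j).
  have b1 (j : 'I_K) := bhj j (ltn_ord j).
  have bf (j : 'I_K) := bfun_fst (b1 j); have bs (j : 'I_K) := bfun_snd (b1 j).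
  rewrite /m (ExD mDD PP1)//; last by apply: bfun_sum => j _; apply: bfunZ; exact: bfunD.
  congr (_ + _); rewrite (Ex_sum mDD PP1); last by move=> j _; apply: bfunZ; exact: bfunD.
  rewrite mulr_sumr; apply: eq_bigr => j _.
  rewrite (ExZ mDD PP1); last exact: bfunD.
  rewrite (ExD mDD PP1)// mulrCA; congr (_ * _).
  have -> : Ex (P \x P)%E (D `*` D) (fun y => hj j y.1) = Ex P D (hj j).
    have := Ex_prod mD P1 (b1 j) (bfun_cst D 1); rewrite (Ex_cst mD P1) mulr1 => <-.
    by congr Ex; apply/funext => y; rewrite mulr1.
  have -> : Ex (P \x P)%E (D `*` D) (fun y => hj j y.2) = Ex P D (hj j).
    have := Ex_prod mD P1 (bfun_cst D 1) (b1 j); rewrite (Ex_cst mD P1) mul1r => <-.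
    by congr Ex; apply/funext => y; rewrite mul1r.
  by rewrite mulr_natl.
rewrite -Em.
pose C := 2 * (1 + 2 * \sum_(j < K) pw j) * B ^+ 2.
apply: (@eq0_first_order _ _ C (2^-1 / B)); first by rewrite divr_gt0.
move=> s; rewrite ler_pdivlMr// => sB.
have hs y : `|y| <= B -> `|s * y| <= 2^-1.
  by move=> yB; rewrite normrM (le_trans _ sB)// ler_wpM2l.
(* Off [D] the patched part is [0] and the map is constantly [z 0 - 1], a point outside [D]; thus
   the preimage of [D] can be [D] itself. *)
pose X0 (x : T) : T := (z 0%N - 1) + ((fun x => x + s * h x - (z 0%N - 1)) \_ D) x.
have mX0 : measurable_fun setT X0.
  apply: measurable_funD => //; apply/(measurable_restrictT _ _).1 => //.
  apply: measurable_funTS; apply: measurable_funB => //.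
  by apply: measurable_funD => //; apply: measurable_funM => //; exact: bh.1.
pose X : {mfun T >-> T} := HB.pack X0 (isMeasurableFun.Build _ _ _ _ X0 mX0).
have XE x : D x -> X x = x + s * h x.
  by move=> Dx; rewrite /X/= /X0 patchE mem_set// addrC subrK.
(* No point leaves [D]: [h] has a factor [x - z_0] and a factor [x - z_(K-1)], so the displacement
   is at most half the distance to either endpoint. *)
have XD : X @^-1` D = D.
  apply/seteqP; split=> x /=; rewrite /X/= /X0 patchE; case: ifPn => [/set_mem Dx|Dx].
  - by [].
  - by rewrite addr0 in_itv/= => /andP[]; lra.
  - have K1 : (K.-1 < K)%N by lia. have K0 : (0 < K)%N by lia.
    move=> _; rewrite addrC subrK.
    have := Dx; rewrite /= !in_itv/= => /andP[x1 x2].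
    have := hs _ (hB _ _ K0 Dx); rewrite ler_norml => /andP[q1 _].
    have := hs _ (hB _ _ K1 Dx); rewrite ler_norml => /andP[q2 _].
    have e1 := hhj x _ Dx K0; have e2 := hhj x _ Dx K1.
    apply/andP; split.
      by rewrite e1; nra.
    by rewrite e2; nra.
  - by move=> Dx'; move: Dx; rewrite mem_set.
have nuD : unit_measure_on (z 0%N) (z K.-1) (distribution P X).
  split; first exact: probability_setT.
  rewrite /distribution /pushforward.
  by change (P (~` (X @^-1` D)) = 0%E); rewrite XD.
have push := @energy_push _ _ _ _ R P X D mD nuD.2 kern c mkern c0 kc.
have N0 : exists2 N, 0 <= N & forall y, (D `*` D) y -> `|s * m y| <= N.
  have [_ [N mN]] := bfunZ s bm; exists `|N| => // y Dy.
  by apply: le_trans (mN y Dy) _; exact: ler_norm.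
have [N N0' mN] := N0.
have C0 : 0 <= C.
  have S0 : 0 <= \sum_(j < K) pw j by apply: sumr_ge0 => j _; rewrite ltW// hp.
  by rewrite /C; have := sqr_ge0 B; nra.
(* [r] is the bound for the increase of the kernel, raised by [N] to be nonnegative; the same [N] is
   added to the other side. *)
pose r (y : T * T) := (C * s ^+ 2 + N) + - (s * m y).
have br : bfun (D `*` D) r by apply: bfunD; [exact: bfun_cst|exact/bfunN/bfunZ].
have r0 y : (D `*` D) y -> 0 <= r y.
  move=> Dy; have := mN y Dy; rewrite ler_norml => /andP[_].
  by have : 0 <= C * s ^+ 2 by [rewrite mulr_ge0 ?sqr_ge0|]; rewrite /r; lra.
have Er : Ex (P \x P)%E (D `*` D) r = C * s ^+ 2 + N - s * Ex (P \x P)%E (D `*` D) m.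
  rewrite (ExD mDD PP1); [|exact: bfun_cst|exact/bfunN/bfunZ].
  by rewrite (ExN mDD PP1) ?(ExZ mDD PP1)// ?(Ex_cst mDD PP1)//; exact: bfunZ.
have ptw y : (D `*` D) y ->
    (kern (X y.1, X y.2) + c%:E + N%:E <= kern y + c%:E + (r y)%:E)%E.
  case: y => x t Dxt.
  have Dx : D x by case: Dxt.
  have Dt : D t by case: Dxt.
  rewrite -[(x, t).1]/x -[(x, t).2]/t (XE x Dx) (XE t Dt).
  rewrite -[leLHS]/(log_kernel w (x + s * h x) (t + s * h t) + c%:E + N%:E)%E.
  rewrite -[kern _]/(log_kernel w x t).
  have := @log_kernel_variation R K A z pw hA hp x t (h x) (h t) (g (x, t)) B s
     (hj ^~ x) (hj ^~ t) (fun j => hhj x j Dx) (fun j => hhj t j Dt) (hg x t Dx Dt)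
     (gB (x, t) (conj Dx Dt)) (fun j jK => hB j x jK Dx) (fun j jK => hB j t jK Dt) sB.
  rewrite -/C => H; apply: (@le_trans _ _ (log_kernel w x t + (- (s * m (x, t)) + C * s ^+ 2)%:E + c%:E + N%:E)%E).
    by rewrite leeD2r// leeD2r.
  by rewrite -!addeA -!EFinD leeD2l// lee_fin; exact: arith1.
have mkc : measurable_fun setT (fun y => kern y + c%:E)%E by exact: emeasurable_funD.
have mX : measurable_fun setT X by exact: measurable_funP.
have mXX : measurable_fun setT (fun y : T * T => (X y.1, X y.2)).
  by apply/measurable_fun_pair; exact: measurableT_comp.
have mkX : measurable_fun setT (fun y => kern (X y.1, X y.2) + c%:E)%E.
  by apply: emeasurable_funD => //; exact: (measurableT_comp mkern mXX).
have kX0 y : (D `*` D) y -> (0 <= kern (X y.1, X y.2) + c%:E)%E.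
  move=> [D1 D2]; apply: kc.
  - by move: D1; rewrite -{1}XD.
  - by move: D2; rewrite -{1}XD.
have main : (wenergy w P + c%:E + N%:E <= wenergy w P + c%:E + (C * s ^+ 2 + N - s * Ex (P \x P)%E (D `*` D) m)%:E)%E.
  apply: (@le_trans _ _ (wenergy w (distribution P X) + c%:E + N%:E)%E).
    by rewrite leeD2r// leeD2r//; exact: Pmin.
  rewrite -Er.
  have -> : (wenergy w (distribution P X) + c%:E =
     \int[(P \x P)]_(y in D `*` D) (kern (X y.1, X y.2) + c%:E))%E.
    by rewrite -[in RHS]XD -push.
  have -> : (wenergy w P + c%:E = \int[(P \x P)]_(y in D `*` D) (kern y + c%:E))%E.
    exact: energy_shift.
  apply: (le_integral_shift mDD PP1) => //.
  by case=> x t [? ?]; exact: kc.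
move: main; rewrite -(fineK wenergy_fin_num) -!EFinD lee_fin; exact: arith2.
Qed.

End FirstVariation.

(** * Existence of the equilibrium measure *)

Section Uniform01.
Context (R : realType).
Local Notation T := (measurableTypeR R).

Definition unif01 : probability T R := uniform_prob (@ltr01 R).

Lemma unif01E (B : set T) : measurable B ->
  unif01 B = lebesgue_measure (B `&` `[0, 1]%classic).
Proof.
move=> mB; rewrite /unif01 /= /uniform_prob integral_uniform_pdf.
rewrite (eq_integral (cst 1%E)); last first.
  move=> x /[!inE] -[_]; rewrite /= in_itv/= /uniform_pdf => ->.
  by rewrite subr0 invr1.
rewrite integral_cst ?mul1e//; exact: measurableI.
Qed.

Lemma unif01_le (y : R) : 0 <= y <= 1 -> unif01 [set s | s <= y] = y%:E.
Proof.
move=> /andP[y0 y1].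
have -> : [set s | s <= y] = `]-oo, y]%classic :> set R.
  by apply/seteqP; split => x /=; rewrite in_itv.
rewrite unif01E; last exact: measurable_itv.
have -> : `]-oo, y] `&` `[0, 1] = `[0, y]%classic :> set R.
  by apply/seteqP; split => x /=; rewrite !in_itv/=; [move=> [? /andP[? ?]]|move=> /andP[? ?]; split]; lra.
rewrite lebesgue_measure_itv/= lte_fin; case: ltgtP y0 => // [_ _|<- _].
  by rewrite oppr0 adde0.
by [].
Qed.

Lemma unif01_countable0 (B : set T) : countable B -> unif01 B = 0%E.
Proof.
move=> cB; have mB : measurable B by exact: countable_measurable.
rewrite unif01E//; apply: countable_lebesgue_measure0.
by apply: sub_countable cB; apply: subset_card_le; exact: subIsetl.
Qed.

End Uniform01.

(** * Quantile functions of measures on an interval *)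

Section Quantile.
Context (R : realType) (a b : R).
Hypothesis ab : a <= b.
Local Notation T := (measurableTypeR R).
Local Notation D := (`[a, b]%classic : set T).
Variable P : probability T R.
Hypothesis PD : P (~` D) = 0%E.

Let F (x : R) : \bar R := P `]-oo, x]%classic.
(** The alternative [x = b] keeps the set nonempty for every real [s], so that the infimum always
    lies in [[a, b]]. *)
Let S (s : R) := [set x : R | a <= x <= b /\ ((s%:E <= F x)%E \/ x = b)].
Definition quantile (s : R) : R := inf (S s).

Let Sinf s : has_inf (S s).
Proof.
split; first by exists b; rewrite /S/= lexx ab; split=> //; right.
by exists a => x [/andP[]].
Qed.

Lemma quantile_in s : a <= quantile s <= b.
Proof.
apply/andP; split; first by apply: lb_le_inf; [exact: (Sinf s).1|move=> x [/andP[]]].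
apply: ge_inf; first exact: (Sinf s).2.
by rewrite /S/= lexx ab; split=> //; right.
Qed.

Lemma quantile_nondecreasing : {homo quantile : s t / s <= t}.
Proof.
move=> s t st; apply: lb_le_inf; first exact: (Sinf t).1.
move=> x [xab [tF|xb]]; apply: ge_inf; (try exact: (Sinf s).2); split=> //; [left|by right].
by apply: le_trans tF; rewrite lee_fin.
Qed.

Let F_nd x y : x <= y -> (F x <= F y)%E.
Proof.
move=> xy; apply: le_measure; rewrite ?inE; try exact: measurable_itv.
by move=> u /=; rewrite !in_itv/= => ?; lra.
Qed.

(** Galois connection between quantile and distribution function. The direct implication is right
    continuity of [F]; [x < b] keeps the extra element [b] of the set away. *)
Lemma quantile_le s x : a <= x < b -> (quantile s <= x) = (s%:E <= F x)%E.
Proof.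
move=> /andP[ax xb]; apply/idP/idP => [qx|sF]; last first.
  apply: ge_inf; first exact: (Sinf s).2.
  by split; [rewrite ax ltW|left].
have Fy y : x < y -> (s%:E <= F y)%E.
  move=> xy; have [xb' yb'] : x < Num.min y b /\ Num.min y b <= b.
    by rewrite lt_min xy xb ge_min lexx orbT.
  have [u [uab uS] uy] := inf_lt (Sinf s).1 (le_lt_trans qx xb').
  have uy' : u < y by rewrite (lt_le_trans uy)// ge_min lexx.
  case: uS => [sFu|ub]; first by apply: le_trans sFu _; exact/F_nd/ltW.
  by move: uy; rewrite ub ltNge yb'.
(* Right continuity, from continuity of [P] along a decreasing sequence of half-lines. *)
have c1 : F (x + n.+1%:R^-1) @[n --> \oo] --> F x.
  have -> : F x = P (\bigcap_n `]-oo, x + n.+1%:R^-1]%classic).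
    congr (P _); apply/seteqP; split.
    - move=> y yx n _; move: yx; rewrite /= !in_itv/= => yx.
      by rewrite (le_trans yx)// lerDl.
    - move=> y yn; rewrite /= in_itv/=; apply/ler_addgt0Pr => e e0.
      have xe : x < x + e by rewrite ltrDl.
      have [n xn] := ltr_add_invr xe.
      by apply: le_trans (ltW xn); have := yn n I; rewrite /= in_itv.
  apply: nonincreasing_cvg_mu => //.
  - by rewrite (le_lt_trans (probability_le1 _ _))// ?ltry//; exact: measurable_itv.
  - by apply: bigcapT_measurable => n; exact: measurable_itv.
  - move=> m n mn; apply/subsetPset => y /=; rewrite !in_itv/= => /le_trans; apply.
    by rewrite lerD2l lef_pV2 ?posrE// ler_nat.
rewrite -(cvg_lim _ c1)//; apply: lime_ge; first by apply/cvg_ex; exists (F x).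
by apply: nearW => n; apply: Fy; rewrite ltrDl.
Qed.

Lemma measurable_quantile : measurable_fun (setT : set T) (quantile : T -> T).
Proof.
by apply: nondecreasing_measurable => // s t *; exact: quantile_nondecreasing.
Qed.

Definition quantile_mfun : {mfun T >-> T} :=
  HB.pack (quantile : T -> T) (isMeasurableFun.Build _ _ T T quantile measurable_quantile).

(** Both measures have the same distribution function, hence agree on half-open intervals and, by
    uniqueness of Lebesgue-Stieltjes measures, on all Borel sets. *)
Lemma distribution_quantile (B : set T) : measurable B ->
  distribution (unif01 R) quantile_mfun B = P B.
Proof.
move=> mB; set Q := distribution _ _.
have QD : Q (~` D) = 0%E.
  rewrite /Q /distribution /pushforward (_ : _ @^-1` _ = set0) ?measure0//.
  apply/seteqP; split => // s; apply; rewrite /= in_itv/=; exact: quantile_in.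
have null (m : probability T R) (C : set T) :
    m (~` D) = 0%E -> measurable C -> C `<=` ~` D -> m C = 0%E.
  move=> mD0 mC CD; apply/eqP; rewrite eq_le measure_ge0 andbT -mD0 le_measure ?inE//.
  by apply: measurableC; exact: measurable_itv.
have eqF x : Q `]-oo, x]%classic = F x.
  have [xa|ax] := ltP x a.
    have sub : `]-oo, x]%classic `<=` ~` D.
      by move=> y /=; rewrite !in_itv/= => yx /andP[]; lra.
    have mx : measurable (`]-oo, x]%classic : set T) by exact: measurable_itv.
    by rewrite /F; apply: etrans (null Q _ QD mx sub) (esym (null P _ PD mx sub)).
  have [bx|xb] := leP b x.
    have sub : ~` `]-oo, x]%classic `<=` ~` D.
      by apply: subsetC => y /=; rewrite !in_itv/= => /andP[]; lra.
    have mx : measurable (~` (`]-oo, x]%classic : set T)) by apply: measurableC; exact: measurable_itv.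
    have full (m : probability T R) : m (~` D) = 0%E -> m `]-oo, x]%classic = 1%E.
      by move=> mD0; have := probability_setC m mx; rewrite setCK (null m _ mD0 mx sub) sube0.
    by rewrite /F; apply: etrans (full Q QD) (esym (full P PD)).
  rewrite /Q /distribution /pushforward.
  have Ffin : F x \is a fin_num by apply: fin_num_measure; exact: measurable_itv.
  have -> : quantile @^-1` `]-oo, x]%classic = [set s | s <= fine (F x)].
    have E s : (quantile s <= x) = (s <= fine (F x)).
      by rewrite quantile_le ?ax ?xb// -[X in (_ <= X)%E](fineK Ffin) lee_fin.
    by apply/seteqP; split => s /=; rewrite in_itv/= E.
  rewrite unif01_le ?fineK// fine_ge0//= -lee_fin fineK//.
  by apply: probability_le1; exact: measurable_itv.
rewrite -[RHS](lebesgue_stieltjes_cdf_id P mB); apply/esym.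
apply: lebesgue_stieltjes_measure_unique mB => X oX.
rewrite lebesgue_stieltjes_cdf_id; last first.
  by case: oX => -[u v] _ <-; exact: measurable_itv.
case: oX => -[u v] _ <- /=.
have -> : `]u, v]%classic = `]-oo, v] `\` `]-oo, u] :> set R.
  by apply/seteqP; split => y /=; rewrite !in_itv/=; [move=> /andP[? ?]; split|move=> [? /negP]; rewrite -ltNge => ?]; lra.
have mu1 (m : probability T R) : m (`]-oo, v] `\` `]-oo, u]) = (m `]-oo, v]%classic - m (`]-oo, v] `&` `]-oo, u])%classic)%E.
  apply: measureD; try exact: measurable_itv.
  by rewrite (le_lt_trans (probability_le1 _ _))// ?ltry//; exact: measurable_itv.
have e : `]-oo, v] `&` `]-oo, u] = `]-oo, Num.min v u]%classic :> set R.
  by apply/seteqP; split => y /=; rewrite !in_itv/= le_min; [move=> [-> ->]|move=> /andP[]].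
have E : (P `]-oo, v]%classic - P (`]-oo, v] `&` `]-oo, u])%classic =
          Q `]-oo, v]%classic - Q (`]-oo, v] `&` `]-oo, u])%classic)%E.
  by rewrite e !eqF.
exact: etrans (mu1 P) (etrans E (esym (mu1 Q))).
Qed.

End Quantile.

(** * Helly selection for monotone functions *)

Section Helly.
Context (R : realType).

(** For nondecreasing [q] this is discontinuity at [s], expressed without one-sided limits. *)
Definition jump (q : R -> R) (s : R) :=
  exists2 e, 0 < e & forall d, 0 < d -> e <= q (s + d) - q (s - d).

(** The intervals between left and right limits at distinct jumps are disjoint, and each receives a
    rational number. *)
Lemma countable_jump (q : R -> R) : {homo q : s t / s <= t} -> countable (jump q).
Proof.
move=> qnd.
have /choice[r hr] s : exists r : rat, jump q s ->
    forall d, 0 < d -> q (s - d) < ratr r < q (s + d).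
  have [[e e0 H]|nj] := pselect (jump q s); last by exists 0.
  (* [L] is the left limit at [s]; a jump of size [e] leaves room for a rational in []L, L + e[]. *)
  pose L := sup [set q (s - d) | d in [set d | 0 < d]].
  have supL : has_sup [set q (s - d) | d in [set d : R | 0 < d]].
    split; first by exists (q (s - 1)); exists 1 => //=.
    by exists (q s) => _ [d /= d0 <-]; apply: qnd; lra.
  have Le : L < L + e by lra.
  have [r /andP[Lr re]] := rat_in_itvoo Le.
  exists r => _ d d0; apply/andP; split.
    by apply: le_lt_trans Lr; apply: ub_le_sup; [exact: supL.2|exists d].
  apply: lt_le_trans re _; rewrite -lerBrDr; apply: ge_sup; first exact: supL.1.
  move=> _ [d' /= d'0 <-].
  have m0 : 0 < Num.min d d' by rewrite lt_min d0.
  have h1 : q (s + Num.min d d') <= q (s + d) by apply: qnd; rewrite lerD2l ge_min lexx.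
  have [dd'|d'd] := leP d d'.
    have := H _ d0; have : q (s - d') <= q (s - d) by apply: qnd; lra.
    lra.
  have := H _ d'0; have : q (s + d') <= q (s + d) by apply: qnd; lra.
  lra.
apply/countable_injP; exists (fun s => choice.pickle (r s)).
have wlog_lt s t : jump q s -> jump q t -> s < t -> r s = r t -> False.
  move=> js jt st rst; pose d := (t - s) / 2.
  have d0 : 0 < d by rewrite divr_gt0// subr_gt0.
  have /andP[_ h1] := hr s js d d0; have /andP[h2 _] := hr t jt d d0.
  have e : s + d = t - d by rewrite /d; field.
  by move: h1 h2; rewrite e rst => /lt_trans h /h; rewrite ltxx.
move=> s t /[!inE] js jt /(pcan_inj choice.pickleK) rst.
case: (ltgtP s t) => // st.
- by case: (wlog_lt s t).
- by case: (wlog_lt t s).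
Qed.

Lemma ultrafilter_limit (a b : R) (U : set_system nat) (u : nat -> R) :
  UltraFilter U -> (forall n, a <= u n <= b) ->
  exists2 l, a <= l <= b & u @ U --> l.
Proof.
move=> UU uab.
have uA : (u @ U) `[a, b]%classic by apply: (@filterE _ U) => n; rewrite /= in_itv/=; exact: uab.
have UP : ProperFilter (u @ U) by exact: fmap_proper_filter.
have [l [lab cl]] := @segment_compact R a b (u @ U) UP uA.
exists l => // B nB; have [//|UB] := in_ultra_setVsetC (u @^-1` B) UU.
have [y [By nBy]] := cl (~` B) B UB nB.
by [].
Qed.

(** Limits along an ultrafilter exist for all [s] at once and define [q0] without a diagonal
    extraction. Indices [n_ k] are then chosen with [q (n_ k)] close to [q0] on the grid
    [i / (k + 1)], and monotonicity carries convergence to the continuity points of [q0]. *)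
Lemma helly (a b : R) (q : nat -> R -> R) :
  (forall n s, a <= q n s <= b) -> (forall n, {homo q n : s t / s <= t}) ->
  exists (n_ : nat -> nat) (q0 : R -> R),
    [/\ forall k, (k <= n_ k)%N, forall s, a <= q0 s <= b, {homo q0 : s t / s <= t} &
    forall s, 0 <= s < 1 -> ~ jump q0 s -> q (n_ k) s @[k --> \oo] --> q0 s].
Proof.
move=> qab qnd.
have [U [UU sU]] := ultraFilterLemma (F := \oo%classic : set_system nat) _.
have /choice[q0 hq0] s : exists l, a <= l <= b /\ q ^~ s @ U --> l.
  by have [l lab ql] := ultrafilter_limit UU (fun n => qab n s); exists l.
have q0nd : {homo q0 : s t / s <= t}.
  move=> s t st; have [_ qs] := hq0 s; have [_ qt] := hq0 t.
  rewrite -(cvg_lim _ qs)// -(cvg_lim _ qt)//.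
  apply: ler_lim; [by apply/cvg_ex; exists (q0 s)|by apply/cvg_ex; exists (q0 t)|].
  by apply: nearW => n; exact: qnd.
have /choice[n_ hn] k : exists n, (k <= n)%N /\
    forall i, (i <= k.+1)%N -> `|q n (i%:R / k.+1%:R) - q0 (i%:R / k.+1%:R)| < k.+1%:R^-1.
  suff H : \forall n \near U, (k <= n)%N /\ forall i, (i <= k.+1)%N ->
      `|q n (i%:R / k.+1%:R) - q0 (i%:R / k.+1%:R)| < k.+1%:R^-1.
    by have [n hn] := filter_ex H; exists n.
  apply: filterI; first by apply: sU; exists k.
  have H i : \forall n \near U, `|q n (i%:R / k.+1%:R) - q0 (i%:R / k.+1%:R)| < k.+1%:R^-1.
    have /cvgrPdist_lt/(_ k.+1%:R^-1) := (hq0 (i%:R / k.+1%:R)).2.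
    rewrite invr_gt0 ltr0n => /(_ isT); apply: filterS => n.
    by rewrite distrC.
  have : forall m, \forall n \near U, forall i, (i <= m)%N ->
      `|q n (i%:R / k.+1%:R) - q0 (i%:R / k.+1%:R)| < k.+1%:R^-1.
    elim=> [|m ih]; first by apply: filterS (H 0%N) => n + i; rewrite leqn0 => + /eqP ->.
    apply: filterS2 ih (H m.+1) => n h1 h2 i; rewrite leq_eqVlt => /predU1P[->//|].
    by rewrite ltnS; exact: h1.
  exact.
exists n_, q0; split=> //.
- by move=> k; have [] := hn k.
- by move=> s; have [] := hq0 s.
move=> s /andP[s0 s1] njump; apply/cvgrPdist_lt => e e0.
have [d d0 dq] : exists2 d, 0 < d & q0 (s + d) - q0 (s - d) < e / 2.
  apply: contrapT => nd; apply: njump; exists (e / 2); first by rewrite divr_gt0.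
  move=> d d0; rewrite leNgt; apply/negP => dq; apply: nd; by exists d.
have m0 : 0 < Num.min d (e / 2) by rewrite lt_min d0 divr_gt0.
near=> k.
have km : k.+1%:R^-1 < Num.min d (e / 2).
  near: k; exact: (near_infty_natSinv_lt (PosNum m0)).
have [kd ke] : k.+1%:R^-1 < d /\ k.+1%:R^-1 < e / 2 by move: km; rewrite lt_min => /andP.
have kp : 0 < k.+1%:R :> R by rewrite ltr0n.
have [_ grid] := hn k.
(* [s] lies between two consecutive grid points. The values of [q (n_ k)] there enclose its value at
   [s], and those of [q0] differ by less than [e / 2]. *)
pose i := Num.truncn (s * k.+1%:R).
have sk0 : 0 <= s * k.+1%:R by rewrite mulr_ge0// ltW.
have /andP[i1 i2] := truncn_itv sk0.
have ik : (i < k.+1)%N.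
  by rewrite -(ltr_nat R); apply: le_lt_trans i1 _; rewrite gtr_pMl.
have lo : i%:R / k.+1%:R <= s by rewrite ler_pdivrMr.
have hi : s <= i.+1%:R / k.+1%:R by rewrite ler_pdivlMr// ltW.
have step : i.+1%:R / k.+1%:R = i%:R / k.+1%:R + k.+1%:R^-1 :> R.
  by rewrite -natr1 mulrDl mul1r.
have g1 := grid _ (ltnW ik); have g2 := grid _ ik.
have q1 := qnd (n_ k) _ _ lo; have q2 := qnd (n_ k) _ _ hi.
move: lo hi q1 q2 g1 g2; rewrite step.
set y := i%:R / k.+1%:R; set h := k.+1%:R^-1 in kd ke *; move=> lo hi q1 q2 g1 g2.
have r1 : q0 (s - d) <= q0 y by apply: q0nd; lra.
have r2 : q0 (y + h) <= q0 (s + d) by apply: q0nd; lra.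
have r3 := q0nd _ _ lo; have r4 := q0nd _ _ hi.
move: g1 g2; rewrite !ltr_norml => /andP[? ?] /andP[? ?].
apply/andP; split; lra.
Unshelve. all: by end_near.
Qed.

End Helly.

(** * Continuity of the kernel with values in the extended reals *)

Section KernelContinuity.
Context (R : realType).

Lemma cvgn_ge0 (u : nat -> R) (l : R) : (forall n, 0 <= u n) -> u @ \oo --> l -> 0 <= l.
Proof.
move=> u0 ul; rewrite -(cvg_lim _ ul)//; apply: limr_ge; first by apply/cvg_ex; exists l.
exact: nearW.
Qed.

Lemma cvg_powR (u : nat -> R) (l p : R) : 0 < p -> (forall n, 0 <= u n) ->
  u @ \oo --> l -> (fun n => powR (u n) p) @ \oo --> powR l p.
Proof.
move=> p0 u0 ul; have l0 : 0 <= l by exact: cvgn_ge0 ul.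
have [ln0|l0'] := eqVneq l 0.
  rewrite ln0 powR0 ?gt_eqF//; apply/cvgr0Pnorm_lt => e e0.
  have e1 : 0 < powR e p^-1 by exact: powR_gt0.
  have : \forall n \near \oo, `|u n| < powR e p^-1.
    by move: ul; rewrite ln0 => /cvgr0Pnorm_lt; exact.
  apply: filterS => n; rewrite !ger0_norm ?powR_ge0// => un.
  have -> : e = powR (powR e p^-1) p by rewrite -powRrM mulVf ?gt_eqF// powRr1// ltW.
  by apply: gt0_ltr_powR; rewrite ?nnegrE ?powR_ge0.
have lp : 0 < l by rewrite lt_neqAle eq_sym l0' l0.
have un0 : \forall n \near \oo, 0 < u n by apply: cvgr_gt ul _ lp.
rewrite /powR (gt_eqF lp); apply: (@cvg_trans _ ((fun n => expR (p * ln (u n))) @ \oo)).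
  apply: near_eq_cvg; near=> n.
  by rewrite gt_eqF//; near: n.
apply: continuous_cvg; first exact: continuous_expR.
apply: cvgM; first exact: cvg_cst.
by apply: continuous_cvg => //; exact: continuous_ln.
Unshelve. all: by end_near. Qed.

(** Minus the logarithm, continued by its limit at [0]. In this form the kernel is sequentially
    continuous, its infinite values included. *)
Definition nlog (y : R) : \bar R := if y == 0 then +oo%E else (- ln y)%:E.

Lemma cvg_nlog (u : nat -> R) (l : R) : (forall n, 0 <= u n) ->
  u @ \oo --> l -> (fun n => nlog (u n)) @ \oo --> nlog l.
Proof.
move=> u0 ul; have l0 : 0 <= l by exact: cvgn_ge0 ul.
rewrite {2}/nlog; case: eqVneq => [ln0|l0'].
  apply/cvgeyPge => M; have : \forall n \near \oo, `|u n| < expR (- M).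
    by move: ul; rewrite ln0 => /cvgr0Pnorm_lt; apply; exact: expR_gt0.
  apply: filterS => n; rewrite ger0_norm// /nlog; case: eqVneq => [_ _|n0 un]; first exact: leey.
  have un0 : 0 < u n by rewrite lt_neqAle eq_sym n0 u0.
  by rewrite lee_fin lerNr -[leRHS](expRK) ler_ln ?posrE ?expR_gt0// ltW.
have lp : 0 < l by rewrite lt_neqAle eq_sym l0' l0.
have un0 : \forall n \near \oo, 0 < u n by apply: cvgr_gt ul _ lp.
apply: (@cvg_trans _ ((fun n => (- ln (u n))%:E) @ \oo)).
  by apply: near_eq_cvg; near=> n; rewrite /nlog gt_eqF//; near: n.
apply: cvg_EFin; first exact: nearW.
by apply: cvgN; apply: continuous_cvg => //; exact: continuous_ln.
Unshelve. all: by end_near. Qed.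

Context (K : nat) (A : R) (z pw : nat -> R).
Hypothesis hp : forall i : nat, (i < K)%N -> 0 < pw i.
Hypothesis hA : 0 < A.
Local Notation w := (weightw K A z pw).

Lemma cvg_weightw (u : nat -> R) (l : R) : u @ \oo --> l -> (fun n => w (u n)) @ \oo --> w l.
Proof.
move=> ul; apply: cvgM; first exact: cvg_cst.
apply: (cvg_big mul_continuous) => i _; apply: cvg_powR => //; first exact: hp.
by apply: cvg_norm; apply: cvgB => //; exact: cvg_cst.
Qed.

Lemma log_kernelE x t : log_kernel w x t = nlog (`|x - t| * w x * w t).
Proof.
rewrite /log_kernel /nlog !mulf_eq0 normr_eq0 subr_eq0.
by case: ifP.
Qed.

Lemma cvg_log_kernel (u v : nat -> R) (x t : R) : u @ \oo --> x -> v @ \oo --> t ->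
  (fun n => log_kernel w (u n) (v n)) @ \oo --> log_kernel w x t.
Proof.
move=> ux vt; rewrite log_kernelE; under eq_fun do rewrite log_kernelE.
apply: cvg_nlog => [n|]; first by do 2 (apply: mulr_ge0; last exact: weightw_ge0).
apply: cvgM; last exact: cvg_weightw.
apply: cvgM; last exact: cvg_weightw.
by apply: cvg_norm; exact: cvgB.
Qed.

End KernelContinuity.

(** * A measure of finite energy *)

Section FiniteEnergy.
Context (R : realType).

(* A layer-cake majorant of [- ln |u|], valued [+oo] at [0]. *)
Definition log_layers (u : R) : \bar R :=
  (\sum_(n <oo) (\1_[set v : R | (`|v| <= 2^-1 ^+ n)%R] u)%:E)%E.

(** At least [m] layers contain [u] once [|u| <= 2 ^- n] for all [n < m]. Since [e ^- n <= 2 ^- n],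
    this holds with [m] one more than the integer part of [- ln |u|]. *)
Lemma nlog_layers (u : R) : (nlog `|u| <= log_layers u)%E.
Proof.
have ge m : (forall n, (n < m)%N -> `|u| <= 2^-1 ^+ n) -> (m%:R%:E <= log_layers u)%E.
  move=> um; apply: le_trans (nneseries_lim_ge m _); last by move=> n _ _; rewrite lee_fin.
  rewrite sumEFin lee_fin big_mkord (eq_bigr (fun=> 1)); last first.
    by move=> i _; rewrite indicE mem_set//=; exact: um.
  by rewrite big_const_ord iter_addr addr0.
have half n : expR (- n%:R) <= 2^-1 ^+ n :> R.
  rewrite -mulN1r expRM_natr; apply: lerXn2r; rewrite ?nnegrE ?expR_ge0//.
  rewrite expRN lef_pV2 ?posrE ?expR_gt0//.
  by have := expR_ge1Dx (1 : R); lra.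
rewrite /nlog; case: eqVneq => [u0|u0].
  suff -> : log_layers u = +oo%E by [].
  apply/eqyP => M M0.
  apply: le_trans (ge (Num.truncn M).+1 _); first by rewrite lee_fin ltW// truncnS_gt.
  by move=> n _; rewrite u0 exprn_ge0.
have up : 0 < `|u| by rewrite normr_gt0 -normr_eq0.
have [l0|l0] := leP 0 (- ln `|u|); last first.
  by apply: (@le_trans _ _ 0%E); [rewrite lee_fin ltW|apply: nneseries_ge0 => n _ _; rewrite lee_fin].
apply: le_trans (ge (Num.truncn (- ln `|u|)).+1 _); first by rewrite lee_fin ltW// truncnS_gt.
move=> n; rewrite ltnS => nt; apply: le_trans (half n).
rewrite -[leLHS]lnK ?posrE// ler_expR lerNr.
have /andP[tl _] := truncn_itv l0.
by apply: le_trans tl; rewrite ler_nat.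
Qed.

End FiniteEnergy.

Section ProductCarrier.
Context d (T : measurableType d) (R : realType).
Variables (P : probability T R) (I : set T).
Hypotheses (mI : measurable I) (PI : P (~` I) = 0%E).

Lemma ge0_prod_carrier (f : T * T -> \bar R) : measurable_fun setT f ->
  (forall y, 0 <= f y)%E ->
  (\int[(P \x P)]_y f y = \int[(P \x P)]_(y in I `*` I) f y)%E.
Proof.
move=> mf f0; have mII : measurable (I `*` I) by exact: measurableX.
have PP1 := prodD1 mI (prob_carrier1 mI PI).
have PPT : (P \x P)%E setT = 1%E.
  rewrite -setXTT; apply: prodD1 => //; exact: probability_setT.
have PPc : (P \x P)%E (~` (I `*` I)) = 0%E.
  rewrite -setTD measureD//; last by rewrite [X in (X < _)%E]PPT ltry.
  by rewrite setTI [X in (X - _)%E]PPT [X in (_ - X)%E]PP1 subee.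
have mc : measurable (~` (I `*` I)) by exact: measurableC.
by rewrite (ge0_negligible_integral mc measurableT mf)// setTD setCK.
Qed.

End ProductCarrier.

Section ProbabilityOfMeasure.
Context d (T : measurableType d) (R : realType) (mu : {measure set T -> \bar R}).
Hypothesis mu1 : mu setT = 1%E.

(** A copy of [mu] that carries the proof of mass one, so that the probability structure can be
    attached to it. *)
Definition prob_of of mu setT = 1%E : set T -> \bar R := mu.

HB.instance Definition _ := isMeasure.Build _ _ _ (prob_of mu1)
  (measure0 mu) (measure_ge0 mu) (@measure_semi_sigma_additive _ _ _ mu).
HB.instance Definition _ := Measure_isProbability.Build _ _ _ (prob_of mu1) mu1.

End ProbabilityOfMeasure.

Section WeightedEnergy.
Context (R : realType).
Local Notation T := (measurableTypeR R).
Local Notation I01 := (`[(0 : R), (1 : R)]%classic : set (measurableTypeR R)).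

Lemma eq_wenergy (w : R -> R) (mu nu : {measure set T -> \bar R}) :
  (forall B, measurable B -> mu B = nu B) -> wenergy w mu = wenergy w nu.
Proof.
move=> e; rewrite /wenergy (eq_measure_integral nu); last by move=> B mB _; exact: e.
by apply: eq_integral => x _; apply: eq_measure_integral => B mB _; exact: e.
Qed.

Lemma unit_measure_probability (mu : {measure set T -> \bar R}) : mu setT = 1%E ->
  exists P : probability T R, forall B, P B = mu B.
Proof. by move=> mu1; exists (prob_of mu1). Qed.

Lemma measurable_log_layers : measurable_fun setT (@log_layers R).
Proof.
rewrite /log_layers; apply: ge0_emeasurable_sum => [n u _ _|n _]; first by rewrite lee_fin.
apply/measurable_EFinP; apply: measurable_indic.
rewrite (_ : [set v | _] = `[- (2^-1 ^+ n), 2^-1 ^+ n]%classic); first exact: measurable_itv.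
by apply/seteqP; split => v /=; rewrite in_itv/= ler_norml.
Qed.

Lemma log_layers_ge0 (u : R) : (0 <= log_layers u)%E.
Proof. by apply: nneseries_ge0 => n _ _; rewrite lee_fin. Qed.

(** The layer of index [n] is an interval of length [2 * 2 ^- n] about [s], and these lengths add up
    to [4]. *)
Lemma integral_log_layers (s : R) :
  (\int[unif01 R]_(t in I01) log_layers (s - t) <= 4%:E)%E.
Proof.
have mst : measurable_fun setT (fun t : R => s - t) by exact: measurable_funB.
have mB n : measurable ((fun t : R => s - t) @^-1` [set v : R | `|v| <= 2^-1 ^+ n]).
  rewrite (_ : _ @^-1` _ = `[s - 2^-1 ^+ n, s + 2^-1 ^+ n]%classic); first exact: measurable_itv.
  by apply/seteqP; split => v /=; rewrite in_itv/= ler_norml => /andP[? ?]; apply/andP; split; lra.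
rewrite /log_layers integral_nneseries//; last first.
  by move=> n; apply/measurable_EFinP; apply: measurable_funTS; apply: measurable_indic (mB n).
have geo : (\sum_(n <oo) (4 / (2 ^ (n + 1))%:R : R)%:E = 4%:E)%E.
  apply/cvg_lim => //; have := @cvg_geometric_eseries_half R 4 0.
  by rewrite expr0 divr1.
rewrite -geo; apply: lee_nneseries.
  by move=> n _ _; apply: integral_ge0 => t _; rewrite lee_fin.
move=> n _.
rewrite (_ : (fun x : R => _) = (fun t : R => (\1_((fun t : R => s - t) @^-1` [set v : R | `|v| <= 2^-1 ^+ n]) t)%:E)); last first.
  by apply/funext => t; rewrite !indicE.
rewrite integral_indic//; last exact: mB.
apply: (@le_trans _ _ (lebesgue_measure (`[s - 2^-1 ^+ n, s + 2^-1 ^+ n]%classic : set T))).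
  apply: (@le_trans _ _ (lebesgue_measure ((fun t : R => s - t) @^-1` [set v : R | `|v| <= 2^-1 ^+ n] `&` I01 `&` I01))).
    rewrite -unif01E; first exact: lexx.
    by apply: measurableI; [exact: mB|exact: measurable_itv].
  apply: le_measure; rewrite ?inE.
  - apply: measurableI; last exact: measurable_itv.
    by apply: measurableI; [exact: mB|exact: measurable_itv].
  - exact: measurable_itv.
  - by move=> v [[]] /=; rewrite !in_itv/= ler_norml => /andP[? ?] _ _; apply/andP; split; lra.
rewrite lebesgue_measure_itv/= lte_fin ifT; last first.
  have : 0 < 2^-1 ^+ n :> R by rewrite exprn_gt0.
  by lra.
rewrite -EFinB lee_fin natrX exprD expr1 exprVn.
have e0 : 2 ^+ n != 0 :> R by rewrite expf_neq0.
rewrite le_eqVlt; apply/orP; left; apply/eqP; field.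
by rewrite e0.
Qed.

Lemma finite_prod_log_layers :
  (\int[(unif01 R \x unif01 R)]_(y in I01 `*` I01)
     log_layers (y.1 - y.2) <= 4%:E)%E.
Proof.
have mI : measurable I01 by exact: measurable_itv.
have I0 : unif01 R (~` I01) = 0%E.
  by rewrite unif01E ?setICl ?measure0//; exact: measurableC.
have mf : measurable_fun setT (fun y : T * T => log_layers (y.1 - y.2)).
  by apply: (measurableT_comp measurable_log_layers); exact: measurable_funB.
rewrite -(ge0_prod_carrier mI I0)//; last by move=> y; exact: log_layers_ge0.
rewrite fubini_tonelli1//; last by move=> y; exact: log_layers_ge0.
apply: (@le_trans _ _ (\int[unif01 R]_x 4%:E)%E); last first.
  by rewrite integral_cst//= [X in (_ * X)%E]probability_setT mule1.
apply: ge0_le_integral => //.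
- by move=> x _; apply: integral_ge0 => t _; exact: log_layers_ge0.
- apply: measurable_fun_fubini_tonelli_F => // y; exact: log_layers_ge0.
move=> x _; rewrite /fubini_F /= (ge0_integral_carrier mI I0).
- exact: integral_log_layers.
- by apply: (measurableT_comp measurable_log_layers); exact: measurable_funB.
- by move=> t; exact: log_layers_ge0.
Qed.

End WeightedEnergy.

Section Existence.
Context (R : realType) (K : nat) (A : R) (z pw : nat -> R).
Hypotheses (hK : (2 <= K)%N) (hA : 0 < A).
Hypothesis hp : forall i : nat, (i < K)%N -> 0 < pw i.
Hypothesis hz : forall i : nat, (i.+1 < K)%N -> z i < z i.+1.
Local Notation w := (weightw K A z pw).
Local Notation T := (measurableTypeR R).
Local Notation a := (z 0%N).
Local Notation b := (z K.-1).
Local Notation D := (`[a, b]%classic : set T).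
Local Notation U := (unif01 R).
Local Notation I01 := (`[(0 : R), (1 : R)]%classic : set T).

Let kern (y : T * T) := log_kernel w y.1 y.2.
Let mkern : measurable_fun setT kern.
Proof. exact: measurable_log_kernel. Qed.
Let mD : measurable D.
Proof. exact: measurable_itv. Qed.
Let mI : measurable I01.
Proof. exact: measurable_itv. Qed.
Let UI : U (~` I01) = 0%E.
Proof. by rewrite unif01E ?setICl ?measure0//; exact: measurableC. Qed.
Let UU1 : (U \x U)%E (I01 `*` I01) = 1%E.
Proof. exact: prodD1 mI (prob_carrier1 mI UI). Qed.

Lemma unit_measure_distribution (X : {mfun T >-> T}) : (forall s, D (X s)) ->
  unit_measure_on a b (distribution U X).
Proof.
move=> XD; split; first exact: probability_setT.
have e : X @^-1` (~` D) = set0 by apply/seteqP; split => // s; apply; exact: XD.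
by change (U (X @^-1` (~` D)) = 0%E); rewrite e measure0.
Qed.

Lemma wenergy_unif01 (X : {mfun T >-> T}) (c : R) : (forall s, D (X s)) -> 0 <= c ->
  (forall x t, D x -> D t -> (0 <= log_kernel w x t + c%:E)%E) ->
  (wenergy w (distribution U X) + c%:E =
   \int[(U \x U)]_(y in I01 `*` I01) (kern (X y.1, X y.2) + c%:E))%E.
Proof.
move=> XD c0 kc.
have XT : X @^-1` D = setT by apply/seteqP; split => // s _; exact: XD.
rewrite /wenergy (@energy_push _ _ _ _ R U X D mD (unit_measure_distribution XD).2 kern c mkern c0 kc).
rewrite XT setXTT.
have mX : measurable_fun setT (fun y : T * T => (X y.1, X y.2)).
  by apply/measurable_fun_pair; exact: measurableT_comp.
apply: (ge0_prod_carrier mI UI (f := fun y => kern (X y.1, X y.2) + c%:E)%E).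
- by apply: emeasurable_funD => //; exact: (measurableT_comp mkern mX).
- by case=> s t; apply: kc; exact: XD.
Qed.

Lemma le_nlog (x y : R) : 0 <= x -> x <= y -> (nlog y <= nlog x)%E.
Proof.
move=> x0 xy; rewrite /nlog; case: (eqVneq x 0) => [_|xn0]; first exact: leey.
have xp : 0 < x by rewrite lt_neqAle eq_sym xn0.
rewrite gt_eqF ?lee_fin ?lerN2 ?ler_ln ?posrE//; exact: lt_le_trans xy.
Qed.

Lemma nlogM (x q : R) : 0 < q -> 0 <= x -> nlog (x * q) = (nlog x + (- ln q)%:E)%E.
Proof.
move=> q0 x0; rewrite /nlog mulf_eq0 (gt_eqF q0) orbF.
case: (eqVneq x 0) => [_|xn0]; first by rewrite addye.
by rewrite lnM ?posrE// ?lt_neqAle 1?eq_sym ?xn0// opprD EFinD.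
Qed.

(** The uniform law on the middle third of [[z_0, z_1]] serves: every [|x - z_i|] is at least [dl]
    there, so [w] is bounded below and only the singularity of [- ln |s - t|] remains, which the
    layers integrate. *)
Lemma exists_finite_energy :
  exists2 nu : {measure set T -> \bar R}, unit_measure_on a b nu & (wenergy w nu < +oo)%E.
Proof.
have [c c0 kc] := log_kernel_lbound hK hA hp hz.
pose dl := (z 1%N - z 0%N) / 3.
have z01 : z 0%N < z 1%N by apply: (z_lt hz); lia.
have dl0 : 0 < dl by rewrite divr_gt0 ?subr_gt0.
have z1b : z 1%N <= b by apply: (z_le hz); lia.
have dle : 3 * dl = z 1%N - a by rewrite /dl; field.
(* The clamp to [[0, 1]] keeps the values in [D] for every real [s]; it is the identity where the
   uniform law lives. *)
pose X0 (s : T) : T := a + dl + dl * Num.max 0 (Num.min 1 s).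
have X0b s : a + dl <= X0 s <= a + 2 * dl.
  have m0 : 0 <= Num.max 0 (Num.min 1 s) by rewrite le_max lexx.
  have m1 : Num.max 0 (Num.min 1 s) <= 1 by rewrite ge_max ler01 ge_min lexx.
  by rewrite /X0; apply/andP; split; nra.
have mX0 : measurable_fun setT X0.
  apply: measurable_funD => //; apply: measurable_funM => //.
  by apply: measurable_maxr => //; exact: measurable_minr.
pose X : {mfun T >-> T} := HB.pack X0 (isMeasurableFun.Build _ _ _ _ X0 mX0).
have XD s : D (X s).
  by rewrite /= in_itv/=; have /andP[? ?] := X0b s; apply/andP; split; lra.
exists (distribution U X); first exact: unit_measure_distribution.
pose m := A * \prod_(i < K) powR dl (pw i).
have m0 : 0 < m by rewrite mulr_gt0// prodr_gt0// => i _; exact: powR_gt0.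
have wm s : m <= w (X0 s).
  rewrite /m /weightw ler_pM2l//; apply: ler_prod => i _; rewrite powR_ge0/=.
  apply: ge0_ler_powR; rewrite ?nnegrE ?(ltW dl0)//; first by rewrite ltW// hp.
  have /andP[x1 x2] := X0b s; have [i0|i0] := posnP i.
    by rewrite i0 ger0_norm; lra.
  have zi : z 1%N <= z i by apply: (z_le hz); rewrite i0/=.
  by rewrite ler0_norm; lra.
(* [q |s - t|] is a lower bound for [|X s - X t| w(X s) w(X t)] on the unit square. *)
pose q := dl * m * m.
have q0 : 0 < q by apply: mulr_gt0 => //; exact: mulr_gt0.
pose C := `|c - ln q|.
have ub y : (I01 `*` I01) y -> (kern (X y.1, X y.2) + c%:E <= log_layers (y.1 - y.2) + C%:E)%E.
  case: y => s t [/=]; rewrite !in_itv/= => /andP[s0 s1] /andP[t0 t1].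
  have Xs : X0 s = a + dl + dl * s by rewrite /X0 (min_r s1) max_r.
  have Xt : X0 t = a + dl + dl * t by rewrite /X0 (min_r t1) max_r.
  rewrite /kern/= log_kernelE.
  apply: (@le_trans _ _ (nlog (`|s - t| * q)%R + c%:E)%E).
    rewrite leeD2r//; apply: le_nlog; first by apply: mulr_ge0 => //; exact: ltW.
    have -> : `|s - t| * q = `|X0 s - X0 t| * m * m.
      have -> : X0 s - X0 t = dl * (s - t) by rewrite Xs Xt; ring.
      by rewrite normrM (gtr0_norm dl0) /q; ring.
    have n0 := normr_ge0 (X0 s - X0 t).
    apply: ler_pM; [by apply: mulr_ge0 => //; exact: ltW|exact: ltW| |exact: wm].
    by apply: ler_pM; [by []|exact: ltW|by []|exact: wm].
  rewrite nlogM// -addeA leeD// ?nlog_layers//.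
  by rewrite -EFinD lee_fin addrC; exact: ler_norm.
have mll : measurable_fun setT (fun y : T * T => log_layers (y.1 - y.2)).
  by apply: (measurableT_comp (@measurable_log_layers R)); exact: measurable_funB.
have mX : measurable_fun setT (fun y : T * T => (X y.1, X y.2)).
  by apply/measurable_fun_pair; exact: measurableT_comp.
have mkX : measurable_fun setT (fun y => kern (X y.1, X y.2) + c%:E)%E.
  by apply: emeasurable_funD => //; exact: (measurableT_comp mkern mX).
have mII : measurable (I01 `*` I01) by exact: measurableX.
have fin : (wenergy w (distribution U X) + c%:E < +oo)%E.
  rewrite (wenergy_unif01 XD c0 kc).
  have le := @le_integral_shift _ _ R (U \x U)%E (I01 `*` I01) mII UU1
    (fun y => kern (X y.1, X y.2) + c%:E)%E (fun y => log_layers (y.1 - y.2)) 0 (fun=> C) mkX mll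
    (fun y _ => kc _ _ (XD _) (XD _)) (fun y _ => log_layers_ge0 _) (lexx 0) (bfun_cst _ C)
    (fun _ _ => normr_ge0 _).
  rewrite -[ltLHS]adde0.
  apply: le_lt_trans (le _) _; first by move=> y Dy; rewrite adde0; exact: ub.
  rewrite (Ex_cst mII UU1); apply: (@le_lt_trans _ _ (4%:E + C%:E)%E); last by rewrite ltry.
  by rewrite leeD2r//; exact: finite_prod_log_layers.
by move: fin; case: (wenergy w _) => [r _| |_ //]; [exact: ltry|rewrite addye// ltxx].
Qed.

End Existence.

(** * Existence by the direct method *)

Section ExistenceTheorem.
Context (R : realType) (K : nat) (A : R) (z pw : nat -> R).
Hypotheses (hK : (2 <= K)%N) (hA : 0 < A).
Hypothesis hp : forall i : nat, (i < K)%N -> 0 < pw i.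
Hypothesis hz : forall i : nat, (i.+1 < K)%N -> z i < z i.+1.
Local Notation w := (weightw K A z pw).
Local Notation T := (measurableTypeR R).
Local Notation a := (z 0%N).
Local Notation b := (z K.-1).
Local Notation D := (`[a, b]%classic : set T).
Local Notation U := (unif01 R).

Let kern (y : T * T) := log_kernel w y.1 y.2.
Let mkern : measurable_fun setT kern.
Proof. exact: measurable_log_kernel. Qed.
Let mD : measurable D.
Proof. exact: measurable_itv. Qed.
Let ab : a <= b.
Proof. by apply: (z_le hz); lia. Qed.

Lemma wenergy_lbound (c : R) (nu : {measure set T -> \bar R}) : 0 <= c ->
  (forall x t, D x -> D t -> (0 <= log_kernel w x t + c%:E)%E) ->
  unit_measure_on a b nu -> (- c%:E <= wenergy w nu)%E.
Proof.
move=> c0 kc [nu1 nuD].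
have [P PE] := unit_measure_probability nu1.
rewrite -(eq_wenergy w (mu := P)); last by move=> B _; exact: PE.
have PD : P (~` D) = 0%E by rewrite PE.
rewrite -[leLHS]add0e leeBlDr//.
rewrite /wenergy (energy_shift mD PD mkern c0 kc); apply: integral_ge0 => -[x t] [Dx Dt].
exact: kc.
Qed.

Lemma unit_measure_quantile (nu : {measure set T -> \bar R}) : unit_measure_on a b nu ->
  exists q : R -> R, [/\ forall s, a <= q s <= b, {homo q : s t / s <= t} &
    exists2 X : {mfun T >-> T}, (forall s, X s = q s) &
    wenergy w nu = wenergy w (distribution U X)].
Proof.
move=> [nu1 nuD]; have [P PE] := unit_measure_probability nu1.
have PD : P (~` D) = 0%E by rewrite PE.
exists (quantile a b P); split.
- by move=> s; exact: quantile_in.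
- exact: quantile_nondecreasing.
exists (quantile_mfun ab P) => //.
rewrite -(eq_wenergy w (mu := P)); last by move=> B _; exact: PE.
by apply: eq_wenergy => B mB; apply/esym; exact: distribution_quantile.
Qed.

Theorem exists_weighted_equilibrium :
  exists mu : {measure set T -> \bar R}, is_weighted_equilibrium a b w mu.
Proof.
have [c c0 kc] := log_kernel_lbound hK hA hp hz.
pose S := [set wenergy w nu | nu in [set nu : {measure set T -> \bar R} | unit_measure_on a b nu]].
pose V := ereal_inf S.
have [nu0 nu0D nu0fin] := exists_finite_energy hK hA hp hz.
have Vfin : V \is a fin_num.
  rewrite fin_numElt; apply/andP; split.
    apply: (@lt_le_trans _ _ (- c%:E)%E); first exact: ltNyr.
    by apply: le_ereal_inf_tmp => _ [nu nuD <-]; exact: wenergy_lbound.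
  by apply: le_lt_trans nu0fin; apply: ereal_inf_lbound; exists nu0.
(* A minimizing sequence, each measure represented as the image of the uniform law by its quantile
   function. Convergence can then be pointwise, and no topology on measures is involved. *)
have /choice[qX hqX] n : exists qX : (R -> R) * {mfun T >-> T},
    [/\ forall s, a <= qX.1 s <= b, {homo qX.1 : s t / s <= t},
    forall s, qX.2 s = qX.1 s & (wenergy w (distribution U qX.2) < V + n.+1%:R^-1%:E)%E].
  have n0 : 0 < n.+1%:R^-1 :> R by rewrite invr_gt0.
  have [_ [nu nuD <-] nuV] := lb_ereal_inf_adherent n0 Vfin.
  have [q [qab qnd [X Xq wX]]] := unit_measure_quantile nuD.
  by exists (q, X); split=> //; rewrite -wX.
pose q n := (qX n).1.
have qab n s : a <= q n s <= b by have [h _ _ _] := hqX n; exact: h.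
have qnd n : {homo q n : s t / s <= t} by have [_ h _ _] := hqX n; exact: h.
have [n_ [q0 [n_k q0ab q0nd q0c]]] := helly qab qnd.
have mq0 : measurable_fun (setT : set T) (q0 : T -> T).
  by apply: nondecreasing_measurable => // s t *; exact: q0nd.
pose X0 : {mfun T >-> T} := HB.pack (q0 : T -> T) (isMeasurableFun.Build _ _ T T q0 mq0).
have X0D s : D (X0 s) by rewrite /= in_itv/=; exact: q0ab.
have XnD n s : D ((qX n).2 s).
  by have [_ _ -> _] := hqX n; rewrite /= in_itv/=; exact: qab.
have uX0 := unit_measure_distribution X0D.
exists (distribution U X0); split=> // nu nuD.
apply: (@le_trans _ _ V); last by apply: ereal_inf_lbound; exists nu.
(* A set of full uniform measure on which the selected quantile functions converge. *)
pose I : set T := `[0, 1[%classic `\` jump q0.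
have mI : measurable I.
  by apply: measurableD; [exact: measurable_itv|exact/countable_measurable/countable_jump].
have UI : U (~` I) = 0%E.
  have sub : ~` I `<=` ~` (`[0, 1]%classic : set T) `|` ([set 1] `|` jump q0).
    move=> s /not_andP[s01|/contrapT js]; last by right; right.
    have [->|s1] := eqVneq s 1; first by right; left.
    left => sin; apply: s01; move: sin; rewrite /= !in_itv/= => /andP[s0 s1'].
    by rewrite s0 lt_neqAle s1.
  have mJ : measurable ([set 1] `|` jump q0 : set T).
    by apply: measurableU => //; exact/countable_measurable/countable_jump.
  apply/eqP; rewrite eq_le measure_ge0 andbT.
  apply: le_trans (le_measure _ _ _ sub) _; rewrite ?inE.
  - exact: measurableC.
  - by apply: measurableU => //; apply: measurableC; exact: measurable_itv.
  have mIc : measurable (~` (`[0, 1]%classic : set T)) by apply: measurableC; exact: measurable_itv.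
  have U0 : U (~` (`[0, 1]%classic : set T)) = 0%E by rewrite unif01E ?setICl ?measure0.
  have J0 : U ([set 1] `|` jump q0) = 0%E.
    have mj : measurable (jump q0 : set T) by exact/countable_measurable/countable_jump.
    apply/eqP; rewrite eq_le measure_ge0 andbT.
    have m1 : measurable ([set 1] : set T) by exact: measurable_set1.
    have h := measureU2 U m1 mj; apply: (le_trans h).
    have U1 : U [set 1] = 0%E by apply: unif01_countable0; exact: countable1.
    have Uj : U (jump q0) = 0%E by apply: unif01_countable0; exact: countable_jump.
    by rewrite [X in (X + _)%E]U1 [X in (_ + X)%E]Uj adde0.
  have h := measureU2 U mIc mJ; apply: (le_trans h).
  by rewrite [X in (X + _)%E]U0 [X in (_ + X)%E]J0 adde0.
have mII : measurable (I `*` I) by exact: measurableX.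
have mX (X : {mfun T >-> T}) : measurable_fun setT (fun y : T * T => (X y.1, X y.2)).
  by apply/measurable_fun_pair; exact: measurableT_comp.
have mkX (X : {mfun T >-> T}) : measurable_fun setT (fun y => kern (X y.1, X y.2) + c%:E)%E.
  by apply: emeasurable_funD => //; exact: (measurableT_comp mkern (mX X)).
have wE (X : {mfun T >-> T}) : (forall s, D (X s)) ->
  (wenergy w (distribution U X) + c%:E =
   \int[(U \x U)]_(y in I `*` I) (kern (X y.1, X y.2) + c%:E))%E.
  move=> XD; have XT : X @^-1` D = setT by apply/seteqP; split => // s _; exact: XD.
  rewrite /wenergy (@energy_push _ _ _ _ R U X D mD (unit_measure_distribution XD).2 kern c mkern c0 kc).
  rewrite XT setXTT; apply: (ge0_prod_carrier mI UI (f := fun y => kern (X y.1, X y.2) + c%:E)%E) => //.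
  by case=> s t; apply: kc; exact: XD.
have cfin : c%:E \is a fin_num by [].
rewrite -(leeD2rE _ _ cfin) (wE X0 X0D).
pose f k (y : T * T) := (kern ((qX (n_ k)).2 y.1, (qX (n_ k)).2 y.2) + c%:E)%E.
have fE k : (\int[(U \x U)]_(y in I `*` I) f k y = wenergy w (distribution U (qX (n_ k)).2) + c%:E)%E.
  by rewrite -wE.
have fcvg y : (I `*` I) y -> f ^~ y @ \oo --> (kern (X0 y.1, X0 y.2) + c%:E)%E.
  case: y => s t [/= [s01 js] [t01 jt]].
  apply: cvgeD; [exact: fin_num_adde_defl| |exact: cvg_cst].
  have h u : `[0, 1[%classic u -> ~ jump q0 u -> (fun k => (qX (n_ k)).2 u) @ \oo --> X0 u.
    move=> u01 ju; rewrite (_ : (fun k => _) = (fun k => q (n_ k) u)); last first.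
      by apply/funext => k; have [_ _ e _] := hqX (n_ k); exact: e.
    by apply: q0c => //; move: u01; rewrite /= in_itv.
  exact: (@cvg_log_kernel R K A z pw hp hA _ _ _ _ (h s s01 js) (h t t01 jt)).
(* The shifted kernels converge pointwise on [I * I], the value [+oo] included, so Fatou bounds the
   energy of the limit by the lower limit of the energies. *)
rewrite (eq_integral (fun y => limn_einf (f ^~ y))); last first.
  by move=> y /[!inE] Iy; have [-> _] := cvg_limn_einf_sup (fcvg y Iy).
apply: (le_trans (fatou _ mII _ _)).
- by move=> k; apply: measurable_funTS; exact: mkX.
- by move=> k [s t] _; apply: kc; exact: XnD.
under eq_fun do rewrite fE.
pose g (k : nat) : \bar R := (V + k.+1%:R^-1%:E + c%:E)%E.
have gV : g @ \oo --> (V + c%:E)%E.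
  apply: cvgeD; [exact: fin_num_adde_defl| |exact: cvg_cst].
  rewrite -[X in _ --> X]adde0; apply: cvgeD; [exact: fin_num_adde_defl|exact: cvg_cst|].
  by apply: cvg_EFin; [exact: nearW|exact: cvg_harmonic].
have [<- _] := cvg_limn_einf_sup gV.
rewrite !limn_einf_lim; apply: lee_lim; [exact: is_cvg_einfs|exact: is_cvg_einfs|].
apply: nearW => m; apply: le_ereal_inf_tmp => _ [k /= mk <-].
apply: ereal_inf_le; exists (wenergy w (distribution U (qX (n_ k)).2) + c%:E)%E; first by exists k.
rewrite leeD2r//; have [_ _ _ /ltW h] := hqX (n_ k); apply: le_trans h _.
(* [k <= n_ k] turns the error at index [n_ k] into the one at index [k]. *)
by rewrite leeD2l// lee_fin lef_pV2 ?posrE// ler_nat ltnS.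
Qed.

End ExistenceTheorem.

(** * The loop equation *)

Local Open Scope complex_scope.
Local Notation Re := (@complex.Re _).
Local Notation Im := (@complex.Im _).

Section ComplexParts.
Context (R : realType).
Implicit Types (x y : R[i]) (r : R).

Lemma cReD x y : Re (x + y) = Re x + Re y. Proof. by case: x; case: y. Qed.
Lemma cImD x y : Im (x + y) = Im x + Im y. Proof. by case: x; case: y. Qed.
Lemma cReM x y : Re (x * y) = Re x * Re y - Im x * Im y. Proof. by case: x => a b; case: y => c d; rewrite /=; simpc. Qed.
Lemma cImM x y : Im (x * y) = Re x * Im y + Im x * Re y.
Proof. by case: x => a b; case: y => c d; rewrite /=; simpc. Qed.
Lemma cReN x : Re (- x) = - Re x. Proof. by case: x. Qed.
Lemma cImN x : Im (- x) = - Im x. Proof. by case: x. Qed.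
Lemma cRe_sum I (s : seq I) (Q : pred I) (f : I -> R[i]) :
  Re (\sum_(i <- s | Q i) f i) = \sum_(i <- s | Q i) Re (f i).
Proof. by apply: (big_morph (@complex.Re R) cReD). Qed.
Lemma cIm_sum I (s : seq I) (Q : pred I) (f : I -> R[i]) :
  Im (\sum_(i <- s | Q i) f i) = \sum_(i <- s | Q i) Im (f i).
Proof. by apply: (big_morph (@complex.Im R) cImD). Qed.
Lemma complex_eq x y : Re x = Re y -> Im x = Im y -> x = y.
Proof. by case: x => a b; case: y => c d /= -> ->. Qed.
Lemma cReZ r x : Re (r%:C * x) = r * Re x. Proof. by rewrite cReM/= mul0r subr0. Qed.
Lemma cImZ r x : Im (r%:C * x) = r * Im x. Proof. by rewrite cImM/= mul0r addr0. Qed.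

End ComplexParts.

Section ComplexExpectation.
Context d (T : measurableType d) (R : realType).

Definition cbfun (D : set T) (f : T -> R[i]) :=
  bfun D (fun x => Re (f x)) /\ bfun D (fun x => Im (f x)).

Definition CEx (m : {measure set T -> \bar R}) (D : set T) (f : T -> R[i]) : R[i] :=
  Ex m D (fun x => Re (f x)) +i* Ex m D (fun x => Im (f x)).

Variables (m : {measure set T -> \bar R}) (D : set T).
Hypotheses (mD : measurable D) (mD1 : m D = 1%E).

Lemma cbfun_cst c : cbfun D (fun=> c).
Proof. by split; exact: bfun_cst. Qed.

Lemma cbfunD f g : cbfun D f -> cbfun D g -> cbfun D (fun x => f x + g x).
Proof.
move=> [f1 f2] [g1 g2]; split.
- by under eq_fun do rewrite cReD; exact: bfunD.
- by under eq_fun do rewrite cImD; exact: bfunD.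
Qed.

Lemma cbfunN f : cbfun D f -> cbfun D (fun x => - f x).
Proof.
move=> [f1 f2]; split.
- by under eq_fun do rewrite cReN; exact: bfunN.
- by under eq_fun do rewrite cImN; exact: bfunN.
Qed.

Lemma cbfunM f g : cbfun D f -> cbfun D g -> cbfun D (fun x => f x * g x).
Proof.
move=> [f1 f2] [g1 g2]; split.
- by under eq_fun do rewrite cReM; apply: bfunB; exact: bfunM.
- by under eq_fun do rewrite cImM; apply: bfunD; exact: bfunM.
Qed.

Lemma cbfun_sum (I : Type) (s : seq I) (Q : pred I) (f : I -> T -> R[i]) :
  (forall i, Q i -> cbfun D (f i)) -> cbfun D (fun x => \sum_(i <- s | Q i) f i x).
Proof.
move=> bf; split.
- by under eq_fun do rewrite cRe_sum; apply: bfun_sum => i /bf[].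
- by under eq_fun do rewrite cIm_sum; apply: bfun_sum => i /bf[].
Qed.

Lemma CExD f g : cbfun D f -> cbfun D g ->
  CEx m D (fun x => f x + g x) = CEx m D f + CEx m D g.
Proof.
move=> [f1 f2] [g1 g2]; apply: complex_eq; rewrite /= ?cReD ?cImD/=.
- by under eq_fun do rewrite cReD; rewrite ExD.
- by under eq_fun do rewrite cImD; rewrite ExD.
Qed.

Lemma CExZ c f : cbfun D f -> CEx m D (fun x => c * f x) = c * CEx m D f.
Proof.
move=> [f1 f2]; apply: complex_eq; rewrite ?cReM ?cImM/=.
- under eq_fun do rewrite cReM; rewrite ExB; [|done|done|exact: bfunZ|exact: bfunZ].
  by rewrite !ExZ.
- under eq_fun do rewrite cImM; rewrite ExD; [|done|done|exact: bfunZ|exact: bfunZ].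
  by rewrite !ExZ.
Qed.

Lemma CExN f : cbfun D f -> CEx m D (fun x => - f x) = - CEx m D f.
Proof. by move=> bf; under eq_fun do rewrite -mulN1r; rewrite CExZ// mulN1r. Qed.

Lemma CEx_sum (I : Type) (s : seq I) (Q : pred I) (f : I -> T -> R[i]) :
  (forall i, Q i -> cbfun D (f i)) ->
  CEx m D (fun x => \sum_(i <- s | Q i) f i x) = \sum_(i <- s | Q i) CEx m D (f i).
Proof.
move=> bf; apply: complex_eq; rewrite ?cRe_sum ?cIm_sum/=.
- by under eq_fun do rewrite cRe_sum; rewrite Ex_sum// => i /bf[].
- by under eq_fun do rewrite cIm_sum; rewrite Ex_sum// => i /bf[].
Qed.

Lemma eq_CEx f g : (forall x, D x -> f x = g x) -> CEx m D f = CEx m D g.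
Proof. by move=> fg; congr (_ +i* _); apply: eq_Ex => x Dx; rewrite fg. Qed.

Lemma CEx_real f : CEx m D (fun x => (f x)%:C) = (Ex m D f)%:C.
Proof. by apply: complex_eq => //=; rewrite (Ex_cst mD mD1). Qed.

Lemma cbfun_real f : bfun D f -> cbfun D (fun x => (f x)%:C).
Proof. by move=> bf; split => //=; exact: bfun_cst. Qed.

End ComplexExpectation.

Section ComplexProductExpectation.
Context d (T : measurableType d) (R : realType).
Variables (mu : probability T R) (D : set T).
Hypotheses (mD : measurable D) (mD1 : mu D = 1%E).

Lemma cbfun_fst (f : T -> R[i]) : cbfun D f -> cbfun (D `*` D) (fun y => f y.1).
Proof. by move=> [f1 f2]; split; [exact: (bfun_fst f1)|exact: (bfun_fst f2)]. Qed.

Lemma cbfun_snd (f : T -> R[i]) : cbfun D f -> cbfun (D `*` D) (fun y => f y.2).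
Proof. by move=> [f1 f2]; split; [exact: (bfun_snd f1)|exact: (bfun_snd f2)]. Qed.

Lemma CEx_prod (f g : T -> R[i]) : cbfun D f -> cbfun D g ->
  CEx (mu \x mu)%E (D `*` D) (fun y => f y.1 * g y.2) = CEx mu D f * CEx mu D g.
Proof.
move=> [f1 f2] [g1 g2].
have mDD : measurable (D `*` D) by exact: measurableX.
have PP1 := prodD1 mD mD1.
have bp u v : bfun D u -> bfun D v -> bfun (D `*` D) (fun y => u y.1 * v y.2 : R).
  by move=> bu bv; apply: bfunM; [exact: bfun_fst|exact: bfun_snd].
apply: complex_eq; rewrite ?cReM ?cImM/=.
- under eq_fun do rewrite cReM.
  rewrite (ExB mDD PP1 (bp _ _ f1 g1) (bp _ _ f2 g2)).
  by rewrite (Ex_prod mD mD1 f1 g1) (Ex_prod mD mD1 f2 g2).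
- under eq_fun do rewrite cImM.
  rewrite (ExD mDD PP1 (bp _ _ f1 g2) (bp _ _ f2 g1)).
  by rewrite (Ex_prod mD mD1 f1 g2) (Ex_prod mD mD1 f2 g1).
Qed.

End ComplexProductExpectation.

(** * Divided differences and their expectations *)

Section DividedDifference.
Context (R : realType).

(* For [u k = x ^+ k] this is [(p - p.[x]) / ('X - x)]; [dd_powers] integrates it over [x]. *)
Definition dd (u : nat -> R) (p : {poly R}) : {poly R} :=
  \sum_(k < size p) p`_k *: \sum_(i < k) u (k - i.+1)%N *: 'X^i.

Local Notation toC p := (map_poly (real_complex R) p).

Lemma dd_horner (u : nat -> R) p (zt : R[i]) : (toC (dd u p)).[zt] =
  \sum_(k < size p) (p`_k)%:C * \sum_(i < k) (u (k - i.+1)%N)%:C * zt ^+ i.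
Proof.
rewrite rmorph_sum horner_sum; apply: eq_bigr => k _.
rewrite /= map_polyZ hornerZ rmorph_sum horner_sum; congr (_ * _).
by apply: eq_bigr => i _; rewrite /= map_polyZ hornerZ map_polyXn hornerXn.
Qed.

Lemma toC_horner p (zt : R[i]) : (toC p).[zt] = \sum_(k < size p) (p`_k)%:C * zt ^+ k.
Proof.
rewrite horner_coef size_map_inj_poly ?rmorph0//; last exact: fmorph_inj.
by apply: eq_bigr => k _; rewrite coef_map.
Qed.

Lemma toC_horner_real p (x : R) : (toC p).[x%:C] = p.[x]%:C.
Proof. by rewrite horner_map. Qed.

Lemma dd_powers p (x : R) (zt : R[i]) :
  (zt - x%:C) * (toC (dd (fun n => x ^+ n) p)).[zt] = (toC p).[zt] - p.[x]%:C.
Proof.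
rewrite dd_horner toC_horner -toC_horner_real toC_horner -sumrB mulr_sumr.
apply: eq_bigr => k _; rewrite mulrCA -mulrBr subrXX; congr (_ * (_ * _)).
rewrite (reindex_inj rev_ord_inj)/=; apply: eq_bigr => i _.
by rewrite rmorphXn mulrC; congr (_ ^+ _ * _ ^+ _); have := ltn_ord i; lia.
Qed.

Lemma coef_dd u p i : (dd u p)`_i = \sum_(k < size p | (i < k)%N) p`_k * u (k - i.+1)%N.
Proof.
rewrite coef_sum [RHS]big_mkcond/=; apply: eq_bigr => k _.
rewrite coefZ coef_sum; case: ifPn => ik.
  rewrite (bigD1 (Ordinal ik))//= coefZ coefXn eqxx mulr1 big1 ?addr0// => j ji.
  rewrite coefZ coefXn; case: eqP => [ij|]; last by rewrite mulr0.
  by move: ji; rewrite -val_eqE/= ij eqxx.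
rewrite big1 ?mulr0// => j _; rewrite coefZ coefXn; case: eqP => [ij|]; last by rewrite mulr0.
by move: ik; rewrite ij ltn_ord.
Qed.

End DividedDifference.

Local Notation toC p := (map_poly (real_complex _) p).

Section DividedDifferenceExpectation.
Context d (T : measurableType d) (R : realType).
Variables (m : {measure set T -> \bar R}) (D : set T).
Hypotheses (mD : measurable D) (mD1 : m D = 1%E).
Variables (v : nat -> T -> R) (p : {poly R}) (zt : R[i]).
Hypothesis bv : forall n, bfun D (v n).

Lemma cbfun_dd : cbfun D (fun y => (toC (dd (fun n => v n y) p)).[zt]).
Proof.
under eq_fun do rewrite dd_horner.
apply: cbfun_sum => k _; apply: cbfunM; first exact: cbfun_cst.
by apply: cbfun_sum => i _; apply: cbfunM; [exact: cbfun_real|exact: cbfun_cst].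
Qed.

(** [dd u p] is linear in [u], so the expectation passes to the sequence [v]. Integrating divided
    differences thus yields a polynomial in [zt] with moments in its coefficients. *)
Lemma CEx_dd : CEx m D (fun y => (toC (dd (fun n => v n y) p)).[zt]) =
  (toC (dd (fun n => Ex m D (v n)) p)).[zt].
Proof.
have b1 i n : cbfun D (fun y => (v n y)%:C * zt ^+ i).
  by apply: cbfunM; [exact: cbfun_real|exact: cbfun_cst].
have b2 k : cbfun D (fun y => \sum_(i < k) (v (k - i.+1)%N y)%:C * zt ^+ i).
  by apply: cbfun_sum.
under eq_fun do rewrite dd_horner; rewrite dd_horner.
rewrite (CEx_sum mD mD1); last by move=> k _; apply: cbfunM => //; exact: cbfun_cst.
apply: eq_bigr => k _; rewrite (CExZ mD mD1)//; congr (_ * _).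
rewrite (CEx_sum mD mD1)//; apply: eq_bigr => i _.
under eq_fun do rewrite mulrC; rewrite (CExZ mD mD1); last exact: cbfun_real.
by rewrite (CEx_real mD mD1) mulrC.
Qed.

End DividedDifferenceExpectation.

Section Resolvent.
Context (R : realType).
Local Notation T := (measurableTypeR R).

Definition resolvent (zt : R[i]) (x : R) : R[i] := (zt - x%:C)^-1.

Lemma resolventE (zt : R[i]) (x : R) : Im zt != 0 -> resolvent zt x =
  ((Re zt - x) / ((Re zt - x) ^+ 2 + Im zt ^+ 2)) +i*
  (- (Im zt / ((Re zt - x) ^+ 2 + Im zt ^+ 2))).
Proof.
case: zt => xi eta /= e0.
have n0 : (xi - x) ^+ 2 + eta ^+ 2 != 0.
  by rewrite gt_eqF// ltr_pwDr ?sqr_ge0// lt_neqAle eq_sym sqrf_eq0 e0 sqr_ge0.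
have zn0 : (xi +i* eta) - x%:C != 0.
  by apply/eqP => /(congr1 Im) /=; rewrite subr0 => /eqP; rewrite (negbTE e0).
apply: (mulfI zn0); rewrite mulfV//; apply: complex_eq; rewrite ?cReM ?cImM/=.
- by field.
- by field.
Qed.

Lemma sub_complex_neq0 (zt : R[i]) (x : R) : Im zt != 0 -> zt - x%:C != 0.
Proof.
case: zt => xi eta /= e0; apply/eqP => /(congr1 Im) /=.
by rewrite subr0 => /eqP; rewrite (negbTE e0).
Qed.

Lemma bfun_id (a b : R) : bfun (`[a, b]%classic : set T) (fun x : T => x : R).
Proof.
split; first exact: measurable_id.
exists (`|a| + `|b|) => x; rewrite /= in_itv/= => /andP[ax xb].
rewrite ler_norml; have := ler_norm b; have := ler_norm (- a); rewrite normrN.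
by have := normr_ge0 a; have := normr_ge0 b; move=> *; apply/andP; split; lra.
Qed.

Lemma bfun_exp (a b : R) n : bfun (`[a, b]%classic : set T) (fun x : T => (x : R) ^+ n).
Proof.
elim: n => [|n ih]; first exact: bfun_cst.
rewrite (_ : (fun x : T => (x : R) ^+ n.+1) = (fun x : T => x * x ^+ n)).
  by apply: bfunM => //; exact: bfun_id.
by apply/funext => x; rewrite exprS.
Qed.

Lemma bfun_horner (a b : R) (p : {poly R}) : bfun (`[a, b]%classic : set T) (fun x : T => p.[x]).
Proof.
rewrite (_ : (fun x : T => p.[x]) = (fun x : T => \sum_(i < size p) p`_i * (x : R) ^+ i)); last first.
  by apply/funext => x; rewrite horner_coef.
by apply: bfun_sum => i _; apply: bfunZ; exact: bfun_exp.
Qed.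

Lemma cbfun_resolvent (a b : R) (zt : R[i]) : Im zt != 0 ->
  cbfun (`[a, b]%classic : set T) (resolvent zt).
Proof.
move=> e0; have e2 : 0 < Im zt ^+ 2 by rewrite lt_neqAle eq_sym sqrf_eq0 e0 sqr_ge0.
have bx : bfun (`[a, b]%classic : set T) (fun x : T => Re zt - x).
  by apply: bfunB; [exact: bfun_cst|exact: bfun_id].
have d0 (x : R) : 0 < (Re zt - x) ^+ 2 + Im zt ^+ 2 by rewrite ltr_pwDr// sqr_ge0.
have bi : bfun (`[a, b]%classic : set T) (fun x : T => ((Re zt - x) ^+ 2 + Im zt ^+ 2)^-1).
  split.
    apply: continuous_measurable_fun => x; apply: cvgV; first by rewrite gt_eqF.
    apply: cvgD; last exact: cvg_cst.
    have cs : (Re zt - y) @[y --> x] --> Re zt - x by apply: cvgB; [exact: cvg_cst|exact: cvg_id].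
    by rewrite expr2; under eq_fun do rewrite expr2; apply: cvgM.
  exists (Im zt ^+ 2)^-1 => x _; rewrite ger0_norm ?invr_ge0 ?(ltW (d0 x))//.
  by rewrite lef_pV2 ?posrE// lerDr sqr_ge0.
split.
- rewrite (_ : (fun x : T => _) = (fun x : T => (Re zt - x) * ((Re zt - x) ^+ 2 + Im zt ^+ 2)^-1)).
    exact: bfunM.
  by apply/funext => x; rewrite resolventE.
- rewrite (_ : (fun x : T => _) = (fun x : T => - (Im zt * ((Re zt - x) ^+ 2 + Im zt ^+ 2)^-1))).
    by apply: bfunN; apply: bfunM => //; exact: bfun_cst.
  by apply/funext => x; rewrite resolventE.
Qed.

End Resolvent.

(** * Degree and leading coefficient of the loop polynomial *)

Section LoopPolynomials.
Context (R : realType) (K : nat) (z pw : nat -> R).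
Hypothesis hK : (2 <= K)%N.

Definition zpoly : {poly R} := \prod_(m < K) ('X - (z m)%:P).
Definition zpolyj (j : nat) : {poly R} := \prod_(m < K | nat_of_ord m != j) ('X - (z m)%:P).
(** [bpoly / zpoly] is the sum of the [p_j / (x - z_j)]. *)
Definition bpoly : {poly R} := \sum_(j < K) pw j *: zpolyj j.
(** The polynomial left over in the first variation. The sum over [l] is the expectation of
    [(x ^ n - t ^ n) / (x - t)] for independent [x] and [t] with moments [mom]. *)
Definition cpoly (mom : nat -> R) : {poly R} :=
  dd (fun n => \sum_(l < n) mom (n.-1 - l)%N * mom l) zpoly +
  2 *: \sum_(j < K) pw j *: dd mom (zpolyj j).
(** This is [Pi]. If the Cauchy transform [H] satisfies [zpoly H ^ 2 + 2 bpoly H = cpoly], then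
    completing the square gives [(zpoly H + bpoly) ^ 2 = bpoly ^ 2 + zpoly cpoly]. *)
Definition loop_poly (mom : nat -> R) : {poly R} := bpoly ^+ 2 + zpoly * cpoly mom.

Lemma zpolyE j : (j < K)%N -> zpoly = ('X - (z j)%:P) * zpolyj j.
Proof.
move=> jK; rewrite /zpoly (bigD1 (Ordinal jK))//=; congr (_ * _).
Qed.

Lemma monic_zpoly : zpoly \is monic. Proof. exact: monic_prod_XsubC. Qed.
Lemma monic_zpolyj j : zpolyj j \is monic. Proof. exact: monic_prod_XsubC. Qed.

Lemma size_zpoly : size zpoly = K.+1.
Proof. by rewrite size_prod_XsubC /index_enum -enumT size_enum_ord. Qed.

Lemma size_zpolyj j : (j < K)%N -> size (zpolyj j) = K.
Proof.
move=> jK; have := size_zpoly; rewrite (zpolyE jK) size_monicM ?monicXsubC ?monic_neq0 ?monic_zpolyj//.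
by rewrite size_XsubC => -[].
Qed.

Lemma horner_zpoly x : zpoly.[x] = \prod_(m < K) (x - z m).
Proof. by rewrite horner_prod; apply: eq_bigr => m _; rewrite hornerXsubC. Qed.

Lemma horner_zpolyj j x : (zpolyj j).[x] = \prod_(m < K | nat_of_ord m != j) (x - z m).
Proof. by rewrite horner_prod; apply: eq_bigr => m _; rewrite hornerXsubC. Qed.

Lemma size_dd u (p : {poly R}) : (size (dd u p) <= (size p).-1)%N.
Proof.
apply/leq_sizeP => i pi; rewrite coef_dd big1// => k ik.
by have := ltn_ord k; lia.
Qed.

Lemma lead_dd u (p : {poly R}) n : size p = n.+2 -> (dd u p)`_n = p`_n.+1 * u 0%N.
Proof.
move=> sp; have np : (n.+1 < size p)%N by rewrite sp.
rewrite coef_dd (bigD1 (Ordinal np)) ?ltnSn//= subnn big1 ?addr0// => k /andP[nk kn].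
have kp : (k < n.+2)%N by rewrite -sp.
by exfalso; move: kn; rewrite -val_eqE/=; lia.
Qed.

Lemma coefM_top (p q : {poly R}) m n : (size p <= m.+1)%N -> (size q <= n.+1)%N ->
  (p * q)`_(m + n) = p`_m * q`_n.
Proof.
move=> sp sq; have mn : (m < (m + n).+1)%N by lia.
rewrite coefM (bigD1 (Ordinal mn))//= addKn big1 ?addr0// => i.
rewrite -val_eqE/= neq_ltn => /orP[im|mi].
  by rewrite [q`_(_)]nth_default ?mulr0//; apply: leq_trans sq _; have := ltn_ord i; lia.
by rewrite [p`_(_)]nth_default ?mul0r//; apply: leq_trans sp _; lia.
Qed.

Variable mom : nat -> R.
Hypothesis mom0 : mom 0%N = 1.

Lemma size_bpoly : (size bpoly <= K)%N.
Proof.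
apply: (leq_trans (size_sum _ _ _)); apply/bigmax_leqP => j _.
by rewrite (leq_trans (size_scale_leq _ _))// size_zpolyj.
Qed.

(** The first divided difference loses two degrees instead of one, because its coefficient sequence
    starts with an empty sum. *)
Lemma size_cpoly : (size (cpoly mom) <= K.-1)%N.
Proof.
rewrite /cpoly (leq_trans (size_polyD _ _))// geq_max; apply/andP; split.
  apply/leq_sizeP => i Ki; rewrite coef_dd big1// => k ik.
  have kK : (k < K.+1)%N by rewrite -size_zpoly; exact: ltn_ord.
  have -> : (k - i.+1 = 0)%N by lia.
  by rewrite big_ord0 mulr0.
rewrite (leq_trans (size_scale_leq _ _))// (leq_trans (size_sum _ _ _))//.
apply/bigmax_leqP => j _; rewrite (leq_trans (size_scale_leq _ _))//.
by rewrite (leq_trans (size_dd _ _))// size_zpolyj.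
Qed.

Lemma coef_bpoly : bpoly`_K.-1 = \sum_(j < K) pw j.
Proof.
rewrite coef_sum; apply: eq_bigr => j _; rewrite coefZ.
have := monic_zpolyj j; rewrite monicE lead_coefE size_zpolyj// => /eqP ->.
by rewrite mulr1.
Qed.

Lemma coef_cpoly : (cpoly mom)`_K.-2 = 1 + 2 * \sum_(j < K) pw j.
Proof.
rewrite coefD coefZ; congr (_ + 2 * _); last first.
  rewrite coef_sum; apply: eq_bigr => j _; rewrite coefZ.
  have sj : size (zpolyj j) = K.-2.+2 by rewrite size_zpolyj//; lia.
  rewrite lead_dd//.
  have := monic_zpolyj j; rewrite monicE lead_coefE sj/= => /eqP ->.
  by rewrite mom0 !mulr1.
have sz : size zpoly = K.-2.+3 by rewrite size_zpoly; lia.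
have k2 : (K.-2.+2 < size zpoly)%N by rewrite sz.
rewrite coef_dd (bigD1 (Ordinal k2))/=; last by lia.
rewrite [X in _ + X]big1 ?addr0 => [|i]; last first.
  move=> /andP[ki]; rewrite -val_eqE/= => ik.
  have iK : (i < K.-2.+3)%N by rewrite -sz; exact: ltn_ord.
  have -> : (i - K.-2.+1 = 0)%N by lia.
  by rewrite big_ord0 mulr0.
have -> : (K.-2.+2 - K.-2.+1 = 1)%N by lia.
have := monic_zpoly; rewrite monicE lead_coefE sz/= => /eqP ->.
by rewrite big_ord1 sub0n mom0 !mulr1.
Qed.

Hypothesis pw0 : 0 < 1 + \sum_(j < K) pw j.

(** With [p] the sum of the [p_j], [bpoly ^ 2] contributes [p ^ 2] and [zpoly cpoly] contributes
    [1 + 2 p] in degree [2 K - 2]. *)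
Let coef_loop : (loop_poly mom)`_(K.-1 + K.-1) = (1 + \sum_(j < K) pw j) ^+ 2.
Proof.
rewrite /loop_poly coefD expr2 coefM_top; last 2 first.
- by rewrite prednK ?size_bpoly//; lia.
- by rewrite prednK ?size_bpoly//; lia.
have -> : (K.-1 + K.-1 = K + K.-2)%N by lia.
rewrite coefM_top ?size_zpoly//; last by rewrite (leq_trans size_cpoly)//; lia.
rewrite coef_bpoly coef_cpoly.
have := monic_zpoly; rewrite monicE lead_coefE size_zpoly/= => /eqP ->.
by ring.
Qed.

Lemma size_loop_poly : size (loop_poly mom) = (K.-1 + K.-1).+1.
Proof.
apply/eqP; rewrite eqn_leq; apply/andP; split.
  rewrite (leq_trans (size_polyD _ _))// geq_max; apply/andP; split.
    rewrite expr2 (leq_trans (size_polyMleq _ _))//.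
    by have := size_bpoly; lia.
  rewrite (leq_trans (size_polyMleq _ _))// size_zpoly.
  by have := size_cpoly; lia.
rewrite ltnNge; apply/negP => /leq_sizeP/(_ _ (leqnn _)) /eqP.
by rewrite coef_loop sqrf_eq0 gt_eqF.
Qed.

Lemma lead_loop_poly : lead_coef (loop_poly mom) = (1 + \sum_(j < K) pw j) ^+ 2.
Proof. by rewrite lead_coefE size_loop_poly. Qed.

End LoopPolynomials.

(** * The quadratic equation for the Cauchy transform of a minimizer *)

Section LoopEquation.
Context (R : realType) (K : nat) (A : R) (z pw : nat -> R).
Hypotheses (hK : (2 <= K)%N) (hA : 0 < A).
Hypothesis hp : forall i : nat, (i < K)%N -> 0 < pw i.
Hypothesis hz : forall i : nat, (i.+1 < K)%N -> z i < z i.+1.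
Local Notation w := (weightw K A z pw).
Local Notation T := (measurableTypeR R).
Local Notation D := (`[z 0%N, z K.-1]%classic : set T).
Variable P : probability T R.
Hypothesis PD : P (~` D) = 0%E.
Hypothesis Pmin : forall nu : {measure set T -> \bar R},
  unit_measure_on (z 0%N) (z K.-1) nu -> (wenergy w P <= wenergy w nu)%E.
Hypothesis Pfin : (wenergy w P < +oo)%E.

Let mD : measurable D.
Proof. exact: measurable_itv. Qed.
Let mDD : measurable (D `*` D).
Proof. exact: measurableX. Qed.
Let P1 : P D = 1%E.
Proof. exact: prob_carrier1. Qed.
Let PP1 : (P \x P)%E (D `*` D) = 1%E.
Proof. exact: prodD1. Qed.

(** The first variation is linear in the test functions, and the differences [x - z_j] and [x - t]
    are real, so real and imaginary parts can be treated separately. *)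
Lemma complex_first_variation (h : T -> R[i]) (hj : nat -> T -> R[i]) (g : T * T -> R[i]) :
  cbfun D h -> (forall j, (j < K)%N -> cbfun D (hj j)) -> cbfun (D `*` D) g ->
  (forall x j, D x -> (j < K)%N -> h x = ((x : R) - z j)%:C * hj j x) ->
  (forall x t, D x -> D t -> h x - h t = ((x : R) - t)%:C * g (x, t)) ->
  CEx (P \x P)%E (D `*` D) g + 2 * \sum_(j < K) (pw j)%:C * CEx P D (hj j) = 0.
Proof.
move=> [hr hi] bhj [gr gi] hhj hg; apply: complex_eq.
- rewrite cReD (_ : 2 = (2 : R)%:C) ?cReZ ?cRe_sum/=; last by rewrite rmorph_nat.
  rewrite -[RHS](@first_variation R K A z pw hK hA hp hz P PD Pmin Pfin (fun x => Re (h x)) (fun j x => Re (hj j x)) (fun y => Re (g y)))//.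
  + by congr (_ + 2 * _); apply: eq_bigr => j _; rewrite mul0r subr0.
  + by move=> j /bhj[].
  + by move=> x j Dx jK; rewrite (hhj x j Dx jK) cReZ.
  + by move=> x t Dx Dt; rewrite -cReN -cReD (hg x t Dx Dt) cReZ.
- rewrite cImD (_ : 2 = (2 : R)%:C) ?cImZ ?cIm_sum/=; last by rewrite rmorph_nat.
  rewrite -[RHS](@first_variation R K A z pw hK hA hp hz P PD Pmin Pfin (fun x => Im (h x)) (fun j x => Im (hj j x)) (fun y => Im (g y)))//.
  + by congr (_ + 2 * _); apply: eq_bigr => j _; rewrite mul0r addr0.
  + by move=> j /bhj[].
  + by move=> x j Dx jK; rewrite (hhj x j Dx jK) cImZ.
  + by move=> x t Dx Dt; rewrite -cImN -cImD (hg x t Dx Dt) cImZ.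
Qed.

Definition moment (n : nat) : R := Ex P D (fun x : T => (x : R) ^+ n).

Lemma moment0 : moment 0 = 1.
Proof. by rewrite /moment (Ex_cst mD P1). Qed.

(** First variation along [h(x) = zpoly(x) / (zt - x)]. In every expectation the numerator is
    replaced by its value at [zt] at the cost of a divided difference; the values at [zt] produce
    the left-hand side, the divided differences the right-hand side. *)
Lemma loop_equation (zt : R[i]) (H := CEx P D (resolvent zt)) : Im zt != 0 ->
  (toC (zpoly K z)).[zt] * H ^+ 2 + 2 * (toC (bpoly K z pw)).[zt] * H =
  (toC (cpoly K z pw moment)).[zt].
Proof.
move=> zt0.
have n0 x := sub_complex_neq0 x zt0.
have br : cbfun D (resolvent zt) by exact: cbfun_resolvent.
have bhp (p : {poly R}) : cbfun D (fun x : T => (p.[x])%:C) by apply: cbfun_real; exact: bfun_horner.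
have bv (n : nat) : bfun D (fun x : T => (x : R) ^+ n) by exact: bfun_exp.
(* The divided difference of [x ^ n] at two points. *)
pose v2 (n : nat) (y : T * T) : R := \sum_(l < n) (y.1 : R) ^+ (n.-1 - l) * (y.2 : R) ^+ l.
have bv2 n : bfun (D `*` D) (v2 n).
  apply: bfun_sum => l _; apply: bfunM; first exact: (bfun_fst (bv _)).
  exact: (bfun_snd (bv _)).
have Ev2 n : Ex (P \x P)%E (D `*` D) (v2 n) = \sum_(l < n) moment (n.-1 - l) * moment l.
  rewrite (Ex_sum mDD PP1); last first.
    by move=> l _; apply: bfunM; [exact: (bfun_fst (bv _))|exact: (bfun_snd (bv _))].
  by apply: eq_bigr => l _; rewrite -(Ex_prod mD P1).
pose q1 (p : {poly R}) (x : T) := (toC (dd (fun n => (x : R) ^+ n) p)).[zt].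
have bq1 p : cbfun D (q1 p) by exact: (cbfun_dd p zt bv).
have Eq1 p : CEx P D (q1 p) = (toC (dd moment p)).[zt] by exact: (CEx_dd mD P1 p zt bv).
(* Splits off the pole: [p(x) / (zt - x)] is [p(zt) / (zt - x)] minus a polynomial in [x] and
   [zt]. *)
have pr p x : (p.[x])%:C * resolvent zt x = (toC p).[zt] * resolvent zt x - q1 p x.
  apply: (mulfI (n0 x)); rewrite mulrBr dd_powers /resolvent.
  by rewrite !(mulrCA (zt - x%:C)) mulfV// !mulr1 opprB addrC subrK.
pose g (y : T * T) := (toC (zpoly K z)).[zt] * (resolvent zt y.1 * resolvent zt y.2)
   - (toC (dd (fun n => v2 n y) (zpoly K z))).[zt].
have brr : cbfun (D `*` D) (fun y => resolvent zt y.1 * resolvent zt y.2).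
  by apply: cbfunM; [exact: (cbfun_fst br)|exact: (cbfun_snd br)].
have := @complex_first_variation (fun x => ((zpoly K z).[x])%:C * resolvent zt x)
  (fun j x => ((zpolyj K z j).[x])%:C * resolvent zt x) g.
have -> : CEx (P \x P)%E (D `*` D) g = (toC (zpoly K z)).[zt] * H ^+ 2 -
   (toC (dd (fun n => \sum_(l < n) moment (n.-1 - l) * moment l) (zpoly K z))).[zt].
  rewrite (CExD mDD PP1); last 2 first.
  - by apply: cbfunM => //; exact: cbfun_cst.
  - by apply: cbfunN; exact: cbfun_dd.
  rewrite (CExN mDD PP1); last exact: cbfun_dd.
  rewrite (CExZ mDD PP1)// (CEx_prod mD P1)// -expr2 (CEx_dd mDD PP1 _ _ bv2).
  by congr (_ - (toC (dd _ _)).[zt]); apply/funext => n; exact: Ev2.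
have -> : \sum_(j < K) (pw j)%:C * CEx P D (fun x => ((zpolyj K z j).[x])%:C * resolvent zt x) =
  (toC (bpoly K z pw)).[zt] * H - (toC (\sum_(j < K) pw j *: dd moment (zpolyj K z j))).[zt].
  rewrite /bpoly !rmorph_sum/= !horner_sum mulr_suml -sumrB; apply: eq_bigr => j _.
  rewrite !map_polyZ !hornerZ -mulrA -mulrBr; congr (_ * _).
  have -> : CEx P D (fun x => ((zpolyj K z j).[x])%:C * resolvent zt x) =
    CEx P D (fun x => (toC (zpolyj K z j)).[zt] * resolvent zt x + - q1 (zpolyj K z j) x).
    by apply: eq_CEx => x _; exact: pr.
  have bA : cbfun D (fun x => (toC (zpolyj K z j)).[zt] * resolvent zt x).
    by apply: cbfunM => //; exact: cbfun_cst.
  rewrite (CExD mD P1 bA (cbfunN (bq1 _))) (CExN mD P1 (bq1 _)) (CExZ mD P1 _ br).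
  by rewrite Eq1.
move=> main.
have {}main : (toC (zpoly K z)).[zt] * H ^+ 2 - (toC (dd (fun n => \sum_(l < n) moment (n.-1 - l) * moment l) (zpoly K z))).[zt] +
  2 * ((toC (bpoly K z pw)).[zt] * H - (toC (\sum_(j < K) pw j *: dd moment (zpolyj K z j))).[zt]) = 0.
  apply: main.
  - exact: cbfunM.
  - by move=> j jK; exact: cbfunM.
  - apply: cbfunD; last by apply: cbfunN; exact: cbfun_dd.
    by apply: cbfunM => //; exact: cbfun_cst.
  - move=> x j _ jK; rewrite (zpolyE z jK) hornerM hornerXsubC rmorphM mulrA//.
  - move=> x t _ _; rewrite !pr /g/=.
    have e1 : resolvent zt x - resolvent zt t = (x - t)%:C * (resolvent zt x * resolvent zt t).
      rewrite /resolvent rmorphB/=; field.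
      by rewrite !n0.
    have e2 : q1 (zpoly K z) x - q1 (zpoly K z) t = (x - t)%:C * (toC (dd (fun n => v2 n (x, t)) (zpoly K z))).[zt].
      rewrite /q1 !dd_horner -sumrB mulr_sumr; apply: eq_bigr => k _.
      rewrite -mulrBr mulrCA; congr (_ * _); rewrite -sumrB mulr_sumr; apply: eq_bigr => i _.
      rewrite -mulrBl mulrA; congr (_ * _); rewrite -rmorphM -rmorphB; congr (_%:C).
      exact: subrXX.
    rewrite mulrBr mulrCA -e1 -e2; ring.
rewrite /cpoly rmorphD hornerD /= map_polyZ hornerZ rmorph_nat.
move: main => /eqP; rewrite mulrBr addrACA -opprD subr_eq0 => /eqP <-.
by ring.
Qed.

(** The function [G]: Cauchy transform of [P] with the charges [p_j] added at the [z_j]. *)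
Definition cauchy_sum (zt : R[i]) : R[i] :=
  CEx P D (resolvent zt) + \sum_(j < K) (pw j)%:C * resolvent zt (z j).

Lemma cauchy_sum_sqr (zt : R[i]) : Im zt != 0 ->
  ((toC (zpoly K z)).[zt] * cauchy_sum zt) ^+ 2 = (toC (loop_poly K z pw moment)).[zt].
Proof.
move=> zt0; have n0 x := sub_complex_neq0 x zt0.
have e : (toC (zpoly K z)).[zt] * cauchy_sum zt =
    (toC (zpoly K z)).[zt] * CEx P D (resolvent zt) + (toC (bpoly K z pw)).[zt].
  rewrite mulrDr; congr (_ + _); rewrite mulr_sumr /bpoly rmorph_sum horner_sum.
  apply: eq_bigr => j _; rewrite /= map_polyZ hornerZ mulrCA; congr (_ * _).
  rewrite (zpolyE z (ltn_ord j)) rmorphM hornerM rmorphB/= map_polyX map_polyC hornerXsubC /resolvent.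
  by rewrite mulrAC (mulfV (n0 _)) mul1r.
rewrite e /loop_poly [bpoly K z pw ^+ 2]expr2 rmorphD hornerD !rmorphM /= !hornerM -loop_equation//.
ring.
Qed.

End LoopEquation.

(** * Stieltjes inversion *)

Section ComplexBounds.
Context (R : realType).

Definition normsq (c : R[i]) : R := Re c ^+ 2 + Im c ^+ 2.

Lemma normsqM (c e : R[i]) : normsq (c * e) = normsq c * normsq e.
Proof. by rewrite /normsq cReM cImM; ring. Qed.

Lemma normsq_ge0 (c : R[i]) : 0 <= normsq c.
Proof. by rewrite addr_ge0 ?sqr_ge0. Qed.

Lemma normsq_prod (I : Type) (s : seq I) (Q : pred I) (f : I -> R[i]) :
  normsq (\prod_(i <- s | Q i) f i) = \prod_(i <- s | Q i) normsq (f i).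
Proof.
by apply: (big_morph _ normsqM); rewrite /normsq/= expr1n expr0n addr0.
Qed.

(** Induction along the Horner scheme. The bound is linear in [e] and uniform for [|x| <= X]: it
    gives both the limit at a point and domination on an interval. *)
Lemma horner_near_real (p : {poly R}) (X : R) : exists2 C, 0 <= C &
  forall x e, `|x| <= X -> 0 <= e <= 1 ->
  [/\ `|p.[x]| <= C, `|Re (toC p).[x +i* e] - p.[x]| <= C * e & `|Im (toC p).[x +i* e]| <= C * e].
Proof.
elim/poly_ind: p => [|p c [C C0 hC]].
  by exists 0 => // x e _ _; rewrite rmorph0 !horner0 /= subrr normr0 mul0r lexx.
exists (C * `|X| + `|c| + 2 * C) => [|x e xX e01].
  by rewrite !addr_ge0 ?mulr_ge0.
have [h1 h2 h3] := hC x e xX e01; have /andP[e0 e1] := e01.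
have X0 : `|X| = X by rewrite ger0_norm// (le_trans _ xX).
rewrite rmorphD rmorphM/= map_polyX map_polyC !hornerE.
set q := (toC p).[_] in h2 h3 *; set px := p.[x] in h1 h2 *.
have -> : Re (q * (x +i* e) + c%:C) = Re q * x - Im q * e + c by rewrite cReD cReM.
have -> : Im (q * (x +i* e) + c%:C) = Re q * e + Im q * x by rewrite cImD cImM/= addr0.
have Ce0 : 0 <= C * e by exact: mulr_ge0.
have n1 : `|px * x| <= C * `|X| by rewrite normrM ler_pM// X0.
have n2 : `|(Re q - px) * x| <= C * e * `|X| by rewrite normrM ler_pM// X0.
have n3 : `|Im q * e| <= C * e.
  by rewrite normrM (ger0_norm e0); have := normr_ge0 (Im q); nra.
have n4 : `|Im q * x| <= C * e * `|X| by rewrite normrM ler_pM// X0.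
have n5 : `|(Re q - px) * e| <= C * e.
  by rewrite normrM (ger0_norm e0); have := normr_ge0 (Re q - px); nra.
have n6 : `|px * e| <= C * e by rewrite normrM (ger0_norm e0) ler_wpM2r.
have cc : 0 <= `|c| * e by exact: mulr_ge0.
split.
- by have := ler_normD (px * x) c; lra.
- have -> : Re q * x - Im q * e + c - (px * x + c) = (Re q - px) * x - Im q * e by ring.
  have := ler_normB ((Re q - px) * x) (Im q * e); nra.
- have -> : Re q * e + Im q * x = (Re q - px) * e + px * e + Im q * x by ring.
  have := ler_normD ((Re q - px) * e + px * e) (Im q * x).
  have := ler_normD ((Re q - px) * e) (px * e); nra.
Qed.

Lemma horner_cvg_real (p : {poly R}) (x : R) :
  (fun n => Re (toC p).[x +i* n.+1%:R^-1]) @ \oo --> p.[x] /\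
  (fun n => Im (toC p).[x +i* n.+1%:R^-1]) @ \oo --> (0 : R).
Proof.
have [C C0 hC] := horner_near_real p `|x|.
have Ce : (fun n => C * n.+1%:R^-1) @ \oo --> (0 : R).
  by rewrite -[X in _ --> X](mulr0 C); apply: cvgM; [exact: cvg_cst|exact: cvg_harmonic].
have nC : (fun n => - (C * n.+1%:R^-1)) @ \oo --> (0 : R).
  by rewrite -[X in _ --> X]oppr0; exact: cvgN.
have i01 (n : nat) : 0 <= (n.+1%:R^-1 : R) <= 1.
  by rewrite invr_ge0 ler0n/= invf_le1 ?ltr0n// ler1n.
split.
  have e : (fun n => Re (toC p).[x +i* n.+1%:R^-1]) =
      (fun n => (Re (toC p).[x +i* n.+1%:R^-1] - p.[x]) + p.[x]).
    by apply/funext => n; rewrite subrK.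
  rewrite -[X in _ --> X]add0r e; apply: cvgD; last exact: cvg_cst.
  apply: (squeeze_cvgr _ nC Ce); apply: nearW => n.
  by have [_ h _] := hC x _ (lexx _) (i01 n); rewrite -ler_norml.
apply: (squeeze_cvgr _ nC Ce); apply: nearW => n.
by have [_ _ h] := hC x _ (lexx _) (i01 n); rewrite -ler_norml.
Qed.

End ComplexBounds.

Section BoundaryValues.
Context (R : realType).

(* Boundary values of an analytic square root [G] of [S = p / q ^ 2], seen from the upper half plane. *)
Lemma sqrt_boundary (p q : {poly R}) (G : nat -> R[i]) (x : R) : q.[x] != 0 ->
  (forall n, normsq (toC q).[x +i* n.+1%:R^-1] != 0) ->
  (forall n, ((toC q).[x +i* n.+1%:R^-1] * G n) ^+ 2 = (toC p).[x +i* n.+1%:R^-1]) ->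
  (forall n, Im (G n) <= 0) ->
  (fun n => - Im (G n)) @ \oo --> Num.sqrt (Num.max (- (p.[x] / q.[x] ^+ 2)) 0) /\
  (fun n => Re (G n) ^+ 2) @ \oo --> Num.max (p.[x] / q.[x] ^+ 2) 0.
Proof.
move=> q0 qn0 hG G0; set S := p.[x] / q.[x] ^+ 2.
have [pr pi_] := horner_cvg_real p x.
have [qr qi] := horner_cvg_real (q ^+ 2) x.
set a := (fun n => Re (toC (q ^+ 2)).[_]) in qr; set a' := (fun n => Im (toC (q ^+ 2)).[_]) in qi.
set b := (fun n => Re (toC p).[_]) in pr; set b' := (fun n => Im (toC p).[_]) in pi_.
pose w n := Re (G n ^+ 2); pose w' n := Im (G n ^+ 2).
have eqn n : (toC (q ^+ 2)).[x +i* n.+1%:R^-1] * G n ^+ 2 = (toC p).[x +i* n.+1%:R^-1].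
  by rewrite -hG exprMn expr2 rmorphM/= hornerM -expr2.
have e1 n : a n * w n - a' n * w' n = b n by rewrite /b -eqn cReM.
have e2 n : a n * w' n + a' n * w n = b' n by rewrite /b' -eqn cImM.
have qx0 : (q ^+ 2).[x] ^+ 2 + 0 ^+ 2 != 0 by rewrite expr0n addr0 expf_neq0// horner_exp expf_neq0.
have dn : (fun n => a n ^+ 2 + a' n ^+ 2) @ \oo --> (q ^+ 2).[x] ^+ 2 + 0 ^+ 2.
  by under eq_fun do rewrite !expr2; rewrite !(expr2 _.[_]) (expr2 0); apply: cvgD; exact: cvgM.
have n0 n : a n ^+ 2 + a' n ^+ 2 != 0.
  have -> : a n ^+ 2 + a' n ^+ 2 = normsq (toC (q ^+ 2)).[x +i* n.+1%:R^-1] by [].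
  by rewrite expr2 rmorphM/= hornerM normsqM mulf_neq0.
have wE n : w n = (a n * b n + a' n * b' n) / (a n ^+ 2 + a' n ^+ 2).
  by rewrite -e1 -e2; field; exact: n0.
have w'E n : w' n = (a n * b' n - a' n * b n) / (a n ^+ 2 + a' n ^+ 2).
  by rewrite -e1 -e2; field; exact: n0.
have wS : w @ \oo --> S.
  have -> : S = ((q ^+ 2).[x] * p.[x] + 0 * 0) / ((q ^+ 2).[x] ^+ 2 + 0 ^+ 2).
    by rewrite /S horner_exp; field; rewrite q0.
  rewrite (_ : w = (fun n => (a n * b n + a' n * b' n) * (a n ^+ 2 + a' n ^+ 2)^-1)); last exact/funext.
  by apply: cvgM; [apply: cvgD; exact: cvgM|exact: cvgV].
have w'0 : w' @ \oo --> (0 : R).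
  have -> : 0 = ((q ^+ 2).[x] * 0 - 0 * p.[x]) / ((q ^+ 2).[x] ^+ 2 + 0 ^+ 2) :> R.
    by rewrite mulr0 mul0r subrr mul0r.
  rewrite (_ : w' = (fun n => (a n * b' n - a' n * b n) * (a n ^+ 2 + a' n ^+ 2)^-1)); last exact/funext.
  by apply: cvgM; [apply: cvgB; exact: cvgM|exact: cvgV].
(* [M n] is [|G n| ^ 2]. Together with [w n = Re ^ 2 - Im ^ 2] it determines [Re ^ 2] and [Im ^ 2]
   as half sum and half difference, and [Im (G n) <= 0] selects the root for the imaginary part. *)
pose M n := Num.sqrt (w n * w n + w' n * w' n).
have MS : M @ \oo --> `|S|.
  have -> : `|S| = Num.sqrt (S * S + 0 * 0) by rewrite mul0r addr0 -expr2 sqrtr_sqr.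
  apply: continuous_cvg; first exact: sqrt_continuous.
  by apply: cvgD; exact: cvgM.
have ME n : M n = Re (G n) ^+ 2 + Im (G n) ^+ 2.
  rewrite /M /w /w' expr2 cReM cImM -[RHS]ger0_norm ?addr_ge0 ?sqr_ge0// -sqrtr_sqr; congr Num.sqrt.
  by ring.
have wG n : w n = Re (G n) ^+ 2 - Im (G n) ^+ 2 by rewrite /w expr2 cReM; ring.
have half (f g : nat -> R) (l m : R) : f @ \oo --> l -> g @ \oo --> m -> (fun n => (f n + g n) / 2) @ \oo --> (l + m) / 2.
  by move=> fl gm; apply: cvgM; [exact: cvgD|exact: cvg_cst].
split.
  have -> : Num.max (- S) 0 = (`|S| - S) / 2.
    have [S0|S0] := leP 0 S; first by rewrite max_r ?oppr_le0// ger0_norm// subrr mul0r.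
    by rewrite max_l ?oppr_ge0 ?ltW// ltr0_norm//; field.
  rewrite (_ : (fun n => - Im (G n)) = (fun n => Num.sqrt ((M n - w n) / 2))); last first.
    apply/funext => n; rewrite ME wG (_ : _ / 2 = (- Im (G n)) ^+ 2); last by field.
    by rewrite sqrtr_sqr ger0_norm// oppr_ge0.
  apply: continuous_cvg; first exact: sqrt_continuous.
  by apply: half => //; exact: cvgN.
have -> : Num.max S 0 = (`|S| + S) / 2.
  have [S0|S0] := leP 0 S; first by rewrite ger0_norm//; field.
  by rewrite ltr0_norm//; field.
rewrite (_ : (fun n => Re (G n) ^+ 2) = (fun n => (M n + w n) / 2)); first exact: half.
by apply/funext => n; rewrite ME wG; field.
Qed.

End BoundaryValues.

(** * Convergence theorems and integrals of translated kernels *)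

Section BoundedConvergence.
Context d (T : measurableType d) (R : realType).
Variables (m : {measure set T -> \bar R}) (D : set T).
Hypotheses (mD : measurable D) (Dfin : (m D < +oo)%E).

Lemma integrable_bounded (f : T -> R) (M : R) : measurable_fun D f ->
  (forall x, D x -> `|f x| <= M) -> m.-integrable D (EFin \o f).
Proof.
move=> mf fM; apply: measurable_bounded_integrable => //.
exists M; split; first exact: num_real.
by move=> N MN x Dx; apply: le_trans (ltW MN); exact: fM.
Qed.

Lemma ae_dominated_Rintegral_cvg (N : set T) (f_ : nat -> T -> R) (f g : T -> R) :
  measurable N -> m N = 0%E ->
  (forall n, measurable_fun D (f_ n)) -> measurable_fun D f ->
  (forall x, D x -> ~ N x -> f_ ^~ x @ \oo --> f x) ->
  m.-integrable D (EFin \o g) -> (forall n x, D x -> ~ N x -> `|f_ n x| <= g x) ->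
  m.-integrable D (EFin \o f) /\
  (fun n => \int[m]_(x in D) f_ n x)%R @ \oo --> (\int[m]_(x in D) f x)%R.
Proof.
move=> mN N0 mf_ mf fc ig fg.
have Hc : {ae m, forall x, D x -> (fun n => (EFin \o f_ n) x) @ \oo --> (EFin \o f) x}.
  exists N; split => // x /=; apply: contra_notP => Nx Dx.
  by apply: cvg_EFin; [exact: nearW|exact: fc].
have Hb : {ae m, forall x n, D x -> (`|(EFin \o f_ n) x| <= (EFin \o g) x)%E}.
  exists N; split => // x /=; apply: contra_notP => Nx n Dx.
  by rewrite lee_fin fg.
have mF n : measurable_fun D (EFin \o f_ n) by exact/measurable_EFinP.
have mF' : measurable_fun D (EFin \o f) by exact/measurable_EFinP.
have [i_f _ cv] := dominated_convergence mD mF mF' Hc ig Hb.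
split=> //; apply: fine_cvg; rewrite fineK//; exact: integrable_fin_num.
Qed.

Lemma dominated_Rintegral_cvg (f_ : nat -> T -> R) (f g : T -> R) :
  (forall n, measurable_fun D (f_ n)) -> measurable_fun D f ->
  (forall x, D x -> f_ ^~ x @ \oo --> f x) ->
  m.-integrable D (EFin \o g) -> (forall n x, D x -> `|f_ n x| <= g x) ->
  m.-integrable D (EFin \o f) /\
  (fun n => \int[m]_(x in D) f_ n x)%R @ \oo --> (\int[m]_(x in D) f x)%R.
Proof.
move=> mf_ mf fc ig fg.
by apply: (ae_dominated_Rintegral_cvg (N := set0) (g := g)) => // [x ? _|n x ? _]; [exact: fc|exact: fg].
Qed.

Lemma bounded_Rintegral_cvg (f_ : nat -> T -> R) (f : T -> R) (M : R) :
  (forall n, measurable_fun D (f_ n)) -> measurable_fun D f ->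
  (forall x, D x -> f_ ^~ x @ \oo --> f x) ->
  (forall n x, D x -> `|f_ n x| <= M) ->
  (fun n => \int[m]_(x in D) f_ n x)%R @ \oo --> (\int[m]_(x in D) f x)%R.
Proof.
move=> mf_ mf fc fM.
apply: (dominated_Rintegral_cvg (g := fun=> `|M|) mf_ mf fc _ _).2.
  by apply: (@integrable_bounded _ `|M|) => //= x _; rewrite normr_id.
by move=> n x Dx; apply: le_trans (fM n x Dx) (ler_norm _).
Qed.

End BoundedConvergence.

Section FundamentalTheorem.
Context (R : realType).
Local Notation leb := (@lebesgue_measure R).

Lemma is_derive_continuous (f : R -> R) (x l : R) : is_derive x 1 f l -> {for x, continuous f}.
Proof. by move=> [df _]; apply: differentiable_continuous; exact/derivable1_diffP. Qed.

Lemma ftc2 (phi Phi : R -> R) (c d : R) : c < d ->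
  (forall x, is_derive x (1 : R) Phi (phi x)) -> continuous phi ->
  (\int[leb]_(x in `[c, d]) (phi x)%:E = (Phi d - Phi c)%:E)%E.
Proof.
move=> cd dPhi cphi.
have cPhi x : {for x, continuous Phi} by exact: is_derive_continuous.
rewrite (@continuous_FTC2 R phi Phi)//.
- by apply: continuous_subspaceT.
- split.
  + by move=> x _; have [] := dPhi x.
  + by apply: cvg_at_right_filter; exact: cPhi.
  + by apply: cvg_at_left_filter; exact: cPhi.
- by move=> x _; rewrite derive1E; have [_] := dPhi x.
Qed.

End FundamentalTheorem.

Section FubiniTranslates.
Context (R : realType).
Local Notation T := (measurableTypeR R).
Local Notation leb := (lebesgue_measure : {measure set T -> \bar R}).
Variables (P : probability T R) (D : set T).
Hypotheses (mD : measurable D) (P1 : P D = 1%E).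
Variables (phi Phi : R -> R) (M : R).
Hypothesis dPhi : forall x, is_derive x (1 : R) Phi (phi x).
Hypothesis cphi : continuous phi.
Hypothesis phiM : forall x, `|phi x| <= M.

Let mphi : measurable_fun setT phi.
Proof. exact: continuous_measurable_fun. Qed.

Lemma bfun_translate x : bfun D (fun t : T => phi (x - t)).
Proof.
split; last by exists M => t _; exact: phiM.
by apply: (measurableT_comp mphi); exact: measurable_funB.
Qed.

Lemma Ex_translate_le x : `|Ex P D (fun t : T => phi (x - t))| <= M.
Proof.
have bt := bfun_translate x.
have lo : Ex P D (fun=> - M) <= Ex P D (fun t : T => phi (x - t)).
  apply: (ler_Ex mD P1) => //; first exact: bfun_cst.
  by move=> t _; have := phiM (x - t); rewrite ler_norml => /andP[].
have hi : Ex P D (fun t : T => phi (x - t)) <= Ex P D (fun=> M).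
  apply: (ler_Ex mD P1) => //; first exact: bfun_cst.
  by move=> t _; have := phiM (x - t); rewrite ler_norml => /andP[].
by move: lo hi; rewrite !(Ex_cst mD P1) ler_norml => -> ->.
Qed.

Let fshift (c d : R) (y : T * T) : \bar R :=
  ((phi (y.1 - y.2) + M) * (\1_(`[c, d]%classic : set T) y.1 * \1_D y.2))%:E.

Let mfshift c d : measurable_fun setT (fshift c d).
Proof.
apply/measurable_EFinP; apply: measurable_funM.
  apply: measurable_funD => //; apply: (measurableT_comp mphi); exact: measurable_funB.
have m1 : measurable_fun setT (\1_(`[c, d]%classic : set T) : T -> R).
  by apply: measurable_indic; exact: measurable_itv.
have m2 : measurable_fun setT (\1_D : T -> R) by exact: measurable_indic.
by apply: measurable_funM; [exact: (measurableT_comp m1)|exact: (measurableT_comp m2)].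
Qed.

Let fshift_ge0 c d y : (0 <= fshift c d y)%E.
Proof.
rewrite lee_fin mulr_ge0 ?mulr_ge0 ?indicE//.
by have := phiM (y.1 - y.2); rewrite ler_norml => /andP[]; lra.
Qed.

(** The constant [M] makes the integrand nonnegative, so that Tonelli applies; it contributes
    [M * (d - c)] to both sides and is cancelled at the end. *)
Lemma fubini_translate (c d : R) : c < d ->
  measurable_fun (`[c, d]%classic : set T) (fun x : T => Ex P D (fun t : T => phi (x - t))) /\
  (\int[leb]_(x in `[c, d]) Ex P D (fun t : T => phi (x - t)))%R =
  Ex P D (fun t : T => Phi (d - t) - Phi (c - t)).
Proof.
move=> cd.
have mcd : measurable (`[c, d]%classic : set T) by exact: measurable_itv.
have F1 x : (\int[P]_t fshift c d (x, t) =
   ((Ex P D (fun t : T => phi (x - t)) + M) * \1_(`[c, d]%classic : set T) x)%:E)%E.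
  transitivity (\int[P]_(t in D) ((phi (x - t) + M) * \1_(`[c, d]%classic : set T) x)%:E)%E.
    rewrite [RHS]integral_mkcond; apply: eq_integral => t _; rewrite /fshift patchE/=.
    by rewrite !indicE; case: (t \in D); rewrite ?mulr1// !mulr0.
  have bs : bfun D (fun t : T => phi (x - t) + M) by apply: bfunD; [exact: bfun_translate|exact: bfun_cst].
  rewrite (ExE mD P1); last by apply: bfunM => //; exact: bfun_cst.
  congr EFin; under eq_fun do rewrite mulrC; rewrite (ExZ mD P1)// mulrC; congr (_ * _).
  by rewrite (ExD mD P1) ?(Ex_cst mD P1)//; [exact: bfun_translate|exact: bfun_cst].
have F2 t : (\int[leb]_x fshift c d (x, t) =
   ((Phi (d - t) - Phi (c - t) + M * (d - c)) * \1_D t)%:E)%E.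
  transitivity (\int[leb]_(x in `[c, d]) ((phi (x - t) + M) * \1_D t)%:E)%E.
    rewrite [RHS]integral_mkcond; apply: eq_integral => x _; rewrite /fshift patchE/=.
    by rewrite !indicE; case: (x \in _); rewrite ?mul1r// mul0r mulr0.
  pose Psi (x : R) := (Phi (x - t) + M * x) * \1_D t.
  have dPsi x : is_derive x (1 : R) Psi ((phi (x - t) + M) * \1_D t).
    have d1 : is_derive x (1 : R) (fun x => Phi (x - t)) (phi (x - t) * 1).
      by apply: (@is_derive1_comp R Phi (fun x => x - t)); apply: is_derive_eq; rewrite subr0.
    by rewrite /Psi; apply: is_derive_eq; rewrite ?mulr1 /GRing.scale/=; ring.
  have cPsi : continuous (fun x => (phi (x - t) + M) * \1_D t).
    move=> x; apply: cvgM; last exact: cvg_cst.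
    apply: cvgD; last exact: cvg_cst.
    apply: (@continuous_comp _ _ _ (fun x => x - t) phi); last exact: cphi.
    by apply: cvgB; [exact: cvg_id|exact: cvg_cst].
  by rewrite (ftc2 cd dPsi cPsi) /Psi; congr EFin; ring.
have mF : measurable_fun setT (fun x : T => (Ex P D (fun t : T => phi (x - t)) + M) * \1_(`[c, d]%classic : set T) x).
  apply/measurable_EFinP; rewrite (_ : EFin \o _ = fubini_F P (fshift c d)).
    exact: measurable_fun_fubini_tonelli_F.
  by apply/funext => x; rewrite /fubini_F F1.
have mE : measurable_fun (`[c, d]%classic : set T) (fun x : T => Ex P D (fun t : T => phi (x - t))).
  apply: (@eq_measurable_fun _ _ _ _ _ (fun x : T => (Ex P D (fun t : T => phi (x - t)) + M) * \1_(`[c, d]%classic : set T) x - M)).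
    by move=> x xcd; rewrite indicE xcd mulr1 addrK.
  by apply: measurable_funTS; exact: measurable_funB.
split=> //.
have ib : leb.-integrable `[c, d] (EFin \o (fun x : T => Ex P D (fun t : T => phi (x - t)))).
  apply: (@integrable_bounded _ _ _ _ _ _ _ _ M) => //.
    by rewrite /= lebesgue_measure_itv/= lte_fin cd ltry.
  by move=> x _; exact: Ex_translate_le.
have lcd : leb `[c, d]%classic = (d - c)%:E by rewrite /= lebesgue_measure_itv/= lte_fin cd EFinB.
have icst : leb.-integrable `[c, d] (EFin \o (fun=> M)).
  by apply: (@integrable_bounded _ _ _ _ _ _ _ _ `|M|) => //; rewrite lcd ltry.
have L : (\int[leb]_x \int[P]_t fshift c d (x, t) =
   (\int[leb]_(x in `[c, d]) Ex P D (fun t : T => phi (x - t)) + M * (d - c))%R%:E)%E.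
  transitivity (\int[leb]_(x in `[c, d]) (Ex P D (fun t : T => phi (x - t)) + M)%:E)%E.
    rewrite [RHS]integral_mkcond; apply: eq_integral => x _; rewrite F1 patchE indicE.
    by case: (x \in _); rewrite ?mulr1 ?mulr0.
  rewrite -[LHS]fineK; last first.
    apply: integrable_fin_num => //; apply: (integrableD mcd ib icst).
  congr EFin; rewrite -/(Rintegral _ _ _) RintegralD//; congr (_ + _).
  by rewrite Rintegral_cst// lcd.
have Rr : (\int[P]_t \int[leb]_x fshift c d (x, t) =
   (Ex P D (fun t : T => Phi (d - t) - Phi (c - t)) + M * (d - c))%:E)%E.
  transitivity (\int[P]_(t in D) (Phi (d - t) - Phi (c - t) + M * (d - c))%:E)%E.
    rewrite [RHS]integral_mkcond; apply: eq_integral => t _; rewrite F2 patchE indicE.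
    by case: (t \in _); rewrite ?mulr1 ?mulr0.
  (* [Phi] itself may be unbounded; the mean value theorem bounds its increments over the length
     [d - c]. *)
  have bPhi : bfun D (fun t : T => Phi (d - t) - Phi (c - t)).
    have cPhi : continuous Phi by move=> x; exact: is_derive_continuous.
    have mPhi : measurable_fun setT Phi by exact: continuous_measurable_fun.
    split.
      by apply: measurable_funB; apply: (measurableT_comp mPhi); exact: measurable_funB.
    exists (M * (d - c)) => t _.
    have ct : c - t <= d - t by rewrite lerD2r ltW.
    have [xi _ ->] := MVT_segment ct (fun x _ => dPhi x) (continuous_subspaceT cPhi).
    rewrite normrM (_ : d - t - (c - t) = d - c); last by ring.
    have dc0 : 0 <= d - c by rewrite subr_ge0 ltW.
    by rewrite (ger0_norm dc0) ler_wpM2r.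
  rewrite (ExE mD P1); last by apply: bfunD => //; exact: bfun_cst.
  by rewrite (ExD mD P1) ?(Ex_cst mD P1)//; exact: bfun_cst.
have e := fubini_tonelli (m1 := leb) (m2 := P) (fshift c d) (mfshift c d) (fshift_ge0 c d).
rewrite L Rr in e; exact: (addIr _ (EFin_inj e)).
Qed.

End FubiniTranslates.

(** * Poisson and conjugate Poisson kernels *)

Section PoissonKernels.
Context (R : realType).
Implicit Types e s : R.

(** [1 / (s + i e)] equals [conj_poisson e s - i poisson e s], so integrating the kernels at [x - t]
    gives the real part and minus the imaginary part of a Cauchy transform at [x + i e]. *)
Definition poisson e s := e / (s ^+ 2 + e ^+ 2).
Definition conj_poisson e s := s / (s ^+ 2 + e ^+ 2).

Let den_gt0 e s : 0 < e -> 0 < s ^+ 2 + e ^+ 2.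
Proof. by move=> e0; rewrite ltr_wpDl ?sqr_ge0// exprn_gt0. Qed.

Let cden e : continuous (fun s : R => s ^+ 2 + e ^+ 2).
Proof.
move=> s; apply: cvgD; last exact: cvg_cst.
by under eq_fun do rewrite expr2; rewrite expr2; apply: cvgM; exact: cvg_id.
Qed.

Lemma continuous_poisson e : 0 < e -> continuous (poisson e).
Proof.
move=> e0 s; apply: cvgM; first exact: cvg_cst.
by apply: cvgV; [rewrite gt_eqF// den_gt0|exact: cden].
Qed.

Lemma continuous_conj_poisson e : 0 < e -> continuous (conj_poisson e).
Proof.
move=> e0 s; apply: cvgM; first exact: cvg_id.
by apply: cvgV; [rewrite gt_eqF// den_gt0|exact: cden].
Qed.

Lemma poisson_le e s : 0 < e -> `|poisson e s| <= e^-1.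
Proof.
move=> e0; have d0 := den_gt0 s e0; rewrite normrM normfV !gtr0_norm// ler_pdivrMr//.
by rewrite ler_pdivlMl// -expr2 lerDr sqr_ge0.
Qed.

Lemma conj_poisson_le e s : 0 < e -> `|conj_poisson e s| <= e^-1.
Proof.
move=> e0; have d0 := den_gt0 s e0; rewrite normrM normfV (gtr0_norm d0) ler_pdivrMr//.
rewrite ler_pdivlMl// -(real_normK (num_real s)).
have := sqr_ge0 (`|s| - e); have := normr_ge0 s; nra.
Qed.

Lemma poisson_ge0 e s : 0 < e -> 0 <= poisson e s.
Proof. by move=> e0; apply: divr_ge0; rewrite ltW// den_gt0. Qed.

Lemma is_derive_poisson e s : 0 < e -> is_derive s (1 : R) (fun s => atan (s / e)) (poisson e s).
Proof.
move=> e0; have d1 : is_derive s (1 : R) (fun s : R => s * e^-1) e^-1.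
  by apply: is_derive_eq; rewrite /GRing.scale/= mulr1 mulr0 add0r.
have := @is_derive1_comp R (@atan R) (fun s => s * e^-1) s _ _ (is_derive1_atan _) d1.
move=> h; apply: is_derive_eq; rewrite /poisson; field.
by rewrite !gt_eqF// den_gt0.
Qed.

Lemma is_derive_conj_poisson e s : 0 < e ->
  is_derive s (1 : R) (fun s => ln (s ^+ 2 + e ^+ 2) / 2) (conj_poisson e s).
Proof.
move=> e0; have d1 : is_derive s (1 : R) (fun s : R => s ^+ 2 + e ^+ 2) (2 * s).
  by apply: is_derive_eq; rewrite /GRing.scale/=; ring.
have := @is_derive1_comp R (@ln R) (fun s => s ^+ 2 + e ^+ 2) s _ _ (is_derive1_ln (den_gt0 s e0)) d1.
move=> h; have h2 : is_derive s (1 : R) (fun s => ln (s ^+ 2 + e ^+ 2) * 2^-1) (conj_poisson e s).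
  apply: is_derive_eq; rewrite /conj_poisson /GRing.scale/=; field.
  by rewrite gt_eqF// den_gt0.
exact: h2.
Qed.

Lemma atanV_pos (x : R) : 0 < x -> atan x = pi / 2 - atan x^-1.
Proof.
move=> x0; have y0 : 0 < atan x^-1 by rewrite -(@atan0 R); apply: lt_atan; rewrite invr_gt0.
have yp := atan_ltpi2 x^-1.
apply: tan_inj.
- by rewrite in_itv/= atan_gtNpi2 atan_ltpi2.
- by rewrite in_itv/=; apply/andP; split; lra.
rewrite atanK /tan sinB cosB sin_pihalf cos_pihalf !mul1r !mul0r subr0 add0r -[LHS]invrK.
by rewrite -{1}[x^-1]atanK /tan invf_div.
Qed.

Lemma cvg_atan_sg s :
  (fun n => atan (s / n.+1%:R^-1)) @ \oo --> Num.sg s * (pi / 2).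
Proof.
have pos (r : R) : 0 < r -> (fun n => atan (r / n.+1%:R^-1)) @ \oo --> pi / 2.
  move=> r0; have [->|] := pselect ((fun n => atan (r / n.+1%:R^-1)) = (fun n => pi / 2 - atan (r^-1 * n.+1%:R^-1))).
    rewrite -[X in _ --> X]subr0 -(@atan0 R); apply: cvgB; first exact: cvg_cst.
    apply: continuous_cvg; first exact: continuous_atan.
    by rewrite -[X in _ --> X](mulr0 r^-1); apply: cvgM; [exact: cvg_cst|exact: cvg_harmonic].
  by case; apply/funext => n; rewrite invrK -invfM -atanV_pos ?mulr_gt0.
have [s0|s0|->] := ltrgtP s 0.
- rewrite ltr0_sg// mulN1r.
  rewrite (_ : (fun n => _) = (fun n => - atan ((- s) / n.+1%:R^-1))); last first.
    by apply/funext => n; rewrite mulNr atanN opprK.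
  by apply: cvgN; apply: pos; rewrite oppr_gt0.
- by rewrite gtr0_sg// mul1r; exact: pos.
- rewrite sgr0 mul0r (_ : (fun n => _) = fun=> 0); first exact: cvg_cst.
  by apply/funext => n; rewrite mul0r atan0.
Qed.

End PoissonKernels.

(** * Boundary values of the Cauchy transform *)

Section InversionFormulas.
Context (R : realType) (K : nat) (A : R) (z pw : nat -> R).
Hypotheses (hK : (2 <= K)%N) (hA : 0 < A).
Hypothesis hp : forall i : nat, (i < K)%N -> 0 < pw i.
Hypothesis hz : forall i : nat, (i.+1 < K)%N -> z i < z i.+1.
Local Notation w := (weightw K A z pw).
Local Notation T := (measurableTypeR R).
Local Notation D := (`[z 0%N, z K.-1]%classic : set T).
Local Notation leb := (lebesgue_measure : {measure set T -> \bar R}).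
Variable P : probability T R.
Hypothesis PD : P (~` D) = 0%E.
Hypothesis Pmin : forall nu : {measure set T -> \bar R},
  unit_measure_on (z 0%N) (z K.-1) nu -> (wenergy w P <= wenergy w nu)%E.
Hypothesis Pfin : (wenergy w P < +oo)%E.

Let mD : measurable D.
Proof. exact: measurable_itv. Qed.
Let P1 : P D = 1%E.
Proof. exact: prob_carrier1. Qed.

(* Integration against [P + \sum_j pw j * dirac (z j)]. *)
Definition charged (f : R -> R) : R := Ex P D (f : T -> R) + \sum_(j < K) pw j * f (z j).

Definition off_z (c d : R) := forall j : nat, (j < K)%N -> ~ (c <= z j <= d).

Lemma charged_integral (phi Phi : R -> R) (M c d : R) : c < d ->
  (forall x, is_derive x (1 : R) Phi (phi x)) -> continuous phi ->
  (forall x, `|phi x| <= M) ->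
  measurable_fun (`[c, d]%classic : set T) (fun x : T => charged (fun t => phi (x - t))) /\
  (\int[leb]_(x in `[c, d]) charged (fun t => phi ((x : R) - t)))%R =
  charged (fun t => Phi (d - t) - Phi (c - t)).
Proof.
move=> cd dPhi cphi phiM.
have mcd : measurable (`[c, d]%classic : set T) by exact: measurable_itv.
have lcd : leb `[c, d]%classic = (d - c)%:E by rewrite /= lebesgue_measure_itv/= lte_fin cd EFinB.
have fcd : (leb `[c, d]%classic < +oo)%E by rewrite lcd ltry.
have [mE IE] := fubini_translate mD P1 dPhi cphi phiM cd.
have mphi : measurable_fun setT phi by exact: continuous_measurable_fun.
pose g (x : T) := \sum_(j < K) pw j * phi (x - z j).
have cg : continuous g.
  move=> x; apply: (cvg_big add_continuous) => j _.
  apply: cvgM; first exact: cvg_cst.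
  apply: (@continuous_comp _ _ _ (fun x => x - z j) phi); last exact: cphi.
  by apply: cvgB; [exact: cvg_id|exact: cvg_cst].
have mg : measurable_fun (`[c, d]%classic : set T) g.
  by apply: measurable_funTS; exact: continuous_measurable_fun.
pose G (x : R) := \sum_(j < K) pw j * Phi (x - z j).
have dG x : is_derive x (1 : R) G (g x).
  rewrite (_ : G = \sum_(j < K) (fun x : R => pw j * Phi (x - z j))); last first.
    by apply/funext => y; rewrite fct_sumE.
  apply: is_derive_sum => j.
  have d1 : is_derive x (1 : R) (fun x => Phi (x - z j)) (phi (x - z j) * 1).
    by apply: (@is_derive1_comp R Phi (fun x => x - z j)); apply: is_derive_eq; rewrite subr0.
  have d2 := @is_deriveZ R _ _ _ (pw j) x 1 _ d1.
  by apply: (is_derive_eq d2); rewrite mulr1.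
have Ig : (\int[leb]_(x in `[c, d]) g x)%R = G d - G c by rewrite /Rintegral (ftc2 cd dG cg).
split; first by apply: measurable_funD.
rewrite RintegralD//; last 2 first.
- apply: (integrable_bounded mcd fcd (M := M)) => // x _; exact: Ex_translate_le.
- apply: continuous_compact_integrable; first exact: segment_compact.
  exact: continuous_subspaceT.
rewrite IE Ig /charged /G -sumrB; congr (_ + _).
by apply: eq_bigr => j _; rewrite mulrBr.
Qed.

Lemma charged_cvg (f_ : nat -> R -> R) (f g : R -> R) :
  (forall n, measurable_fun D (f_ n)) -> measurable_fun D f ->
  (forall x, D x -> f_ ^~ x @ \oo --> f x) ->
  P.-integrable D (EFin \o g) -> (forall n x, D x -> `|f_ n x| <= g x) ->
  (fun n => charged (f_ n)) @ \oo --> charged f.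
Proof.
move=> mf_ mf fc ig fg; apply: cvgD.
  exact: (dominated_Rintegral_cvg mD mf_ mf fc ig fg).2.
apply: (cvg_big add_continuous) => j _; apply: cvgM; first exact: cvg_cst.
by apply: fc; exact: z_in.
Qed.

Local Notation eps n := (n.+1%:R^-1 : R).
Local Notation Pi := (loop_poly K z pw (moment K z P)).
Definition cauchy_at n x := cauchy_sum K z pw P (x +i* eps n).
(** Boundary value of [G ^ 2] on the real line away from the [z_j]. *)
Definition disc (x : R) := Pi.[x] / (zpoly K z).[x] ^+ 2.

Let eps_gt0 n : 0 < eps n. Proof. by rewrite invr_gt0. Qed.

Lemma Re_cauchy_at n x : Re (cauchy_at n x) = charged (fun t => conj_poisson (eps n) (x - t)).
Proof.
have e0 := eps_gt0 n; have i0 : Im (x +i* eps n) != 0 by rewrite /= gt_eqF.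
rewrite /cauchy_at /cauchy_sum cReD cRe_sum; congr (_ + _).
  by apply: eq_Ex => t _; rewrite resolventE.
by apply: eq_bigr => j _; rewrite cReZ resolventE.
Qed.

Lemma Im_cauchy_at n x : - Im (cauchy_at n x) = charged (fun t => poisson (eps n) (x - t)).
Proof.
have e0 := eps_gt0 n; have i0 : Im (x +i* eps n) != 0 by rewrite /= gt_eqF.
rewrite /cauchy_at /cauchy_sum cImD cIm_sum opprD -sumrN; congr (_ + _).
  have [_ bI] := cbfun_resolvent (z 0%N) (z K.-1) i0.
  transitivity (- Ex P D (fun t : T => Im (resolvent (x +i* eps n) t))) => //.
  rewrite -(ExN mD P1 bI).
  by apply: eq_Ex => t _; rewrite (resolventE _ i0) /= opprK.
by apply: eq_bigr => j _; rewrite cImZ resolventE//= mulrN opprK.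
Qed.

Lemma Im_cauchy_at_le0 n x : Im (cauchy_at n x) <= 0.
Proof.
rewrite -oppr_ge0 Im_cauchy_at addr_ge0//.
  by apply: Ex_ge0 => t _; exact: poisson_ge0.
by apply: sumr_ge0 => j _; rewrite mulr_ge0 ?poisson_ge0// ltW// hp.
Qed.

Lemma normsq_zpoly x e :
  normsq (toC (zpoly K z)).[x +i* e] = \prod_(m < K) ((x - z m) ^+ 2 + e ^+ 2).
Proof.
rewrite rmorph_prod horner_prod normsq_prod; apply: eq_bigr => m _.
by rewrite rmorphB/= map_polyX map_polyC hornerXsubC /normsq/= subr0.
Qed.

Lemma normsq_zpoly_ge x e : (zpoly K z).[x] ^+ 2 <= normsq (toC (zpoly K z)).[x +i* e].
Proof.
rewrite normsq_zpoly horner_zpoly -prodrXl; apply: ler_prod => m _.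
by rewrite sqr_ge0 lerDl sqr_ge0.
Qed.

Lemma normsq_zpoly_neq0 n x : normsq (toC (zpoly K z)).[x +i* eps n] != 0.
Proof.
rewrite gt_eqF// normsq_zpoly; apply: prodr_gt0 => m _.
by rewrite ltr_wpDl ?sqr_ge0// exprn_gt0.
Qed.

Lemma cauchy_at_sqr n x :
  ((toC (zpoly K z)).[x +i* eps n] * cauchy_at n x) ^+ 2 = (toC Pi).[x +i* eps n].
Proof. by apply: (cauchy_sum_sqr hK hA hp hz PD Pmin Pfin); rewrite /= gt_eqF. Qed.

Lemma zpoly_neq0 x : (forall j, (j < K)%N -> x != z j) -> (zpoly K z).[x] != 0.
Proof.
by move=> xz; rewrite horner_zpoly; apply/prodf_neq0 => m _; rewrite subr_eq0 xz.
Qed.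

Lemma cauchy_at_cvg x : (forall j, (j < K)%N -> x != z j) ->
  (fun n => - Im (cauchy_at n x)) @ \oo --> Num.sqrt (Num.max (- disc x) 0) /\
  (fun n => Re (cauchy_at n x) ^+ 2) @ \oo --> Num.max (disc x) 0.
Proof.
move=> xz; apply: sqrt_boundary; first exact: zpoly_neq0.
- by move=> n; exact: normsq_zpoly_neq0.
- by move=> n; exact: cauchy_at_sqr.
- by move=> n; exact: Im_cauchy_at_le0.
Qed.

Lemma off_z_neq c d x j : off_z c d -> c <= x <= d -> (j < K)%N -> x != z j.
Proof. by move=> cd xcd jK; apply/eqP => xz; apply: (cd j jK); rewrite -xz. Qed.

(** [|zpoly|] only increases off the real axis and has a positive minimum on [[c, d]], so
    [(zpoly G) ^ 2 = Pi] bounds [G] uniformly down to the axis. This is the domination behind the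
    inversion formulas. *)
Lemma cauchy_at_le (c d : R) : c <= d -> off_z c d ->
  exists M, forall n x, c <= x <= d -> `|Re (cauchy_at n x)| <= M /\ `|Im (cauchy_at n x)| <= M.
Proof.
move=> cd ncd.
have [C C0 hC] := horner_near_real Pi (`|c| + `|d|).
have ch : {within `[c, d], continuous (fun x => `|(zpoly K z).[x]|)}.
  apply: continuous_subspaceT => x; apply: cvg_norm; exact: continuous_horner.
have [y ycd hy] := EVT_min cd ch.
set q := (zpoly K z).[y] in hy.
have q0 : q != 0 by apply: zpoly_neq0 => j jK; apply: (off_z_neq ncd ycd jK).
have q2 : 0 < q ^+ 2 by rewrite exprn_even_gt0.
(* [5 C ^ 2 = (2 C) ^ 2 + C ^ 2] bounds [|Pi| ^ 2]; each added [1] replaces a square root, through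
   [t <= 1 + t ^ 2]. *)
exists (1 + (1 + 5 * C ^+ 2) / q ^+ 2) => n x xcd.
have /andP[cx xd] := xcd.
have xX : `|x| <= `|c| + `|d|.
  rewrite ler_norml; have := ler_norm d; have := ler_norm (- c); rewrite normrN.
  by have := normr_ge0 c; have := normr_ge0 d; move=> *; apply/andP; split; lra.
have e01 : 0 <= eps n <= 1 by rewrite ltW//= invf_le1 ?ltr0n// ler1n.
have [h1 h2 h3] := hC x (eps n) xX e01.
have Nb : normsq (toC Pi).[x +i* eps n] <= 5 * C ^+ 2.
  have /andP[e0 e1] := e01.
  have Ce : C * eps n <= C by rewrite ler_piMr.
  have k3 : `|Im (toC Pi).[x +i* eps n]| <= C by exact: le_trans h3 Ce.
  have k2 : `|Re (toC Pi).[x +i* eps n]| <= 2 * C.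
    move: (le_trans h2 Ce) h1; set a := Re _; set b := Pi.[x] => h2' h1'.
    by have := ler_normD (a - b) b; rewrite subrK; lra.
  rewrite /normsq -(real_normK (num_real (Re _))) -(real_normK (num_real (Im (toC _).[_]))).
  have := normr_ge0 (Im (toC Pi).[x +i* eps n]); have := normr_ge0 (Re (toC Pi).[x +i* eps n]); nra.
set g := cauchy_at n x.
have gb : normsq g <= (1 + 5 * C ^+ 2) / q ^+ 2.
  rewrite ler_pdivlMr//.
  have := cauchy_at_sqr n x; rewrite -/g => e.
  have {e}e : (normsq (toC (zpoly K z)).[x +i* eps n] * normsq g) ^+ 2 = normsq (toC Pi).[x +i* eps n].
    by rewrite -normsqM expr2 -normsqM -expr2 e.
  set a := normsq _ in e.
  have qa : q ^+ 2 <= a.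
    apply: le_trans (normsq_zpoly_ge x (eps n)).
    rewrite -(real_normK (num_real q)) -[leRHS](real_normK (num_real _)) ler_sqr ?nnegrE//; exact: hy.
  have g0 := normsq_ge0 g.
  have : normsq g * q ^+ 2 <= a * normsq g by rewrite mulrC ler_wpM2r.
  move: Nb; rewrite -e; set X := a * normsq g; set Y := normsq g * _; nra.
have : Re g ^+ 2 + Im g ^+ 2 <= (1 + 5 * C ^+ 2) / q ^+ 2 by exact: gb.
set B := _ / _; rewrite -(real_normK (num_real (Re g))) -(real_normK (num_real (Im g))).
by have := normr_ge0 (Re g); have := normr_ge0 (Im g); move=> *; split; nra.
Qed.

(** The limit of [- Im G], that is [pi] times the density of [P]. *)
Definition density (x : R) : R := Num.sqrt (Num.max (- disc x) 0).

Lemma density_ge0 x : 0 <= density x. Proof. exact: sqrtr_ge0. Qed.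

(** Integrated over [[c, d]], the Poisson integrals become sums of differences of arctangents, whose
    limits are signs. A mass at an endpoint thus counts by half. *)
Lemma density_integral (c d : R) : c < d -> off_z c d ->
  [/\ leb.-integrable `[c, d] (EFin \o density), exists M, forall x, c <= x <= d -> density x <= M &
  (\int[leb]_(x in `[c, d]) density x)%R =
    Ex P D (fun t : T => (Num.sg (d - t) - Num.sg (c - t)) * (pi / 2))].
Proof.
move=> cd ncd.
have mcd : measurable (`[c, d]%classic : set T) by exact: measurable_itv.
have lcd : leb `[c, d]%classic = (d - c)%:E by rewrite /= lebesgue_measure_itv/= lte_fin cd EFinB.
have fcd : (leb `[c, d]%classic < +oo)%E by rewrite lcd ltry.
have [M hM] := cauchy_at_le (ltW cd) ncd.
pose v n (x : T) := charged (fun t => poisson (eps n) (x - t)).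
have vE n x : v n x = - Im (cauchy_at n x) by rewrite Im_cauchy_at.
have key n := charged_integral cd (fun x => is_derive_poisson x (eps_gt0 n)) (continuous_poisson (eps_gt0 n)) (fun x => poisson_le x (eps_gt0 n)).
have mv n : measurable_fun (`[c, d]%classic : set T) (v n) by exact: (key n).1.
have vM n (x : T) : `[c, d]%classic x -> `|v n x| <= M.
  by rewrite /= in_itv/= => xcd; rewrite vE normrN; exact: (hM n x xcd).2.
have vc (x : T) : `[c, d]%classic x -> v ^~ x @ \oo --> density x.
  rewrite /= in_itv/= => xcd; under eq_fun do rewrite vE.
  have xz j (jK : (j < K)%N) := off_z_neq ncd xcd jK.
  exact: (cauchy_at_cvg xz).1.
have md : measurable_fun (`[c, d]%classic : set T) density.
  by apply: measurable_fun_cvg vc.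
have dM x : c <= x <= d -> density x <= M.
  move=> xcd; have vx := vc x; rewrite /= in_itv/= in vx; have {}vx := vx xcd.
  rewrite -(cvg_lim _ vx)//; apply: limr_le; first by apply/cvg_ex; exists (density x).
  apply: nearW => n; apply: le_trans (ler_norm _) _; apply: vM; by rewrite /= in_itv.
split; first 1 last.
- by exists M.
- have c1 := bounded_Rintegral_cvg mcd fcd mv md vc vM.
  have c2 : (fun n => (\int[leb]_(x in `[c, d]) v n x)%R) @ \oo -->
      charged (fun t => (Num.sg (d - t) - Num.sg (c - t)) * (pi / 2)).
    rewrite (_ : (fun n => (\int[leb]_(x in `[c, d]) v n x)%R) = (fun n => charged (fun t => atan ((d - t) / eps n) - atan ((c - t) / eps n)))); last first.
      by apply/funext => n; rewrite (key n).2.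
    have mat n (y : R) : measurable_fun D (fun t : T => atan ((y - t) / eps n)).
      apply: measurable_funTS; apply: (measurableT_comp (continuous_measurable_fun (@continuous_atan R))).
      by apply: measurable_funM => //; exact: measurable_funB.
    have cat y t : (fun n => atan ((y - t) / eps n)) @ \oo --> Num.sg (y - t) * (pi / 2) by exact: cvg_atan_sg.
    have msg (y : R) : measurable_fun D (fun t : T => Num.sg (y - t) * (pi / 2)).
      apply: (measurable_fun_cvg (h := fun n (t : T) => atan ((y - t) / eps n))).
        by move=> n; exact: mat.
      by move=> t _; exact: cat.
    apply: (charged_cvg (g := fun=> pi)).
    + by move=> n; apply: measurable_funB.
    + rewrite (_ : (fun t : R => _) = (fun t : T => Num.sg (d - t) * (pi / 2) - Num.sg (c - t) * (pi / 2))).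
        exact: measurable_funB.
      by apply/funext => t; rewrite mulrBl.
    + by move=> t _; rewrite mulrBl; apply: cvgB.
    + exact: (bfun_integrable mD P1 (bfun_cst D pi)).
    + move=> n t _; apply: le_trans (ler_normB _ _) _.
      have ab (y : R) : `|atan y| <= pi / 2.
        by rewrite ler_norml; apply/andP; split; apply: ltW; [exact: atan_gtNpi2|exact: atan_ltpi2].
      have := ab ((d - t) / eps n); have := ab ((c - t) / eps n); lra.
  (* Every charge [z_j] lies on one side of [[c, d]], so its two signs agree and it drops out. *)
  rewrite -[LHS](cvg_lim _ c1)// (cvg_lim _ c2)// /charged big1 ?addr0// => j _.
  have [zc|cz] := ltP (z j) c.
    by rewrite !gtr0_sg ?subr_gt0//; [rewrite subrr mul0r mulr0|exact: lt_trans cd].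
  have dz : d < z j.
    by rewrite ltNge; apply/negP => zd; apply: (ncd j (ltn_ord j)); rewrite cz.
  by rewrite !ltr0_sg ?subr_lt0//; [rewrite subrr mul0r mulr0|exact: lt_trans dz].
apply: (integrable_bounded mcd fcd (M := M)) => // x; rewrite /= in_itv/= => xcd.
by rewrite ger0_norm ?density_ge0// dM.
Qed.

(** Primitive of the conjugate Poisson kernel, a smoothing of [ln |s|]. *)
Let rln n s : R := ln (s ^+ 2 + eps n ^+ 2) / 2.

Let rln_cvg s : s != 0 -> (fun n => rln n s) @ \oo --> ln `|s|.
Proof.
move=> s0; have s2 : 0 < s ^+ 2 by rewrite exprn_even_gt0.
have -> : ln `|s| = ln (s ^+ 2 + 0 * 0) / 2.
  by rewrite mul0r addr0 -(real_normK (num_real s)) lnXn ?normr_gt0// mulr2n; field.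
apply: cvgM; last exact: cvg_cst.
apply: continuous_cvg; first by apply: continuous_ln; rewrite mul0r addr0.
apply: cvgD; first exact: cvg_cst.
by under eq_fun do rewrite expr2; apply: cvgM; exact: cvg_harmonic.
Qed.

(** The height is at most [1], so the smoothed logarithm lies between [ln |s|] and [s ^ 2 / 2]; the
    bound does not depend on [n]. *)
Let rln_le n s : s != 0 -> `|rln n s| <= `|ln `|s| | + s ^+ 2.
Proof.
move=> s0; have s2 : 0 < s ^+ 2 by rewrite exprn_even_gt0.
have e2 : 0 < eps n ^+ 2 by rewrite exprn_gt0.
have e1 : eps n ^+ 2 <= 1 by rewrite expr_le1// ?invf_le1 ?ltr0n ?ler1n// ltW.
have lns : ln (s ^+ 2) = ln `|s| * 2 by rewrite -(real_normK (num_real s)) lnXn ?normr_gt0// mulr_natr.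
have l1 : ln (s ^+ 2) <= ln (s ^+ 2 + eps n ^+ 2) by rewrite ler_ln ?posrE ?addr_gt0// lerDl ltW.
have l2 : ln (s ^+ 2 + eps n ^+ 2) <= ln (1 + s ^+ 2).
  by rewrite ler_ln ?posrE ?addr_gt0// addrC lerD2r.
have l3 : ln (1 + s ^+ 2) <= s ^+ 2 by apply: le_ln1Dx; rewrite (lt_trans _ s2)// ltrN10.
have n1 := ler_norm (ln `|s|); have n2 := ler_norm (- ln `|s|); rewrite normrN in n2.
by rewrite /rln ler_norml; apply/andP; split; lra.
Qed.

Let mrln n (y : R) : measurable_fun D (fun t : T => rln n (y - t)).
Proof.
apply: measurable_funTS; apply: measurable_funM => //.
apply: (measurableT_comp (@measurable_ln R)); apply: measurable_funD => //.
by apply: measurable_funX; exact: measurable_funB.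
Qed.

Lemma charged_ln_cvg (c d : R) :
  P [set c] = 0%E -> P [set d] = 0%E ->
  (forall j, (j < K)%N -> c != z j) -> (forall j, (j < K)%N -> d != z j) ->
  P.-integrable D (fun t : T => (ln `|c - t|)%:E) -> P.-integrable D (fun t : T => (ln `|d - t|)%:E) ->
  (fun n => charged (fun t => ln ((d - t) ^+ 2 + eps n ^+ 2) / 2 - ln ((c - t) ^+ 2 + eps n ^+ 2) / 2)) @ \oo -->
  charged (fun t => ln `|d - t| - ln `|c - t|).
Proof.
move=> Pc Pd cz dz ic id.
have mln (y : R) : measurable_fun D (fun t : T => ln `|y - t|).
  apply: measurable_funTS; apply: (measurableT_comp (@measurable_ln R)).
  by apply: (measurableT_comp (@normr_measurable R setT)); exact: measurable_funB.
have sq (y : R) : bfun D (fun t : T => (y - t) ^+ 2).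
  rewrite (_ : (fun t : T => (y - t) ^+ 2) = (fun t : T => (y - t) * (y - t))).
    by apply: bfunM; apply: bfunB; [exact: bfun_cst|exact: bfun_id|exact: bfun_cst|exact: bfun_id].
  by apply/funext => t; rewrite expr2.
pose g (t : T) : R := `|ln `|d - t| | + (d - t) ^+ 2 + (`|ln `|c - t| | + (c - t) ^+ 2).
have ig : P.-integrable D (EFin \o g).
  have i1 (y : R) : P.-integrable D (fun t : T => (ln `|y - t|)%:E) ->
      P.-integrable D (fun t : T => (`|ln `|y - t| | + (y - t) ^+ 2)%:E).
    by move=> iy; exact: (integrableD mD (integrable_abse iy) (bfun_integrable mD P1 (sq y))).
  exact: (integrableD mD (i1 d id) (i1 c ic)).
have nN (y t : R) : ~ ([set c] `|` [set d]) t -> c - t != 0 /\ d - t != 0.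
  move=> N; split; rewrite subr_eq0; apply/eqP => e; apply: N; [left|right]; by rewrite /= e.
apply: cvgD.
  apply: (ae_dominated_Rintegral_cvg mD (N := [set c] `|` [set d]) (g := g) _ _ _ _ _ ig _).2.
  - by apply: measurableU; exact: measurable_set1.
  - apply/negligibleP; first by apply: measurableU; exact: measurable_set1.
    by apply: negligibleU; apply/negligibleP => //; exact: measurable_set1.
  - by move=> n; apply: measurable_funB; exact: mrln.
  - exact: measurable_funB.
  - by move=> t _ /(nN t)[ct dt]; apply: cvgB; exact: rln_cvg.
  - move=> n t _ /(nN t)[ct dt]; apply: le_trans (ler_normB _ _) _.
    by apply: lerD; exact: rln_le.
apply: (cvg_big add_continuous) => j _; apply: cvgM; first exact: cvg_cst.
by apply: cvgB; apply: rln_cvg; rewrite subr_eq0; [exact: dz|exact: cz].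
Qed.

(** Counterpart of [density_integral] for the real part. The limiting primitive [ln |s|] is singular
    at [0], so integrability and absence of mass at the endpoints enter as hypotheses;
    [ln_integrable] and [prob_set1] supply them later. *)
Lemma log_integral (c d : R) (U : R -> R) : c < d -> off_z c d ->
  (forall x, c <= x <= d -> (fun n => Re (cauchy_at n x)) @ \oo --> U x) ->
  P [set c] = 0%E -> P [set d] = 0%E ->
  P.-integrable D (fun t : T => (ln `|c - t|)%:E) -> P.-integrable D (fun t : T => (ln `|d - t|)%:E) ->
  leb.-integrable `[c, d] (EFin \o U) /\
  (\int[leb]_(x in `[c, d]) U x)%R = charged (fun t => ln `|d - t| - ln `|c - t|).
Proof.
move=> cd ncd Uc Pc Pd ic id.
have mcd : measurable (`[c, d]%classic : set T) by exact: measurable_itv.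
have lcd : leb `[c, d]%classic = (d - c)%:E by rewrite /= lebesgue_measure_itv/= lte_fin cd EFinB.
have fcd : (leb `[c, d]%classic < +oo)%E by rewrite lcd ltry.
have [M hM] := cauchy_at_le (ltW cd) ncd.
pose v n (x : T) := charged (fun t => conj_poisson (eps n) (x - t)).
have vE n x : v n x = Re (cauchy_at n x) by rewrite Re_cauchy_at.
have key n := charged_integral cd (fun x => is_derive_conj_poisson x (eps_gt0 n)) (continuous_conj_poisson (eps_gt0 n)) (fun x => conj_poisson_le x (eps_gt0 n)).
have mv n : measurable_fun (`[c, d]%classic : set T) (v n) by exact: (key n).1.
have vM n (x : T) : `[c, d]%classic x -> `|v n x| <= M.
  by rewrite /= in_itv/= => xcd; rewrite vE; exact: (hM n x xcd).1.
have vc (x : T) : `[c, d]%classic x -> v ^~ x @ \oo --> U x.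
  by rewrite /= in_itv/= => xcd; under eq_fun do rewrite vE; exact: Uc.
have mU : measurable_fun (`[c, d]%classic : set T) U by apply: measurable_fun_cvg vc.
have UM x : c <= x <= d -> `|U x| <= M.
  move=> xcd; have vx : v ^~ x @ \oo --> U x by apply: vc; rewrite /= in_itv.
  have vx' : (fun n => `|v n x|) @ \oo --> `|U x| by exact: cvg_norm.
  rewrite -(cvg_lim _ vx')//; apply: limr_le; first by apply/cvg_ex; exists `|U x|.
  by apply: nearW => n; apply: vM; rewrite /= in_itv.
split.
  by apply: (integrable_bounded mcd fcd (M := M)) => // x; rewrite /= in_itv/= => xcd; exact: UM.
have c1 := bounded_Rintegral_cvg mcd fcd mv mU vc vM.
have c2 : (fun n => (\int[leb]_(x in `[c, d]) v n x)%R) @ \oo -->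
    charged (fun t => ln `|d - t| - ln `|c - t|).
  rewrite (_ : (fun n => (\int[leb]_(x in `[c, d]) v n x)%R) = (fun n => charged (fun t =>
      ln ((d - t) ^+ 2 + eps n ^+ 2) / 2 - ln ((c - t) ^+ 2 + eps n ^+ 2) / 2))); last first.
    by apply/funext => n; rewrite (key n).2.
  have lo : c <= c <= d by rewrite lexx ltW.
  have hi : c <= d <= d by rewrite lexx andbT ltW.
  apply: charged_ln_cvg => // j jK; [exact: (off_z_neq ncd lo)|exact: (off_z_neq ncd hi)].
by rewrite -[LHS](cvg_lim _ c1)// (cvg_lim _ c2).
Qed.

End InversionFormulas.

(** * Absence of atoms and of mass near the zeros of the weight *)

Section Atoms.
Context (R : realType) (K : nat) (A : R) (z pw : nat -> R).
Hypotheses (hK : (2 <= K)%N) (hA : 0 < A).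
Hypothesis hp : forall i : nat, (i < K)%N -> 0 < pw i.
Hypothesis hz : forall i : nat, (i.+1 < K)%N -> z i < z i.+1.
Local Notation w := (weightw K A z pw).
Local Notation T := (measurableTypeR R).
Local Notation D := (`[z 0%N, z K.-1]%classic : set T).
Local Notation leb := (lebesgue_measure : {measure set T -> \bar R}).
Variable P : probability T R.
Hypothesis PD : P (~` D) = 0%E.
Hypothesis Pmin : forall nu : {measure set T -> \bar R},
  unit_measure_on (z 0%N) (z K.-1) nu -> (wenergy w P <= wenergy w nu)%E.
Hypothesis Pfin : (wenergy w P < +oo)%E.
Local Notation Pi := (loop_poly K z pw (moment K z P)).
Local Notation Az := (zpoly K z).
Local Notation Bz := (bpoly K z pw).
Local Notation disc := (disc K z pw P).
Local Notation density := (density K z pw P).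
Local Notation off_z := (off_z K z).
Local Notation eps n := (n.+1%:R^-1 : R).

Let mD : measurable D.
Proof. exact: measurable_itv. Qed.
Let P1 : P D = 1%E.
Proof. exact: prob_carrier1. Qed.
Let eps_gt0 n : 0 < eps n.
Proof. by rewrite invr_gt0. Qed.

Lemma integrable_log_kernel :
  (P \x P)%E.-integrable (D `*` D) (fun y : T * T => log_kernel w y.1 y.2).
Proof.
have mDD : measurable (D `*` D) by exact: measurableX.
have mkern := measurable_log_kernel K A z pw.
have [c c0 kc] := log_kernel_lbound hK hA hp hz.
have ic : (P \x P)%E.-integrable (D `*` D) (EFin \o (fun _ : T * T => c)).
  by apply: (bfun_integrable mDD (prodD1 mD P1)); exact: bfun_cst.
have i1 : (P \x P)%E.-integrable (D `*` D) (fun y : T * T => (log_kernel w y.1 y.2 + c%:E)%E).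
  apply/integrableP; split.
    by apply: measurable_funTS; apply: emeasurable_funD => //; exact: measurable_cst.
  have <- : (wenergy w P + c%:E = \int[(P \x P)]_(y in D `*` D) `|log_kernel w y.1 y.2 + c%:E|)%E.
    rewrite /wenergy (energy_shift mD PD mkern c0 kc); apply: eq_integral => -[x t].
    by rewrite inE => -[Dx Dt]; rewrite gee0_abs//; exact: kc.
  by rewrite lte_add_pinfty// ltry.
have := integrableB mDD i1 ic; apply: eq_integrable => //.
by move=> y _ /=; rewrite addeK.
Qed.

(** The kernel is [+oo] on [{z_j} * D], so finite energy makes this set null. *)
Lemma prob_z j : (j < K)%N -> P [set z j] = 0%E.
Proof.
move=> jK; have mDD : measurable (D `*` D) by exact: measurableX.
have [N [mN N0 hN]] := integrable_ae mDD integrable_log_kernel.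
have Dz : D (z j) := z_in hK hA hz jK.
have sub : [set z j] `*` D `<=` N.
  move=> [x t] [/= -> Dt]; apply: hN => /= /(_ (conj Dz Dt)).
  by rewrite /log_kernel (weightw_z A z hp jK) eqxx orbT.
have : (P \x P)%E ([set z j] `*` D) = 0%E.
  apply/eqP; rewrite -measure_le0 -[leRHS]N0; apply: le_measure; rewrite ?inE//.
  by apply: measurableX => //; exact: measurable_set1.
by rewrite product_measure1E// [X in (_ * X)%E]P1 mule1.
Qed.

Lemma Ex_indic (B : set T) : measurable B -> (Ex P D (\1_B : T -> R))%:E = P B.
Proof.
move=> mB; rewrite -(ExE mD P1); last first.
  split; first exact: measurable_indic.
  by exists 1 => x _; rewrite indicE ger0_norm// lern1 leq_b1.
rewrite integral_indic//; apply/eqP; rewrite eq_le; apply/andP; split.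
  by apply: le_measure; rewrite ?inE//; exact: measurableI.
have e : P B = P (B `&` D `|` (B `\` D)) by rewrite setUIDK.
rewrite [leLHS]e (le_trans (measureU2 _ _ _))//; [exact: measurableI|exact: measurableD|].
rewrite -[leRHS]adde0 leeD2l// -PD; apply: le_measure; rewrite ?inE//.
- exact: measurableD.
- exact: measurableC.
Qed.

Let bindic (B : set T) : measurable B -> bfun D (\1_B : T -> R).
Proof.
move=> mB; split; first exact: measurable_indic.
by exists 1 => x _; rewrite indicE ger0_norm// lern1 leq_b1.
Qed.

Let sg_indic (c d t : R) : c < d ->
  (Num.sg (d - t) - Num.sg (c - t)) * (pi / 2) =
  pi * (\1_(`]c, d[%classic : set T) t) + pi / 2 * (\1_([set c] : set T) t + \1_([set d] : set T) t).
Proof.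
move=> cd; rewrite !indicE.
have m1 : (t \in (`]c, d[%classic : set T)) = (c < t < d).
  by apply/idP/idP; rewrite inE /= in_itv.
have m2 r : (t \in ([set r] : set T)) = (t == r).
  by apply/idP/idP; rewrite inE /= => /eqP.
have sp a b : b < a -> Num.sg (a - b) = 1 :> R by move=> h; rewrite gtr0_sg// subr_gt0.
have sn a b : a < b -> Num.sg (a - b) = - 1 :> R by move=> h; rewrite ltr0_sg// subr_lt0.
rewrite m1 !m2; have [ct|tc|ct] := ltrgtP c t.
- have [td|dt|td] := ltrgtP t d => /=.
  + by rewrite sp// sn//; field.
  + by rewrite !sn//; field.
  + by rewrite td subrr sgr0 sn -?td//; field.
- have td := lt_trans tc cd.
  by rewrite (lt_eqF td) !sp//=; field.
- by rewrite -ct subrr sgr0 (lt_eqF cd) sp//=; field.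
Qed.

Lemma density_prob (c d : R) : c < d -> off_z c d ->
  ((\int[leb]_(x in `[c, d]) density x)%R)%:E =
  (pi%:E * P `]c, d[%classic + (pi / 2)%:E * (P [set c] + P [set d]))%E.
Proof.
move=> cd ncd; have [_ _ ->] := density_integral hK hA hp hz PD Pmin Pfin cd ncd.
have b0 : bfun D (\1_(`]c, d[%classic : set T) : T -> R) by apply: bindic; exact: measurable_itv.
have b1 r : bfun D (\1_([set r] : set T) : T -> R) by apply: bindic; exact: measurable_set1.
under eq_Ex do rewrite sg_indic//.
rewrite (ExD mD P1 (bfunZ _ b0) (bfunZ _ (bfunD (b1 _) (b1 _)))).
rewrite (ExZ mD P1 _ b0) (ExZ mD P1 _ (bfunD (b1 _) (b1 _))) (ExD mD P1 (b1 _) (b1 _)).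
have mI : measurable (`]c, d[%classic : set T) by exact: measurable_itv.
have arith (r s x1 x2 x3 : R) (y1 y2 y3 : \bar R) : x1%:E = y1 -> x2%:E = y2 -> x3%:E = y3 ->
  (r * x1 + s * (x2 + x3))%:E = (r%:E * y1 + s%:E * (y2 + y3))%E by move=> <- <- <-.
by apply: arith; apply: Ex_indic => //; exact: measurable_set1.
Qed.

Lemma off_z_ball x : exists2 h, 0 < h & forall j, (j < K)%N -> x != z j -> h < `|x - z j|.
Proof.
elim: K => [|n [h h0 hh]]; first by exists 1.
have [e|xn] := eqVneq x (z n).
  by exists h => // j; rewrite ltnS leq_eqVlt => /predU1P[->|jn]; [rewrite e eqxx|exact: hh].
exists (Num.min h (`|x - z n| / 2)) => [|j].
  by rewrite lt_min h0 divr_gt0// normr_gt0 subr_eq0.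
rewrite ltnS leq_eqVlt => /predU1P[->|jn] xj.
  by rewrite gt_min; apply/orP; right; rewrite ltr_pdivrMr// ltr_pMr ?normr_gt0 ?subr_eq0// ltr1n.
by rewrite gt_min hh.
Qed.

(** Away from the [z_j], [pi / 2] times the mass at [x] is at most the integral of the locally
    bounded [density] over [[x - s, x]], hence at most [M s] for all small [s]. *)
Lemma prob_set1 x : P [set x] = 0%E.
Proof.
have [[j jK xj]|nz] := pselect (exists2 j, (j < K)%N & x = z j); first by rewrite xj prob_z.
have xz j : (j < K)%N -> x != z j by move=> jK; apply/eqP => e; apply: nz; exists j.
have [h h0 hh] := off_z_ball x.
have ncd (c : R) : x - h <= c -> off_z c x.
  move=> hc j jK /andP[cz zx]; have := hh j jK (xz j jK).
  by rewrite ltNge ger0_norm ?subr_ge0//; apply/negP; rewrite negbK; lra.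
have hx : x - h < x by rewrite gtrBl.
have [_ [M hM] _] := density_integral hK hA hp hz PD Pmin Pfin hx (ncd _ (lexx _)).
pose p := fine (P [set x]).
have pE : P [set x] = p%:E by rewrite fineK// fin_num_measure//; exact: measurable_set1.
have p0 : 0 <= p by rewrite fine_ge0.
have M0 : 0 <= M by apply: le_trans (hM x _); rewrite ?density_ge0// lexx andbT ltW.
have key s : 0 < s <= h -> pi / 2 * p <= M * s.
  move=> /andP[s0 sh]; have cx : x - s < x by rewrite gtrBl.
  have nc : off_z (x - s) x by apply: ncd; lra.
  have mcd : measurable (`[x - s, x]%classic : set T) by exact: measurable_itv.
  have lcd : leb `[x - s, x]%classic = s%:E.
    by rewrite /= lebesgue_measure_itv/= lte_fin cx -EFinB; congr EFin; ring.
  have := density_prob cx nc => e.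
  have le1 : ((\int[leb]_(x in `[(x - s)%R, x]) density x)%R <= M * s).
    have -> : M * s = (\int[leb]_(x in `[(x - s)%R, x]) (fun=> M) x)%R.
      by rewrite Rintegral_cst// lcd.
    have [i1 _ _] := density_integral hK hA hp hz PD Pmin Pfin cx nc.
    apply: le_Rintegral => //.
      by apply: (integrable_bounded mcd) => //=; rewrite ?lcd ?ltry.
    by move=> y; rewrite /= in_itv/= => /andP[y1 y2]; apply: hM; apply/andP; split; lra.
  rewrite -lee_fin; have {}le1 : (((\int[leb]_(x in `[(x - s)%R, x]) density x)%R)%:E <= (M * s)%:E)%E by rewrite lee_fin.
  refine (le_trans _ le1).
  rewrite e EFinM -pE; apply: (@le_trans _ _ ((pi / 2)%:E * (P [set (x - s)%R] + P [set x]))%E).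
    by apply: lee_wpmul2l => //; rewrite ?lee_fin ?divr_ge0 ?pi_ge0//; rewrite leeDr.
  by rewrite leeDr// mule_ge0// lee_fin pi_ge0.
rewrite pE; congr EFin; apply/eqP; rewrite eq_le p0 andbT leNgt; apply/negP => pp.
have pi0 := @pi_gt0 R.
have q0 : 0 < pi / 2 * p by rewrite mulr_gt0// divr_gt0.
(* Small enough for [M s] to fall below [pi / 2 * p]. *)
pose s := Num.min h (pi / 2 * p / (M + 1) / 2).
have s0 : 0 < s by rewrite lt_min h0 !divr_gt0// ltr_wpDl.
have sh : s <= h by rewrite ge_min lexx.
have s2 : s <= pi / 2 * p / (M + 1) / 2 by rewrite ge_min lexx orbT.
have k := key s; rewrite s0 sh in k; have {}k := k isT.
have M1 : 0 < M + 1 by lra.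
have : s * (M + 1) * 2 <= pi / 2 * p.
  by rewrite -ler_pdivlMr// -ler_pdivlMr// mulrAC.
move: k q0 s0; set q := pi / 2 * p; nra.
Qed.

Lemma density_itv (c d : R) : c < d -> off_z c d ->
  P `]c, d]%classic = ((\int[leb]_(x in `[c, d]) density x)%R / pi)%:E.
Proof.
move=> cd ncd; have pi0 := @pi_gt0 R.
have := density_prob cd ncd; rewrite !prob_set1 adde0 mule0 adde0 => e.
rewrite mulrC EFinM e muleA -EFinM mulVf ?gt_eqF// mul1e.
have -> : `]c, d]%classic = `]c, d[%classic `|` [set d] :> set T.
  apply/seteqP; split => x /=; rewrite !in_itv/=.
    by rewrite [x <= d]le_eqVlt => /andP[cx /predU1P[->|xd]]; [right|left; rewrite cx].
  by case => [/andP[-> /ltW]//|->]; rewrite cd lexx.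
apply/eqP; rewrite eq_le; apply/andP; split; last first.
  have mU : measurable (`]c, d[%classic `|` [set d] : set T).
    by apply: measurableU; [exact: measurable_itv|exact: measurable_set1].
  by apply: le_measure; rewrite ?inE//; move=> x; left.
apply: (le_trans (measureU2 _ _ _)); [exact: measurable_itv|exact: measurable_set1|].
by rewrite [X in (_ + X)%E]prob_set1 adde0.
Qed.

Lemma disc_gt0 x : (forall j, (j < K)%N -> x != z j) -> (0 <= disc x) = (0 <= Pi.[x]).
Proof.
move=> xz; have A0 := zpoly_neq0 xz.
by rewrite pmulr_lge0// invr_gt0 exprn_even_gt0.
Qed.

(** [density] vanishes where [Pi >= 0]. The endpoints may be zeros of the weight, where the
    inversion formula does not apply, so the interval is exhausted from inside. *)
Lemma prob_itv0 (c d : R) : (forall j, (j < K)%N -> ~ (c < z j < d)) ->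
  (forall x, c < x < d -> 0 <= Pi.[x]) -> P `]c, d[%classic = 0%E.
Proof.
move=> ncd Pi0.
have mcd : measurable (`]c, d[%classic : set T) by exact: measurable_itv.
apply: (measure_negligible mcd).
apply: (@negligibleS _ T _ P (\bigcup_n `](c + eps n)%R, (d - eps n)%R]%classic : set T)).
  move=> x; rewrite /= in_itv/= => /andP[cx xd].
  have m0 : 0 < Num.min (x - c) (d - x) by rewrite lt_min !subr_gt0 cx.
  have [n _ /(_ n (leqnn _))] : \forall n \near \oo, eps n < Num.min (x - c) (d - x) by exact: near_infty_natSinv_lt (PosNum m0).
  rewrite /= lt_min => /andP[n1 n2]; exists n => //=; rewrite in_itv/=; apply/andP; split.
    by rewrite -ltrBrDl.
  by rewrite lerBrDr -lerBrDl ltW.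
apply: negligible_bigcup => n; apply/negligibleP; first exact: measurable_itv.
move: (eps n) (eps_gt0 n) => e e0; have [lt1|] := ltP (c + e) (d - e); last first.
  by move=> ge1; rewrite set_itv_ge// bnd_simp -leNgt.
have nc : off_z (c + e) (d - e).
  by move=> j jK /andP[h1 h2]; apply: (ncd j jK); apply/andP; split; lra.
apply: (etrans (density_itv lt1 nc)); congr EFin; rewrite (_ : (\int[leb]_(x in _) _)%R = 0) ?mul0r//.
transitivity (\int[leb]_(x in `[(c + e)%R, (d - e)%R]) (fun=> 0 : R) x)%R.
  apply: eq_Rintegral => x; rewrite inE /= in_itv/= => /andP[x1 x2].
  have xz j : (j < K)%N -> x != z j.
    by move=> jK; apply/eqP => xe; apply: (nc j jK); rewrite -xe x1.
  have : 0 <= disc x by rewrite disc_gt0// Pi0//; apply/andP; split; lra.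
  by rewrite /density => h; rewrite max_r ?sqrtr0// oppr_le0.
by rewrite Rintegral_cst ?mul0r//; exact: measurable_itv.
Qed.

Lemma horner_loop_poly_z j : (j < K)%N -> Pi.[z j] = Bz.[z j] ^+ 2.
Proof. move=> jK; have Az0 : Az.[z j] = 0 by rewrite (zpolyE z jK) hornerM hornerXsubC subrr mul0r.
by rewrite /loop_poly hornerD [(Az * _).[_]]hornerM Az0 mul0r addr0 expr2 hornerM -expr2. Qed.

Lemma horner_bpoly_z j : (j < K)%N -> Bz.[z j] = pw j * \prod_(m < K | nat_of_ord m != j) (z j - z m).
Proof.
move=> jK; rewrite /bpoly horner_sum (bigD1 (Ordinal jK))//= hornerZ horner_zpolyj [X in _ + X]big1 ?addr0// => i ij.
rewrite hornerZ horner_zpolyj (bigD1 (Ordinal jK))/= ?subrr ?mul0r ?mulr0//.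
by rewrite eq_sym.
Qed.

Lemma bpoly_z_neq0 j : (j < K)%N -> Bz.[z j] != 0.
Proof.
move=> jK; rewrite horner_bpoly_z//; apply: mulf_neq0; first by rewrite gt_eqF ?hp.
apply/prodf_neq0 => m mj; rewrite subr_eq0; apply/eqP => /(z_inj hz) e.
by move: mj; rewrite -e ?eqxx.
Qed.

Lemma loop_poly_z_gt0 j : (j < K)%N -> 0 < Pi.[z j].
Proof. by move=> jK; rewrite horner_loop_poly_z// exprn_even_gt0//= bpoly_z_neq0. Qed.

(** [Pi (z_j)] is the square of the nonzero number [bpoly (z_j)], so [Pi] is positive nearby and
    there is no mass there. *)
Lemma prob_ball_z j : (j < K)%N -> exists2 h, 0 < h &
  (forall x, z j - h < x < z j + h -> 0 < Pi.[x]) /\ P `]z j - h, z j + h[%classic = 0%E.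
Proof.
move=> jK; have [h1 h10 hh1] := off_z_ball (z j).
have c0 : {for z j, continuous (horner Pi)} by exact: continuous_horner.
have : \forall x \near z j, 0 < Pi.[x] by apply: (cvgr_gt _ c0); exact: loop_poly_z_gt0.
move=> /nbhs_ballP[h2 /= h20 hh2].
pose h := Num.min h1 h2; have h0 : 0 < h by rewrite lt_min h10.
have hl1 : h <= h1 by rewrite ge_min lexx.
have hl2 : h <= h2 by rewrite ge_min lexx orbT.
have pos x : z j - h < x < z j + h -> 0 < Pi.[x].
  move=> /andP[x1 x2]; apply: hh2; rewrite /ball/= ltr_norml; apply/andP; split; lra.
exists h => //; split=> //.
have nz i : (i < K)%N -> z j - h < z i < z j + h -> i = j.
  move=> iK /andP[x1 x2]; apply/eqP; apply/negP => ij.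
  have zz : z j != z i by apply/eqP => /(z_inj hz jK iK) e; apply: ij; rewrite e.
  have := hh1 i iK zz; rewrite ltNge => /negP; apply.
  by apply: le_trans hl1; rewrite ler_norml; apply/andP; split; lra.
have p1 : P `]z j - h, z j[%classic = 0%E.
  apply: prob_itv0 => [i iK /andP[x1 x2]|x /andP[x1 x2]].
    have := nz i iK; rewrite x1 (lt_trans x2) ?ltrDl// => /(_ isT) e.
    by move: x2; rewrite e ltxx.
  by apply: ltW; apply: pos; rewrite x1 (lt_trans x2)// ltrDl.
have p2 : P `]z j, z j + h[%classic = 0%E.
  apply: prob_itv0 => [i iK /andP[x1 x2]|x /andP[x1 x2]].
    have := nz i iK; rewrite x2 andbT (lt_trans _ x1) ?gtrBl// => /(_ isT) e.
    by move: x1; rewrite e ltxx.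
  by apply: ltW; apply: pos; rewrite x2 andbT (lt_trans _ x1)// gtrBl.
apply: measure_negligible; first exact: measurable_itv.
apply: (@negligibleS _ T _ P ((`]z j - h, z j[%classic `|` [set z j]) `|` `]z j, z j + h[%classic : set T)).
  move=> x; rewrite /= !in_itv/= => /andP[x1 x2].
  by have [xz|xz|xz] := ltrgtP x (z j); [left; left; rewrite x1|right; rewrite x2|left; right].
have n1 : P.-negligible (`]z j - h, z j[%classic : set T) by apply/negligibleP => //; exact: measurable_itv.
have n2 : P.-negligible (`]z j, z j + h[%classic : set T) by apply/negligibleP => //; exact: measurable_itv.
have n3 : P.-negligible ([set z j] : set T) by apply/negligibleP; [exact: measurable_set1|exact: prob_z].
exact: negligibleU (negligibleU n1 n3) n2.
Qed.

End Atoms.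

(** * Roots of the loop polynomial *)

Section Signs.
Context (R : realType).

Lemma prod_sign (I : Type) (s : seq I) (Q : pred I) (b : I -> bool) (f : I -> R) :
  (forall i, Q i -> if b i then f i < 0 else 0 < f i) ->
  0 < (-1) ^+ (\sum_(i <- s | Q i) b i) * \prod_(i <- s | Q i) f i.
Proof.
move=> h; apply: (big_ind2 (fun (n : nat) x => 0 < (-1) ^+ n * x :> R)).
- by rewrite expr0 mul1r.
- by move=> n1 x1 n2 x2 h1 h2; rewrite exprD mulrACA mulr_gt0.
- by move=> i /h; case: (b i); rewrite ?expr1 ?expr0 ?mulN1r ?mul1r ?oppr_gt0.
Qed.

Lemma sum_ltn_ord n j : (\sum_(m < n) (j < m) = n - j.+1)%N.
Proof. by elim: n => [|n ih]; rewrite ?big_ord0// big_ord_recr/= ih; case: ltnP; lia. Qed.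

End Signs.

(** * The square root of the loop polynomial on intervals without mass *)

Section OffSupport.
Context (R : realType) (K : nat) (A : R) (z pw : nat -> R).
Hypotheses (hK : (2 <= K)%N) (hA : 0 < A).
Hypothesis hp : forall i : nat, (i < K)%N -> 0 < pw i.
Hypothesis hz : forall i : nat, (i.+1 < K)%N -> z i < z i.+1.
Local Notation w := (weightw K A z pw).
Local Notation T := (measurableTypeR R).
Local Notation D := (`[z 0%N, z K.-1]%classic : set T).
Variable P : probability T R.
Hypothesis PD : P (~` D) = 0%E.
Hypothesis Pmin : forall nu : {measure set T -> \bar R},
  unit_measure_on (z 0%N) (z K.-1) nu -> (wenergy w P <= wenergy w nu)%E.
Hypothesis Pfin : (wenergy w P < +oo)%E.
Local Notation Pi := (loop_poly K z pw (moment K z P)).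
Local Notation Az := (zpoly K z).
Local Notation Bz := (bpoly K z pw).
Local Notation charged := (charged K z pw P).
Local Notation cauchy_at := (cauchy_at K z pw P).
Local Notation disc := (disc K z pw P).
Local Notation eps n := (n.+1%:R^-1 : R).

Let mD : measurable D.
Proof. exact: measurable_itv. Qed.
Let P1 : P D = 1%E.
Proof. exact: prob_carrier1. Qed.

(** Among the factors [z_j - z_m], the negative ones are the [K - 1 - j] with [m > j]. *)
Lemma bpoly_z_sign j : (j < K)%N -> 0 < (-1) ^+ (K.-1 - j) * Bz.[z j].
Proof.
move=> jK; rewrite (horner_bpoly_z z pw jK) mulrCA mulr_gt0 ?hp//.
have -> : (K.-1 - j = \sum_(m < K | nat_of_ord m != j) (j < m))%N.
  have := sum_ltn_ord K j; rewrite (bigID (fun m : 'I_K => nat_of_ord m != j))/=.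
  rewrite [X in (_ + X)%N]big1; first by lia.
  by move=> m /negPn/eqP ->; rewrite ltnn.
apply: prod_sign => m mj; have mK := ltn_ord m.
case: ltnP => [jm|]; first by rewrite subr_lt0 (z_lt hz)// jm.
rewrite leq_eqVlt (negbTE mj)/= => mj'; by rewrite subr_gt0 (z_lt hz)// mj'.
Qed.

Section NullInterval.
Variables c d : R.
Hypotheses (cd : c < d) (Pcd : P `]c, d[%classic = 0%E).

(** Cut to [0] on []c, d[], which [P] does not charge: the integral against [P] is that of
    [1 / (x - t)], with an integrand bounded for each [x] of the interval. *)
Definition gap_resolvent x (t : T) : R := if c < (t : R) < d then 0 else (x - t)^-1.
(** [A G] on the interval. The factor [A] removes the poles of the charges, so the function passes
    continuously through the [z_j]. *)
Definition gap_sum x := Az.[x] * Ex P D (gap_resolvent x) + Bz.[x].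

Let m x := Num.min (x - c) (d - x).

Let m_gt0 x : c < x < d -> 0 < m x.
Proof. by move=> /andP[cx xd]; rewrite lt_min !subr_gt0 cx. Qed.

Let far x t : ~~ (c < t < d) -> m x <= `|x - t|.
Proof.
rewrite negb_and -!leNgt => /orP[tc|dt]; rewrite ge_min.
  by apply/orP; left; apply: le_trans (ler_norm _); rewrite lerD2l lerN2.
by apply/orP; right; rewrite distrC; apply: le_trans (ler_norm _); rewrite lerD2r.
Qed.

Let far_neq0 x t : c < x < d -> ~~ (c < t < d) -> x - t != 0.
Proof. by move=> /m_gt0 m0 /(@far x) h; rewrite -normr_gt0 (lt_le_trans m0). Qed.

Let gap_le x t : c < x < d -> `|gap_resolvent x t| <= (m x)^-1.
Proof.
move=> xcd; have m0 := m_gt0 xcd; rewrite /gap_resolvent; case: ifPn => h.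
  by rewrite normr0 invr_ge0 ltW.
have x0 := far_neq0 xcd h; rewrite normfV lef_pV2 ?posrE ?normr_gt0//.
exact: far.
Qed.

Let cvg_eps2 (s : R) : (fun n => s ^+ 2 + eps n ^+ 2) @ \oo --> s ^+ 2.
Proof.
rewrite -[X in _ --> X]addr0; apply: cvgD; first exact: cvg_cst.
by rewrite -(mulr0 (0 : R)); under eq_fun do rewrite expr2; apply: cvgM; exact: cvg_harmonic.
Qed.

Let cvg_conj (s : R) : s != 0 -> (fun n => conj_poisson (eps n) s) @ \oo --> s^-1.
Proof.
move=> s0; have -> : s^-1 = s * (s ^+ 2)^-1 by field.
apply: cvgM; first exact: cvg_cst.
by apply: cvgV; [rewrite expf_neq0|exact: cvg_eps2].
Qed.

Let cvg_pois (s : R) : s != 0 -> (fun n => poisson (eps n) s) @ \oo --> (0 : R).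
Proof.
move=> s0; have -> : 0 = 0 * (s ^+ 2)^-1 :> R by rewrite mul0r.
apply: cvgM; first exact: cvg_harmonic.
by apply: cvgV; [rewrite expf_neq0|exact: cvg_eps2].
Qed.

Let conj_le e (s : R) : 0 < e -> s != 0 -> `|conj_poisson e s| <= `|s|^-1.
Proof.
move=> e0 s0; have s2 : 0 < s ^+ 2 by rewrite exprn_even_gt0.
have n0 : 0 < `|s| by rewrite normr_gt0.
have d0 : 0 < s ^+ 2 + e ^+ 2 by rewrite addr_gt0// exprn_gt0.
rewrite normrM normfV (gtr0_norm d0) ler_pdivrMr// ler_pdivlMl//.
by rewrite -expr2 (real_normK (num_real s)) lerDl sqr_ge0.
Qed.

Let pois_le e (s : R) : 0 < e -> s != 0 -> `|poisson e s| <= `|s|^-1.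
Proof.
move=> e0 s0; have s2 : 0 < s ^+ 2 by rewrite exprn_even_gt0.
have n0 : 0 < `|s| by rewrite normr_gt0.
have d0 : 0 < s ^+ 2 + e ^+ 2 by rewrite addr_gt0// exprn_gt0.
rewrite normrM normfV (gtr0_norm d0) (gtr0_norm e0) ler_pdivrMr// ler_pdivlMl//.
rewrite -(real_normK (num_real s)); have := sqr_ge0 (`|s| - e); nra.
Qed.

Let mitv : measurable (`]c, d[%classic : set T).
Proof. exact: measurable_itv. Qed.

Let mconj e x : 0 < e -> measurable_fun setT (fun t : T => conj_poisson e (x - t)).
Proof.
move=> e0; apply: (measurableT_comp (continuous_measurable_fun (continuous_conj_poisson e0))).
exact: measurable_funB.
Qed.

Let mpois e x : 0 < e -> measurable_fun setT (fun t : T => poisson e (x - t)).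
Proof.
move=> e0; apply: (measurableT_comp (continuous_measurable_fun (continuous_poisson e0))).
exact: measurable_funB.
Qed.

Let nN (t : R) : (t \in (`]c, d[%classic : set T)) = (c < t < d).
Proof. by apply/idP/idP; rewrite inE /= in_itv. Qed.

Let mgap x : c < x < d -> measurable_fun setT (gap_resolvent x).
Proof.
move=> xcd; apply: (measurable_fun_cvg (h := fun n (t : T) => conj_poisson (eps n) (x - t) * \1_(~` (`]c, d[%classic : set T)) t)).
  move=> n; apply: measurable_funM; first exact: mconj.
  by apply: measurable_indic; exact: measurableC.
move=> t _; rewrite /gap_resolvent; under eq_fun do rewrite indicC/= nN.
case: ifPn => h /=; first by under eq_fun do rewrite mulr0; exact: cvg_cst.
by under eq_fun do rewrite mulr1; apply: cvg_conj; exact: far_neq0.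
Qed.

Lemma bfun_gap x : c < x < d -> bfun D (gap_resolvent x).
Proof. by move=> xcd; split; [exact: mgap|exists (m x)^-1 => t _; exact: gap_le]. Qed.

Lemma gap_limit x : c < x < d -> (forall j, (j < K)%N -> x != z j) ->
  (fun n => Re (cauchy_at n x)) @ \oo --> gap_sum x / Az.[x] /\
  (fun n => - Im (cauchy_at n x)) @ \oo --> (0 : R).
Proof.
move=> xcd xz; have m0 := m_gt0 xcd.
have A0 : Az.[x] != 0 by exact: zpoly_neq0.
have ig : P.-integrable D (EFin \o (fun=> (m x)^-1 : R)).
  exact: (bfun_integrable mD P1 (bfun_cst D _)).
have far' t : D t -> ~ (`]c, d[%classic : set T) t -> ~~ (c < t < d).
  by move=> _; rewrite /= in_itv/= => /negP.
have fle s : m x <= `|x - s| -> x - s != 0 -> `|x - s|^-1 <= (m x)^-1.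
  by move=> h h0; rewrite lef_pV2 ?posrE ?normr_gt0.
have sz : \sum_(j < K) pw j * (x - z j)^-1 = Bz.[x] / Az.[x].
  rewrite /bpoly horner_sum mulr_suml; apply: eq_bigr => j _.
  have xj : x - z j != 0 by rewrite subr_eq0 xz.
  move: A0; rewrite hornerZ (zpolyE z (ltn_ord j)) hornerM hornerXsubC => A0.
  have q0 : (zpolyj K z j).[x] != 0 by move: A0; rewrite mulf_eq0 negb_or => /andP[].
  by field; rewrite q0 xj.
split.
  have -> : gap_sum x / Az.[x] = Ex P D (gap_resolvent x) + \sum_(j < K) pw j * (x - z j)^-1.
    by rewrite sz /gap_sum; field.
  under eq_fun do rewrite Re_cauchy_at; apply: cvgD.
    apply: (ae_dominated_Rintegral_cvg mD mitv Pcd _ _ _ ig _).2.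
    - by move=> n; apply: measurable_funTS; exact: mconj.
    - by apply: measurable_funTS; exact: mgap.
    - move=> t Dt /(far' t Dt) h; rewrite /gap_resolvent (negbTE h); apply: cvg_conj; exact: far_neq0.
    - move=> n t Dt /(far' t Dt) h; apply: le_trans (fle t _ _); [|exact: far|exact: far_neq0].
      by apply: conj_le => //; exact: far_neq0.
  apply: (cvg_big add_continuous) => j _; apply: cvgM; first exact: cvg_cst.
  by apply: cvg_conj; rewrite subr_eq0 xz.
have -> : 0 = Ex P D (fun=> 0 : R) + \sum_(j < K) pw j * 0.
  by rewrite (Ex_cst mD P1) big1 ?addr0// => j _; rewrite mulr0.
rewrite (_ : (fun n => - Im _) = (fun n => charged (fun t => poisson (eps n) (x - t)))); last first.
  by apply/funext => n; exact: Im_cauchy_at.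
apply: cvgD.
  apply: (ae_dominated_Rintegral_cvg mD mitv Pcd _ _ _ ig _).2.
  - by move=> n; apply: measurable_funTS; exact: mpois.
  - exact: measurable_cst.
  - move=> t Dt /(far' t Dt) h; apply: cvg_pois; exact: far_neq0.
  - move=> n t Dt /(far' t Dt) h; apply: le_trans (fle t _ _); [|exact: far|exact: far_neq0].
    by apply: pois_le => //; exact: far_neq0.
apply: (cvg_big add_continuous) => j _; apply: cvgM; first exact: cvg_cst.
by apply: cvg_pois; rewrite subr_eq0 xz.
Qed.

Lemma gap_sum_z j : (j < K)%N -> gap_sum (z j) = Bz.[z j].
Proof. by move=> jK; rewrite /gap_sum (zpolyE z jK) hornerM hornerXsubC subrr !mul0r add0r. Qed.

(** Without mass nearby [Im G] tends to [0], so [disc x] is nonnegative and equals the limit of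
    [Re (G) ^ 2]. At a [z_j] both sides are the square of [bpoly]. *)
Lemma gap_sum_sqr x : c < x < d -> gap_sum x ^+ 2 = Pi.[x].
Proof.
move=> xcd; have [[j jK ->]|nz] := pselect (exists2 j, (j < K)%N & x = z j).
  by rewrite gap_sum_z// horner_loop_poly_z.
have xz j : (j < K)%N -> x != z j by move=> jK; apply/eqP => e; apply: nz; exists j.
have A0 : Az.[x] != 0 by exact: zpoly_neq0.
have [h1 h2] := gap_limit xcd xz.
have [k1 k2] := cauchy_at_cvg hK hA hp hz PD Pmin Pfin xz.
have S0 : 0 <= disc x.
  have : Num.sqrt (Num.max (- disc x) 0) = 0.
    by rewrite -(cvg_lim _ k1)// (cvg_lim _ h2).
  by move=> /eqP; rewrite sqrtr_eq0 ge_max oppr_le0 => /andP[].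
have h3 : (fun n => Re (cauchy_at n x) ^+ 2) @ \oo --> (gap_sum x / Az.[x]) ^+ 2.
  by under eq_fun do rewrite expr2; rewrite expr2; apply: cvgM.
have e : Num.max (disc x) 0 = (gap_sum x / Az.[x]) ^+ 2.
  by rewrite -(cvg_lim _ h3)// (cvg_lim _ k2).
move: e; rewrite max_l// /disc expr_div_n => /(congr1 (fun u => u * Az.[x] ^+ 2)).
by rewrite !divfK ?expf_neq0.
Qed.

Lemma gap_sum_continuous x : c < x < d -> {for x, continuous gap_sum}.
Proof.
move=> xcd; apply: cvgD; last exact: continuous_horner.
apply: cvgM; first exact: continuous_horner.
have m0 := m_gt0 xcd; apply/cvgrPdist_le => e e0.
(* Within [m x / 2] of [x] the product of the two denominators is at least [(m x) ^ 2 / 2]. *)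
pose r := Num.min (m x / 2) (e * (m x) ^+ 2 / 2).
have r0 : 0 < r by rewrite lt_min !divr_gt0 ?mulr_gt0 ?exprn_gt0.
have r1 : r <= m x / 2 by rewrite ge_min lexx.
have r2 : r <= e * (m x) ^+ 2 / 2 by rewrite ge_min lexx orbT.
apply/nbhs_ballP; exists r => //= y; rewrite /ball/= => xy.
have [m1 m2] : m x <= x - c /\ m x <= d - x by split; rewrite ge_min lexx ?orbT.
have ycd : c < y < d.
  by move: xy; rewrite ltr_norml => /andP[y1 y2]; apply/andP; split; lra.
have my : m x / 2 <= m y.
  by rewrite le_min; move: xy; rewrite ltr_norml => /andP[y1 y2]; apply/andP; split; lra.
have key t : `|gap_resolvent x t - gap_resolvent y t| <= e.
  rewrite /gap_resolvent; case: ifPn => h; first by rewrite subrr normr0 ltW.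
  have x0 := far_neq0 xcd h; have y0 := far_neq0 ycd h.
  have -> : (x - t)^-1 - (y - t)^-1 = (y - x) / ((x - t) * (y - t)).
    by field; rewrite x0 y0.
  rewrite normrM normfV normrM (distrC y) ler_pdivrMr ?mulr_gt0 ?normr_gt0//.
  have f1 := far x h; have f2 := le_trans my (far y h).
  apply: (le_trans (ltW xy)); apply: (le_trans r2).
  rewrite -mulrA ler_pM2l// expr2 -mulrA; apply: ler_pM => //; [exact: ltW|by rewrite divr_ge0// ltW].
have bx := bfun_gap xcd; have by_ := bfun_gap ycd.
have be c0 := bfun_cst D c0 : bfun D (fun=> c0).
rewrite -(ExB mD P1 bx by_) ler_norml; apply/andP; split.
  rewrite -(Ex_cst mD P1 (- e)); apply: (ler_Ex mD P1) => //; first exact: bfunB.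
  by move=> t _; have := key t; rewrite ler_norml => /andP[].
rewrite -[leRHS](Ex_cst mD P1 e); apply: (ler_Ex mD P1) => //; first exact: bfunB.
by move=> t _; have := key t; rewrite ler_norml => /andP[].
Qed.

Lemma gap_sum_ivt x y : c < x < d -> c < y < d -> x <= y -> gap_sum x * gap_sum y <= 0 ->
  exists2 s, x <= s <= y & gap_sum s = 0.
Proof.
move=> /andP[cx xd] /andP[cy yd] xy le0.
have cw : {within `[x, y], continuous gap_sum}.
  apply: continuous_in_subspaceT => s; rewrite inE /= in_itv/= => /andP[xs sy].
  by apply: gap_sum_continuous; rewrite (lt_le_trans cx)// (le_lt_trans sy).
have [|s] := @IVT R gap_sum x y 0 xy cw; last by rewrite in_itv/=; exists s.
rewrite ge_min le_max; have [a|a] := ltP (gap_sum x) 0.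
  rewrite (ltW a)/=; rewrite leNgt; apply/negP => b.
  by move: le0; rewrite leNgt => /negP; apply; rewrite nmulr_lgt0.
rewrite /= andbT; move: a; rewrite le_eqVlt => /predU1P[<-|a]; first by rewrite lexx.
by move: le0; rewrite pmulr_rle0// => ->; rewrite orbT.
Qed.

(** Where [Pi] has no zero the continuous function [gap_sum] keeps one sign, and it equals [bpoly]
    at [z_j]. *)
Lemma gap_sum_sign j x : (j < K)%N -> c < z j < d -> c < x < d ->
  (forall y, c < y < d -> Pi.[y] != 0) -> gap_sum x = (-1) ^+ (K.-1 - j) * Num.sqrt Pi.[x].
Proof.
move=> jK zcd xcd nz.
have pos : 0 < gap_sum x * Bz.[z j].
  rewrite ltNge -(gap_sum_z jK); apply/negP => le0.
  have [s scd s0] : exists2 s, c < s < d & gap_sum s = 0.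
    have /andP[cx xd] := xcd; have /andP[cz zd] := zcd.
    have [xz|zx] := leP x (z j).
      have [s /andP[s1 s2] s0] := gap_sum_ivt xcd zcd xz le0.
      by exists s => //; rewrite (lt_le_trans cx)// (le_lt_trans s2).
    have [s /andP[s1 s2] s0] : exists2 s, z j <= s <= x & gap_sum s = 0.
      by apply: gap_sum_ivt => //; [exact: ltW|rewrite mulrC].
    by exists s => //; rewrite (lt_le_trans cz)// (le_lt_trans s2).
  by have := nz s scd; rewrite -gap_sum_sqr// s0 expr0n eqxx.
have sj := bpoly_z_sign jK.
have : 0 < (-1) ^+ (K.-1 - j) * gap_sum x.
  rewrite -(pmulr_rgt0 _ pos); set u := (-1) ^+ _ in sj *.
  have B2 : 0 < Bz.[z j] ^+ 2 by rewrite exprn_even_gt0//= bpoly_z_neq0.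
  have : 0 < gap_sum x ^+ 2 * (u * Bz.[z j]).
    by rewrite mulr_gt0// exprn_even_gt0//=; apply: contraTneq pos => ->; rewrite mul0r ltxx.
  by rewrite expr2; congr (0 < _); ring.
rewrite -gap_sum_sqr// sqrtr_sqr => h.
rewrite -{2}[gap_sum x]mul1r -{2}(sqrr_sign R (K.-1 - j)) expr2 -mulrA normrM normrX normrN1 expr1n mul1r.
by rewrite (gtr0_norm h) mulrA -expr2 sqrr_sign mul1r.
Qed.

(** Boundary values up to the endpoints of the interval: there [Pi] vanishes, and the limit of
    [Re (G) ^ 2] is [0]. *)
Lemma gap_cauchy_limit j x : (j < K)%N -> c < z j < d -> c <= x <= d -> x != z j ->
  (forall i, (i < K)%N -> x != z i) ->
  (forall y, c < y < d -> Pi.[y] != 0) ->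
  (x = c \/ x = d -> Pi.[x] = 0) ->
  (fun n => Re (cauchy_at n x)) @ \oo --> (-1) ^+ (K.-1 - j) * Num.sqrt Pi.[x] / Az.[x].
Proof.
move=> jK zcd /andP[cx xd] xj xz nz ends.
have [e|ne] := pselect (x = c \/ x = d).
  rewrite ends// sqrtr0 mulr0 mul0r.
  have [_ k2] := cauchy_at_cvg hK hA hp hz PD Pmin Pfin xz.
  move: k2; rewrite /disc ends// mul0r maxxx => k2.
  have k3 : (fun n => `|Re (cauchy_at n x)|) @ \oo --> (0 : R).
    rewrite -(@sqrtr0 R); under eq_fun do rewrite -sqrtr_sqr.
    by apply: continuous_cvg; [exact: sqrt_continuous|].
  by apply/norm_cvg0P.
have xcd : c < x < d.
  by rewrite !lt_neqAle cx xd !andbT; apply/andP; split; apply/eqP => e; apply: ne; [left|right].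
by rewrite -(gap_sum_sign jK zcd xcd nz); exact: (gap_limit xcd xz).1.
Qed.

End NullInterval.

End OffSupport.

(** * Location of the roots and of the support *)

Section LoopPolynomialRoots.
Context (R : realType) (K : nat) (A : R) (z pw : nat -> R).
Hypotheses (hK : (2 <= K)%N) (hA : 0 < A).
Hypothesis hp : forall i : nat, (i < K)%N -> 0 < pw i.
Hypothesis hz : forall i : nat, (i.+1 < K)%N -> z i < z i.+1.
Local Notation w := (weightw K A z pw).
Local Notation T := (measurableTypeR R).
Local Notation D := (`[z 0%N, z K.-1]%classic : set T).
Variable P : probability T R.
Hypothesis PD : P (~` D) = 0%E.
Hypothesis Pmin : forall nu : {measure set T -> \bar R},
  unit_measure_on (z 0%N) (z K.-1) nu -> (wenergy w P <= wenergy w nu)%E.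
Hypothesis Pfin : (wenergy w P < +oo)%E.
Local Notation Pi := (loop_poly K z pw (moment K z P)).
Local Notation Bz := (bpoly K z pw).

Lemma z_between n x : (n < K)%N -> z 0%N < x < z n -> (forall j, (j < K)%N -> x != z j) ->
  exists2 j, (j.+1 < K)%N & z j < x < z j.+1.
Proof.
move=> nK /andP[zx xn] xz; elim: n nK xn => [_ h|n ih nK xn].
  by move: (lt_trans zx h); rewrite ltxx.
have [h|h|h] := ltrgtP x (z n); [exact: (ih (ltnW nK) h)|by exists n => //; rewrite h|].
by move: (xz n (ltnW nK)); rewrite h eqxx.
Qed.

(** In contrast to [prob_itv0], the interval may contain some [z_j] or leave [D]. It is covered by
    the points [z_j], its parts in the gaps between them, and the complement of [D]. *)
Lemma prob_itv_ge0 (c d : R) : (forall x, c < x < d -> 0 <= Pi.[x]) -> P `]c, d[%classic = 0%E.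
Proof.
move=> Pi0; have mcd : measurable (`]c, d[%classic : set T) by exact: measurable_itv.
apply: (measure_negligible mcd).
pose G j : set T := if (j < K.-1)%N then [set z j] `|` `]Num.max c (z j), Num.min d (z j.+1)[%classic
  else if (j < K)%N then [set z j] else ~` D.
apply: (@negligibleS _ T _ P (\bigcup_j G j)).
  move=> x; rewrite /= in_itv/= => /andP[cx xd].
  have [[j jK xj]|nz] := pselect (exists2 j, (j < K)%N & x = z j).
    exists j => //; rewrite /G; case: ifPn => _; first by left.
    by rewrite jK.
  have xz j : (j < K)%N -> x != z j by move=> jK; apply/eqP => e; apply: nz; exists j.
  have [Dx|nDx] := pselect (D x); last first.
    by exists K => //; rewrite /G ltnn ltnNge leq_pred.
  move: Dx; rewrite /= in_itv/= => /andP[x0 xK].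
  have x0K : z 0%N < x < z K.-1.
    by rewrite !lt_neqAle x0 xK !andbT eq_sym !xz//; lia.
  have [|j jK /andP[jx xj]] := z_between _ x0K xz; first by lia.
  have jK1 : (j < K.-1)%N by move: jK; clear; lia.
    exists j => //; rewrite /G jK1.
  by right; rewrite /= in_itv/= gt_max lt_min cx jx xd xj.
apply: negligible_bigcup => j; rewrite /G; case: ifPn => jK.
  apply: negligibleU; first by apply/negligibleP; [exact: measurable_set1|exact: (prob_set1 hK hA hp hz PD Pmin Pfin)].
  apply/negligibleP; first exact: measurable_itv.
  apply: (prob_itv0 hK hA hp hz PD Pmin Pfin) => [i iK|x]; rewrite gt_max lt_min; last first.
    by move=> /andP[/andP[cx _] /andP[xd _]]; apply: Pi0; rewrite cx.
  move=> /andP[/andP[_ ji] /andP[_ ij]].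
  have [h|h] := leqP i j.
    have : z i <= z j by apply: (z_le hz); rewrite h (leq_trans jK)// leq_pred.
    by rewrite leNgt ji.
  have : z j.+1 <= z i by apply: (z_le hz); rewrite h.
  by rewrite leNgt ij.
case: ifPn => _; apply/negligibleP; [exact: measurable_set1|exact: (prob_set1 hK hA hp hz PD Pmin Pfin)|exact: measurableC|exact: PD].
Qed.

Lemma bpoly_z_opp j : (j.+1 < K)%N -> Bz.[z j] * Bz.[z j.+1] < 0.
Proof.
move=> jK; have jK' := ltnW jK.
have s1 : 0 < (-1) ^+ (K.-1 - j) * Bz.[z j] by exact: (bpoly_z_sign hK hA hp hz Pfin).
have s2 : 0 < (-1) ^+ (K.-1 - j.+1) * Bz.[z j.+1] by exact: (bpoly_z_sign hK hA hp hz Pfin).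
have e : (K.-1 - j = (K.-1 - j.+1).+1)%N by lia.
have := mulr_gt0 s1 s2; rewrite e exprS; set u := (-1) ^+ _ => h.
have u2 : u * u = 1 by rewrite -expr2 sqrr_sign.
move: h; have -> : -1 * u * Bz.[z j] * (u * Bz.[z j.+1]) = - (u * u) * (Bz.[z j] * Bz.[z j.+1]) by ring.
by rewrite u2 mulN1r oppr_gt0.
Qed.

(** For [p = q * (X - c)] the sign of [p] on one side of [c] contradicts [q(c) <> 0]: the right side
    excludes a negative value, the left side a positive one. *)
Lemma double_root (p : {poly R}) (c a b : R) : a < c < b -> (forall x, a < x < b -> 0 <= p.[x]) ->
  root p c -> ('X - c%:P) * ('X - c%:P) %| p.
Proof.
move=> /andP[ac cb] p0; rewrite -dvdp_XsubCl => /dvdpP[q pq].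
rewrite pq mulrC; apply: dvdp_mul => //; rewrite dvdp_XsubCl.
have cq : {for c, continuous (horner q)} by exact: continuous_horner.
have pE x : p.[x] = q.[x] * (x - c) by rewrite pq hornerM hornerXsubC.
apply/negPn/negP => /negPf; rewrite rootE => /negbT; rewrite neq_lt => /orP[q0|q0].
- have : \forall x \near c, q.[x] < 0 by exact: (cvgr_lt _ cq).
  move=> /nbhs_ballP[e /= e0 he].
  pose s := Num.min (e / 2) ((b - c) / 2).
  have s0 : 0 < s by rewrite lt_min !divr_gt0// subr_gt0.
  have s1 : s <= e / 2 by rewrite ge_min lexx.
  have s2 : s <= (b - c) / 2 by rewrite ge_min lexx orbT.
  have qs : q.[c + s] < 0.
    by apply: he; rewrite /ball/= opprD addrA subrr add0r normrN gtr0_norm//; lra.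
  have := p0 (c + s); rewrite pE addrAC subrr add0r => /(_ ltac:(apply/andP; split; lra)).
  by rewrite leNgt => /negP; apply; rewrite pmulr_llt0.
- have : \forall x \near c, 0 < q.[x] by exact: (cvgr_gt _ cq).
  move=> /nbhs_ballP[e /= e0 he].
  pose s := Num.min (e / 2) ((c - a) / 2).
  have s0 : 0 < s by rewrite lt_min !divr_gt0// subr_gt0.
  have s1 : s <= e / 2 by rewrite ge_min lexx.
  have s2 : s <= (c - a) / 2 by rewrite ge_min lexx orbT.
  have qs : 0 < q.[c - s].
    by apply: he; rewrite /ball/= opprB addrC subrK gtr0_norm//; lra.
  have := p0 (c - s); rewrite pE addrAC subrr add0r => /(_ ltac:(apply/andP; split; lra)).
  by rewrite leNgt mulrN oppr_lt0 mulr_gt0.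
Qed.

(** [Pi] is positive at both ends of the gap. If it is negative at some point inside, intermediate
    values give a root on either side of that point; otherwise the square root [gap_sum] supplies a
    double root. *)
Lemma gap_roots j : (j.+1 < K)%N -> exists ab : R * R,
  [/\ z j < ab.1, ab.1 <= ab.2, ab.2 < z j.+1 & ('X - ab.1%:P) * ('X - ab.2%:P) %| Pi].
Proof.
move=> jK; have zz := hz jK.
have jK' := ltnW jK.
have p1 : 0 < Pi.[z j] by exact: loop_poly_z_gt0.
have p2 : 0 < Pi.[z j.+1] by exact: loop_poly_z_gt0.
have [[x /andP[jx xj] Px]|npos] := pselect (exists2 x, z j < x < z j.+1 & Pi.[x] < 0).
  have [|al /andP[a1 a2] ra] := @poly_ivt R (- Pi) (z j) x (ltW jx).
    by rewrite !hornerN oppr_le0 oppr_ge0 !ltW.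
  have [|be /andP[b1 b2] rb] := @poly_ivt R Pi x (z j.+1) (ltW xj); first by rewrite !ltW.
  have Pa : Pi.[al] = 0 by move: ra; rewrite rootE hornerN oppr_eq0 => /eqP.
  have Pb : Pi.[be] = 0 by move: rb; rewrite rootE => /eqP.
  have strict u v : u <= v -> Pi.[u] != Pi.[v] -> u < v.
    by rewrite le_eqVlt => /predU1P[->|//]; rewrite eqxx.
  have A1 : z j < al by apply: strict => //; rewrite Pa gt_eqF.
  have A2 : al < x by apply: strict => //; rewrite Pa gt_eqF.
  have B1 : x < be by apply: strict => //; rewrite Pb lt_eqF.
  have B2 : be < z j.+1 by apply: strict => //; rewrite Pb lt_eqF.
  have ab : al < be by exact: lt_trans B1.
  exists (al, be); split => //=; first exact: ltW.
  rewrite Gauss_dvdp ?dvdp_XsubCl ?rootE ?Pa ?Pb ?eqxx//.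
  by rewrite coprimep_XsubC rootE hornerXsubC subr_eq0 gt_eqF.
have pos x : z j < x < z j.+1 -> 0 <= Pi.[x].
  by move=> zx; rewrite leNgt; apply/negP => h; apply: npos; exists x.
have [h1 h10 [q1 n1]] := prob_ball_z hK hA hp hz PD Pmin Pfin (ltnW jK).
have [h2 h20 [q2 n2]] := prob_ball_z hK hA hp hz PD Pmin Pfin jK.
(* The null interval extends beyond both ends of the gap, so that [gap_sum] is continuous up to the
   two points where its sign is known. *)
have Pnull : P `]z j - h1, z j.+1 + h2[%classic = 0%E.
  apply: prob_itv_ge0 => x /andP[x1 x2].
  have [zx|xz] := ltP (z j) x; last by apply/ltW/q1; rewrite x1 (le_lt_trans xz)// ltrDl.
  have [xz|xz] := ltP x (z j.+1); first by apply: pos; rewrite zx.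
  by apply/ltW/q2; rewrite x2 andbT (lt_le_trans _ xz)// gtrBl.
have cd : z j - h1 < z j.+1 + h2 by lra.
have i1 : z j - h1 < z j < z j.+1 + h2 by apply/andP; split; lra.
have i2 : z j - h1 < z j.+1 < z j.+1 + h2 by apply/andP; split; lra.
have [|c /andP[c1 c2] Fc] := gap_sum_ivt (pw := pw) PD i1 i2 (ltW zz).
  by rewrite !gap_sum_z ?(ltnW jK)// ltW// bpoly_z_opp.
have Pc : Pi.[c] = 0.
  rewrite -(gap_sum_sqr hK hA hp hz PD Pmin Pfin Pnull); first by rewrite Fc expr0n.
  by apply/andP; split; lra.
have strict u v : u <= v -> Pi.[u] != Pi.[v] -> u < v.
  by rewrite le_eqVlt => /predU1P[->|//]; rewrite eqxx.
have C1 : z j < c by apply: strict => //; rewrite Pc gt_eqF.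
have C2 : c < z j.+1 by apply: strict => //; rewrite Pc lt_eqF.
exists (c, c); split => //=.
by apply: (double_root (a := z j) (b := z j.+1)) => //; rewrite ?C1// rootE Pc.
Qed.

(** Pairs of roots from different gaps are coprime, so their product divides [Pi]; it already has
    degree [2 K - 2], and the cofactor is the leading coefficient. *)
Lemma loop_poly_factor : exists al be : nat -> R,
  (forall j, (j < K.-1)%N -> [/\ z j < al j, al j <= be j & be j < z j.+1]) /\
  forall x, Pi.[x] = (1 + \sum_(j < K) pw j) ^+ 2 * \prod_(j < K.-1) ((x - al j) * (x - be j)).
Proof.
have [ab hab] : exists ab : nat -> R * R, forall j, (j.+1 < K)%N ->
    [/\ z j < (ab j).1, (ab j).1 <= (ab j).2, (ab j).2 < z j.+1 & ('X - (ab j).1%:P) * ('X - (ab j).2%:P) %| Pi].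
  suff /choice[f hf] : forall j, exists ab : R * R, (j.+1 < K)%N ->
      [/\ z j < ab.1, ab.1 <= ab.2, ab.2 < z j.+1 & ('X - ab.1%:P) * ('X - ab.2%:P) %| Pi] by exists f.
  move=> j.
  have [jK|jK] := boolP (j.+1 < K)%N; first by have [x hx] := gap_roots jK; exists x.
  by exists (0, 0).
exists (fun j => (ab j).1), (fun j => (ab j).2); split.
  by move=> j jK; have [|? ? ? _] := hab j; [lia|].
pose q n : {poly R} := \prod_(j < n) (('X - (ab j).1%:P) * ('X - (ab j).2%:P)).
have mq n : q n \is monic by apply: monic_prod => j _; rewrite monicMr ?monicXsubC.
have sq n : size (q n) = (n + n).+1.
  elim: n => [|n ih]; first by rewrite /q big_ord0 size_poly1.
  rewrite /q big_ord_recr/= -/(q n) size_monicM ?mq// ?monic_neq0 ?monicMr ?monicXsubC//.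
  by rewrite ih size_monicM ?monicXsubC ?monic_neq0 ?monicXsubC// !size_XsubC; lia.
have dq n : (n < K)%N -> q n %| Pi.
  elim: n => [|n ih] nK; first by rewrite /q big_ord0 dvd1p.
  rewrite /q big_ord_recr/= -/(q n).
  have [h1 h2 h3 h4] := hab n nK.
  have cop x : z n < x -> coprimep (q n) ('X - x%:P).
    move=> zx; rewrite coprimep_XsubC rootE horner_prod; apply/prodf_neq0 => i _.
    have iK : (i.+1 < K)%N by have := ltn_ord i; lia.
    have [g1 g2 g3 _] := hab i iK.
    have g4 : z i.+1 <= z n by apply: (z_le hz); rewrite ltn_ord ltnW.
    rewrite hornerM !hornerXsubC mulf_neq0// subr_eq0 gt_eqF//.
      by rewrite (le_lt_trans g2)// (lt_trans g3)// (le_lt_trans g4).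
    by rewrite (lt_trans g3)// (le_lt_trans g4).
  by rewrite Gauss_dvdp ?ih ?h4 ?(ltnW nK)// coprimepMr !cop// (lt_le_trans h1).
have K1 : (K.-1 < K)%N by lia.
have pw0 : 0 < 1 + \sum_(j < K) pw j.
  by rewrite ltr_pwDl// sumr_ge0// => j _; rewrite ltW// hp.
have mom0 : moment K z P 0 = 1 by rewrite moment0.
have /dvdpP[r Pr] := dq _ K1.
have Pn0 : Pi != 0 by rewrite -size_poly_eq0 (size_loop_poly z hK mom0 pw0).
have r0 : r != 0 by apply: contraNneq Pn0 => r0; rewrite Pr r0 mul0r.
have := size_loop_poly z hK mom0 pw0; rewrite Pr size_Mmonic// sq addnS/= => sr.
have /eqP/size_poly1P[c c0 rc] : size r = 1%N by apply/eqP; move: sr; rewrite -add1n => /addIn ->.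
have := lead_loop_poly z hK mom0 pw0; rewrite Pr lead_coef_Mmonic// rc lead_coefC => <- x.
rewrite hornerM hornerC horner_prod; congr (_ * _).
by apply: eq_bigr => j _; rewrite hornerM !hornerXsubC.
Qed.

Section Factored.
Variables al be : nat -> R.
Hypothesis hab : forall j, (j < K.-1)%N -> [/\ z j < al j, al j <= be j & be j < z j.+1].
Hypothesis PiE : forall x,
  Pi.[x] = (1 + \sum_(j < K) pw j) ^+ 2 * \prod_(j < K.-1) ((x - al j) * (x - be j)).

Let pw0 : 0 < (1 + \sum_(j < K) pw j) ^+ 2.
Proof. by rewrite exprn_gt0// ltr_pwDl// sumr_ge0// => j _; rewrite ltW// hp. Qed.

Lemma be_lt_al i j : (i < j < K.-1)%N -> be i < al j.
Proof.
move=> /andP[ij jK]; have [_ _ h1] := hab (ltn_trans ij jK); have [h2 _ _] := hab jK.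
by rewrite (lt_trans h1)// (le_lt_trans _ h2)// (z_le hz)//; lia.
Qed.

Lemma loop_poly_lt0 j x : (j < K.-1)%N -> al j < x < be j -> Pi.[x] < 0.
Proof.
move=> jK /andP[ax xb]; rewrite PiE pmulr_rlt0// (bigD1 (Ordinal jK))//= pmulr_llt0.
  by rewrite pmulr_rlt0 ?subr_gt0// subr_lt0.
apply: prodr_gt0 => i; rewrite -val_eqE/= neq_ltn => /orP[ij|ji].
  have h : be i < x by rewrite (lt_trans _ ax)// be_lt_al// ij jK.
  have [_ h' _] := hab (ltn_ord i).
  by rewrite mulr_gt0// subr_gt0// (le_lt_trans h').
have h : x < al i by rewrite (lt_trans xb)// be_lt_al// ji ltn_ord.
have [_ h' _] := hab (ltn_ord i).
by rewrite nmulr_lgt0 subr_lt0// (lt_le_trans h).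
Qed.

Lemma loop_poly_ge0 x : (forall j, (j < K.-1)%N -> ~ (al j < x < be j)) -> 0 <= Pi.[x].
Proof.
move=> h; rewrite PiE mulr_ge0 ?(ltW pw0)//; apply: prodr_ge0 => j _.
have [_ h' _] := hab (ltn_ord j).
have [xa|ax] := leP x (al j); first by rewrite mulr_le0// subr_le0// (le_trans xa).
have [xb|bx] := ltP x (be j); first by case: (h j (ltn_ord j)); rewrite ax.
by rewrite mulr_ge0// subr_ge0// ltW.
Qed.

Lemma loop_poly_region k : (k.+1 < K.-1)%N ->
  [/\ be k < z k.+1 < al k.+1, P `]be k, al k.+1[%classic = 0%E,
      forall y, be k < y < al k.+1 -> Pi.[y] != 0 & Pi.[be k] = 0 /\ Pi.[al k.+1] = 0].
Proof.
move=> kK; have [_ _ h1] := hab (ltnW kK); have [h2 _ _] := hab kK.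
have out y j : be k < y < al k.+1 -> (j < K.-1)%N -> be j < y \/ y < al j.
  move=> /andP[by_ ya] jK; have [|kj] := leqP j k.
    rewrite leq_eqVlt => /predU1P[->|jk]; first by left.
    have [_ ab _] := hab (ltnW kK).
    by left; apply: lt_trans by_; rewrite (lt_le_trans _ ab)// be_lt_al// jk ltnW.
  right; apply: (lt_le_trans ya); move: kj; rewrite leq_eqVlt => /predU1P[->//|kj].
  have [_ ab _] := hab kK.
  by rewrite (le_trans ab)// ltW// be_lt_al// kj.
split.
- by rewrite h1.
- apply: prob_itv_ge0 => y yk; apply: loop_poly_ge0 => j jK /andP[ay yb].
  by have [h|h] := out y j yk jK; [move: (lt_trans h yb)|move: (lt_trans h ay)]; rewrite ltxx.
- move=> y yk; rewrite PiE; apply: mulf_neq0; first by rewrite gt_eqF.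
  apply/prodf_neq0 => j _; have [_ ab _] := hab (ltn_ord j).
  have [h|h] := out y j yk (ltn_ord j); apply: mulf_neq0; rewrite subr_eq0.
  + by rewrite gt_eqF// (le_lt_trans ab).
  + by rewrite gt_eqF.
  + by rewrite lt_eqF.
  + by rewrite lt_eqF// (lt_le_trans h).
- rewrite !PiE (bigD1 (Ordinal (ltnW kK)))//= subrr mulr0 mul0r mulr0; split=> //.
  by rewrite (bigD1 (Ordinal kK))//= subrr !mul0r mulr0.
Qed.

(** Off the nondegenerate bands [Pi >= 0] in a neighbourhood, hence no mass. Conversely, on a null
    part of a band [Pi] would be the square of [gap_sum], whereas it is negative inside the band. *)
Lemma msupport_prob : msupport P =
  \bigcup_(j in [set j | (j < K.-1)%N && (al j < be j)]) `[al j, be j]%classic.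
Proof.
apply/seteqP; split => x.
  move=> Sx; apply: contrapT => nx.
  (* A common radius is built one band at a time. Degenerate bands are passed over: a double root
     does not belong to the support on its own account. *)
  have far n : (n <= K.-1)%N -> exists2 e, 0 < e & forall j, (j < n)%N -> al j < be j ->
      forall y, x - e < y < x + e -> ~ (al j < y < be j).
    elim: n => [|n ih] nK; first by exists 1.
    have [e e0 he] := ih (ltnW nK).
    have [ab|nab] := ltP (al n) (be n); last first.
      exists e => // j; rewrite ltnS leq_eqVlt => /predU1P[->|jn]; last exact: he.
      by rewrite ltNge nab.
    have : x < al n \/ be n < x.
      have [h1|h1] := ltP x (al n); [by left|have [h2|h2] := ltP (be n) x; [by right|]].
      by case: nx; exists n; rewrite /= ?nK ?ab// in_itv/= h1.
    pose e1 := Num.max (al n - x) (x - be n).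
    move=> xn; have e10 : 0 < e1 by rewrite lt_max !subr_gt0; case: xn => ->; rewrite ?orbT.
    exists (Num.min e e1) => [|j]; first by rewrite lt_min e0.
    have ee : Num.min e e1 <= e by rewrite ge_min lexx.
    have ee1 : Num.min e e1 <= e1 by rewrite ge_min lexx orbT.
    rewrite ltnS leq_eqVlt => /predU1P[->|jn] jab y /andP[y1 y2]; last first.
      by apply: (he j jn jab); apply/andP; split; lra.
    move=> /andP[ay yb]; move: ee1; rewrite le_max; case: xn => xn /orP[h|h]; lra.
  have [e e0 he] := far _ (leqnn _).
  have := Sx e e0; rewrite /open_itv; apply/negP; rewrite -leNgt.
  suff h : P `](x - e)%R, (x + e)%R[%classic = 0%E by exact: (@eq_ind_r _ _ (fun u => (u <= 0)%E) (lexx _) _ h).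
  apply: prob_itv_ge0 => y yx; apply: loop_poly_ge0 => j jK yab.
  have ab : al j < be j by case/andP: yab => h1 h2; exact: lt_trans h2.
  exact: (he j jK ab y yx yab).
move=> [j /= /andP[jK ab]]; rewrite in_itv/= => /andP[ax xb] e e0.
rewrite lt0e measure_ge0 andbT; apply/eqP => null.
pose u := Num.max (al j) (x - e); pose v := Num.min (be j) (x + e).
have uv : u < v by rewrite gt_max !lt_min ab; apply/and3P; split; [|lra|]; rewrite ?andbT; lra.
have u1 : al j <= u by rewrite le_max lexx.
have u2 : x - e <= u by rewrite le_max lexx orbT.
have v1 : v <= be j by rewrite ge_min lexx.
have v2 : v <= x + e by rewrite ge_min lexx orbT.
have nuv : P `]u, v[%classic = 0%E.
  apply/eqP; rewrite -measure_le0 -null; apply: le_measure; rewrite ?inE; try exact: measurable_itv.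
  by move=> y; rewrite /open_itv /= !in_itv/= => /andP[y1 y2]; apply/andP; split; lra.
have mid : u < (u + v) / 2 < v by apply/andP; split; lra.
have := gap_sum_sqr hK hA hp hz PD Pmin Pfin nuv mid => e1.
have : Pi.[(u + v) / 2] < 0 by apply: (loop_poly_lt0 jK); apply/andP; split; lra.
by rewrite -e1 ltNge sqr_ge0.
Qed.

End Factored.

End LoopPolynomialRoots.

(** * The logarithmic potential *)

Section InducedMeasure.
Context d (T : measurableType d) (R : realType) (mu : {measure set T -> \bar R}).
Variable f : T -> \bar R.

(** The measure of density [f] with respect to [mu]; the hypotheses are arguments so that the
    measure structure can be declared on it. *)
Definition induced_measure of measurable_fun setT f & (forall x, 0 <= f x)%E : set T -> \bar R :=
  fun A => (\int[mu]_(x in A) f x)%E.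

Hypotheses (mf : measurable_fun setT f) (f0 : forall x, (0 <= f x)%E).

Let im0 : induced_measure mf f0 set0 = 0%E.
Proof. exact: integral_set0. Qed.

Let im_ge0 A : (0 <= induced_measure mf f0 A)%E.
Proof. exact: integral_ge0. Qed.

Let im_sigma : semi_sigma_additive (induced_measure mf f0).
Proof. exact: semi_sigma_additive_nng_induced. Qed.

HB.instance Definition _ := isMeasure.Build _ _ _ (induced_measure mf f0) im0 im_ge0 im_sigma.

End InducedMeasure.

Section LayersIntegral.
Context (R : realType).
Local Notation T := (measurableTypeR R).

(** The layer of index [n] has mass at most [C 2 ^- n], and the geometric series sums to [2 C]. *)
Lemma integral_log_layers_le (m : {measure set T -> \bar R}) (D : set T) (C x : R) : measurable D ->
  (forall n, (m `[(x - 2^-1 ^+ n)%R, (x + 2^-1 ^+ n)%R]%classic <= (C * 2^-1 ^+ n)%:E)%E) ->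
  (\int[m]_(t in D) log_layers (x - t) <= (2 * C)%:E)%E.
Proof.
move=> mD hC; have mst : measurable_fun setT (fun t : T => x - t) by exact: measurable_funB.
have pre n : (fun t : T => x - t) @^-1` [set v : R | `|v| <= 2^-1 ^+ n] = `[x - 2^-1 ^+ n, x + 2^-1 ^+ n]%classic.
  by apply/seteqP; split => v /=; rewrite in_itv/= ler_norml => /andP[? ?]; apply/andP; split; lra.
have mB n : measurable ((fun t : T => x - t) @^-1` [set v : R | `|v| <= 2^-1 ^+ n]).
  by rewrite pre; exact: measurable_itv.
rewrite /log_layers integral_nneseries//; last first.
  by move=> n; apply/measurable_EFinP; apply: measurable_funTS; apply: measurable_indic (mB n).
have geo : (\sum_(n <oo) (2 * C / (2 ^ (n + 1))%:R : R)%:E = (2 * C)%:E)%E.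
  apply/cvg_lim => //; have := @cvg_geometric_eseries_half R (2 * C) 0.
  by rewrite expr0 divr1.
rewrite -geo; apply: lee_nneseries.
  by move=> n _ _; apply: integral_ge0 => t _; rewrite lee_fin.
move=> n _.
rewrite (_ : (fun x : T => _) = (fun t : T => (\1_((fun t : T => x - t) @^-1` [set v : R | `|v| <= 2^-1 ^+ n]) t)%:E)); last first.
  by apply/funext => t; rewrite !indicE.
rewrite (integral_indic m mD (mB n)).
apply: (@le_trans _ _ (m `[(x - 2^-1 ^+ n)%R, (x + 2^-1 ^+ n)%R]%classic)).
  apply: le_measure; rewrite ?inE; [by apply: measurableI => //; exact: mB|exact: measurable_itv|].
  by rewrite -pre => v [].
apply: (le_trans (hC n)); rewrite lee_fin natrX exprD expr1 exprVn.
have e0 : 2 ^+ n != 0 :> R by rewrite expf_neq0.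
rewrite le_eqVlt; apply/orP; left; apply/eqP; field.
by rewrite e0.
Qed.

(** The layers control [|s| <= 1], and [ln |s| <= |s|] the rest; at [s = 0] the left-hand side is
    [0] by the convention [ln 0 = 0]. *)
Lemma ln_abs_le (s : R) : (`|ln `|s| |%:E <= log_layers s + `|s|%:E)%E.
Proof.
have [->|s0] := eqVneq s 0; first by rewrite normr0 ln0// normr0 adde_ge0// log_layers_ge0.
have n0 : 0 < `|s| by rewrite normr_gt0.
have [s1|s1] := leP `|s| 1.
  have := nlog_layers s; rewrite /nlog (gt_eqF n0) => h.
  rewrite ler0_norm; first by apply: (le_trans h); rewrite leeDl// lee_fin.
  by rewrite -(@ln1 R) ler_ln ?posrE.
rewrite ger0_norm; last by rewrite -(@ln1 R) ler_ln ?posrE// ltW.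
apply: (@le_trans _ _ `|s|%:E); last by rewrite leeDr// log_layers_ge0.
rewrite lee_fin; have -> : `|s| = 1 + (`|s| - 1) by ring.
apply: (le_trans (le_ln1Dx _)); first by lra.
lra.
Qed.

End LayersIntegral.

Section LogPotential.
Context (R : realType) (K : nat) (A : R) (z pw : nat -> R).
Hypotheses (hK : (2 <= K)%N) (hA : 0 < A).
Hypothesis hp : forall i : nat, (i < K)%N -> 0 < pw i.
Hypothesis hz : forall i : nat, (i.+1 < K)%N -> z i < z i.+1.
Local Notation w := (weightw K A z pw).
Local Notation T := (measurableTypeR R).
Local Notation D := (`[z 0%N, z K.-1]%classic : set T).
Local Notation leb := (lebesgue_measure : {measure set T -> \bar R}).
Variable P : probability T R.
Hypothesis PD : P (~` D) = 0%E.
Hypothesis Pmin : forall nu : {measure set T -> \bar R},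
  unit_measure_on (z 0%N) (z K.-1) nu -> (wenergy w P <= wenergy w nu)%E.
Hypothesis Pfin : (wenergy w P < +oo)%E.
Local Notation Pi := (loop_poly K z pw (moment K z P)).
Local Notation charged := (charged K z pw P).
Local Notation cauchy_at := (cauchy_at K z pw P).
Local Notation disc := (disc K z pw P).
Local Notation density := (density K z pw P).
Local Notation off_z := (off_z K z).

Let mD : measurable D.
Proof. exact: measurable_itv. Qed.
Let P1 : P D = 1%E.
Proof. exact: prob_carrier1. Qed.

Let rho (a b : R) : T -> \bar R := (fun x => (density x / pi)%:E) \_ `[a, b].

Let mrho a b : a < b -> off_z a b -> measurable_fun setT (rho a b).
Proof.
move=> ab nab; have [idn _ _] := density_integral hK hA hp hz PD Pmin Pfin ab nab.
have mab : measurable (`[a, b]%classic : set T) by exact: measurable_itv.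
apply/(measurable_restrictT _ mab).
have md : measurable_fun (`[a, b]%classic : set T) density by apply/measurable_EFinP; exact: (measurable_int _ idn).
by apply/measurable_EFinP; apply: measurable_funM => //; exact: measurable_cst.
Qed.

Let rho_ge0 a b x : (0 <= rho a b x)%E.
Proof.
rewrite /rho patchE; case: ifPn => // _; rewrite lee_fin divr_ge0 ?pi_ge0//.
exact: density_ge0.
Qed.

Lemma integral_rho (c d a b : R) : c < d -> a <= c -> d <= b -> off_z a b ->
  (\int[leb]_(x in `[c, d]) rho a b x)%E = P `]c, d]%classic.
Proof.
move=> cd ac db nab; have ncd : off_z c d.
  by move=> j jK /andP[cz zd]; apply: (nab j jK); rewrite (le_trans ac)// (le_trans zd).
rewrite (density_itv hK hA hp hz PD Pmin Pfin cd ncd).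
have [idn _ _] := density_integral hK hA hp hz PD Pmin Pfin cd ncd.
have mcd : measurable (`[c, d]%classic : set T) by exact: measurable_itv.
transitivity (\int[leb]_(x in `[c, d]) ((density x)%:E * (pi^-1)%:E))%E.
  apply: eq_integral => x; rewrite inE /= in_itv/= => /andP[cx xd].
  rewrite /rho patchE mem_set ?EFinM//= in_itv/=; by rewrite (le_trans ac)// (le_trans xd).
rewrite integralZr// EFinM; congr (_ * _)%E.
by rewrite /Rintegral fineK//; exact: integrable_fin_num.
Qed.

(** Inversion gives the masses of half-open intervals inside [[a, b]] only. To reach Borel sets, [P]
    is compared with the measure that keeps [P] outside [[a, b]] and has the density inside: they
    agree on all half-open intervals of the line, hence everywhere. *)
Lemma prob_density (a b : R) (E : set T) : a < b -> off_z a b -> measurable E ->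
  E `<=` `[a, b]%classic -> P E = (\int[leb]_(x in E) (density x / pi)%:E)%E.
Proof.
move=> ab nab mE Eab.
have mab : measurable (`[a, b]%classic : set T) by exact: measurable_itv.
have mnab : measurable (~` `[a, b]%classic : set T) by exact: measurableC.
have mr := mrho ab nab; have r0 := rho_ge0 a b.
pose nu := measure_add (mrestr P mnab) (induced_measure leb mr r0).
have nuE X : nu X = (P (X `&` ~` `[a, b]) + \int[leb]_(x in X) rho a b x)%E by rewrite /nu measure_addE.
have PS (x : R) : P [set x] = 0%E by exact: (prob_set1 hK hA hp hz PD Pmin Pfin).
have zeroI (c : R) (X : set T) : measurable X -> X `<=` [set c] -> (\int[leb]_(x in X) rho a b x = 0)%E.
  move=> mX Xc; apply/eqP; rewrite eq_le integral_ge0// andbT.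
  apply: (@le_trans _ _ (\int[leb]_(x in [set c]) rho a b x)%E); last by rewrite integral_set1.
  by apply: ge0_subset_integral => //; exact: measurable_funTS.
have agree X : ocitv X -> P X = nu X.
  case=> -[u v] _ <- /=; have muv : measurable (`]u, v]%classic : set T) by exact: measurable_itv.
  have mI : measurable (`]u, v] `&` `[a, b] : set T) by exact: measurableI.
  have split_ : P `]u, v]%classic = (P (`]u, v] `&` ~` `[a, b]) + P (`]u, v] `&` `[a, b]))%E.
    rewrite -measureU; [by rewrite -setIUr setvU setIT|by exact: measurableI|by []|].
    by rewrite setIACA setICl setI0.
  have outside : (\int[leb]_(x in `]u, v]) rho a b x = \int[leb]_(x in `]u, v] `&` `[a, b]) rho a b x)%E.
    rewrite [LHS]integral_mkcond [RHS]integral_mkcond; apply: eq_integral => x _.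
    by rewrite !patchE in_setI; case: (x \in `]u, v]%classic) => //=; rewrite /rho patchE; case: (x \in `[a, b]%classic).
  rewrite nuE [LHS]split_ outside; congr (_ + _)%E.
  pose u' := Num.max u a; pose v' := Num.min v b.
  have subI : `]u, v] `&` `[a, b] `<=` (`[u', v']%classic : set R).
    by move=> x [] /=; rewrite !in_itv/= ge_max le_min => /andP[/ltW -> ->] /andP[-> ->].
  have [uv|vu] := ltP u' v'; last first.
    have sub1 : `]u, v] `&` `[a, b] `<=` ([set u'] : set R).
      move=> x /subI /=; rewrite in_itv/= => /andP[h1 h2]; apply/eqP.
      by rewrite eq_le h1 (le_trans h2).
    rewrite (zeroI _ _ mI sub1); apply/eqP; rewrite -measure_le0 -(PS u'); apply: le_measure; rewrite ?inE//.
  have supI : `]u', v'] `<=` (`]u, v] `&` `[a, b] : set R).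
    by move=> x /=; rewrite !in_itv/= gt_max le_min => /andP[/andP[-> /ltW ->] /andP[-> ->]].
  have nuv := @integral_rho u' v' a b uv.
  have au : a <= u' by rewrite le_max lexx orbT.
  have vb : v' <= b by rewrite ge_min lexx orbT.
  have {}nuv := nuv au vb nab.
  have muv' : measurable (`]u', v']%classic : set T) by exact: measurable_itv.
  have muv2 : measurable (`[u', v']%classic : set T) by exact: measurable_itv.
  have Pc : P `[u', v']%classic = P `]u', v']%classic.
    have -> : `[u', v']%classic = [set u'] `|` `]u', v']%classic :> set R.
      by rewrite setU1itv// bnd_simp ltW.
    apply/eqP; rewrite eq_le; apply/andP; split; last first.
      apply: le_measure; rewrite ?inE//; first by apply: measurableU => //; exact: measurable_set1.
    apply: (le_trans (measureU2 _ _ _)); [exact: measurable_set1|exact: muv'|].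
    by rewrite [X in (X + _)%E](PS u') add0e.
  have Ic : (\int[leb]_(x in `]u', v']) rho a b x = \int[leb]_(x in `[u', v']) rho a b x)%E.
    by apply: integral_itv_obnd_cbnd; exact: measurable_funTS.
  have Ic' : (\int[leb]_(x in `]u', v']) rho a b x = P `]u', v']%classic)%E by rewrite Ic.
  transitivity (P `]u', v']%classic).
    apply/eqP; rewrite eq_le; apply/andP; split.
      by rewrite -Pc; apply: le_measure; rewrite ?inE.
    by apply: le_measure; rewrite ?inE.
  apply/eqP; rewrite eq_le; apply/andP; split.
    by rewrite -Ic'; apply: ge0_subset_integral => //; exact: measurable_funTS.
  by rewrite -nuv; apply: ge0_subset_integral => //; exact: measurable_funTS.
have key : P E = nu E.
  rewrite -[LHS](lebesgue_stieltjes_cdf_id P mE).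
  apply: lebesgue_stieltjes_measure_unique mE => X oX.
  rewrite lebesgue_stieltjes_cdf_id; first exact: agree.
  by case: oX => -[u v] _ <-; exact: measurable_itv.
rewrite key nuE (_ : E `&` ~` `[a, b] = set0); last first.
  by apply/seteqP; split => // x [/Eab].
rewrite [X in (X + _)%E]measure0 add0e; apply: eq_integral => x; rewrite inE => /Eab xab.
by rewrite /rho patchE mem_set.
Qed.

(** Near a [z_j] there is no mass, near any other point the density is bounded, and for [s > h] the
    bound [1 <= s / h] suffices; whence the constant [C + h^-1]. *)
Lemma prob_ball_le (x : R) : exists C, forall s, 0 < s ->
  (P `[(x - s)%R, (x + s)%R]%classic <= (C * s)%:E)%E.
Proof.
suff [h h0 [C C0 hC]] : exists2 h, 0 < h & exists2 C, 0 <= C & forall s, 0 < s -> s <= h ->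
    (P `[(x - s)%R, (x + s)%R]%classic <= (C * s)%:E)%E.
  exists (C + h^-1) => s s0; have [sh|hs] := leP s h.
    by apply: (le_trans (hC s s0 sh)); rewrite lee_fin mulrDl lerDl mulr_ge0// ?invr_ge0 ltW.
  apply: (@le_trans _ _ 1%E); first by apply: probability_le1; exact: measurable_itv.
  have hs1 : 1 <= h^-1 * s by rewrite ler_pdivlMl// mulr1 ltW.
  by rewrite lee_fin mulrDl (le_trans hs1)// lerDr mulr_ge0// ltW.
have [[j jK ->]|nz] := pselect (exists2 j, (j < K)%N & x = z j).
  have [h h0 [_ Ph]] := prob_ball_z hK hA hp hz PD Pmin Pfin jK.
  exists (h / 2); first by rewrite divr_gt0.
  exists 0 => // s s0 sh; rewrite mul0r; apply: (@le_trans _ _ (P `](z j - h)%R, (z j + h)%R[%classic)); last by rewrite Ph.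
  apply: le_measure; rewrite ?inE; try exact: measurable_itv.
  by move=> y /=; rewrite !in_itv/= => /andP[y1 y2]; apply/andP; split; lra.
have xz j : (j < K)%N -> x != z j by move=> jK; apply/eqP => e; apply: nz; exists j.
have [h h0 hh] := off_z_ball K z x.
have nab : off_z (x - h) (x + h).
  move=> j jK /andP[h1 h2]; have := hh j jK (xz j jK); rewrite ltNge => /negP; apply.
  by rewrite ler_norml; apply/andP; split; lra.
have ab : x - h < x + h by lra.
have [_ [M hM] _] := density_integral hK hA hp hz PD Pmin Pfin ab nab.
have M0 : 0 <= M by apply: le_trans (hM x _); rewrite ?density_ge0//; apply/andP; split; lra.
have pi0 := @pi_gt0 R.
exists h => //; exists (2 * M / pi) => [|s s0 sh]; first by rewrite divr_ge0 ?pi_ge0// mulr_ge0.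
have ss : x - s < x + s by lra.
have ms : measurable (`[(x - s)%R, (x + s)%R]%classic : set T) by exact: measurable_itv.
rewrite (prob_density ab nab ms); last first.
  by move=> y /=; rewrite !in_itv/= => /andP[y1 y2]; apply/andP; split; lra.
have ls : leb `[(x - s)%R, (x + s)%R]%classic = (2 * s)%:E.
  by rewrite /= lebesgue_measure_itv/= lte_fin ss -EFinB; congr EFin; ring.
apply: (@le_trans _ _ (\int[leb]_(y in `[(x - s)%R, (x + s)%R]) (M / pi)%:E)%E); last first.
  rewrite integral_cst// [X in (_ * X)%E]ls -EFinM lee_fin.
  by have -> : M / pi * (2 * s) = 2 * M / pi * s by ring.
apply: ge0_le_integral => //.
- by move=> y _; rewrite lee_fin divr_ge0 ?pi_ge0// density_ge0.
- have nss : off_z (x - s) (x + s).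
    by move=> j jK /andP[h1 h2]; apply: (nab j jK); apply/andP; split; lra.
  have [idn _ _] := density_integral hK hA hp hz PD Pmin Pfin ss nss.
  have md : measurable_fun (`[x - s, x + s]%classic : set T) density by apply/measurable_EFinP; exact: (measurable_int _ idn).
  by apply/measurable_EFinP; apply: measurable_funM => //; exact: measurable_cst.
- move=> y; rewrite /= in_itv/= => /andP[y1 y2]; rewrite lee_fin ler_pM2r ?invr_gt0//.
  by apply: hM; apply/andP; split; lra.
Qed.

(** The linear bound on the mass of balls makes the layers of the logarithm summable. *)
Lemma ln_integrable (x : R) : P.-integrable D (fun t : T => (ln `|x - t|)%:E).
Proof.
have [C hC] := prob_ball_le x.
have mst : measurable_fun setT (fun t : T => x - t) by exact: measurable_funB.
have mn : measurable_fun setT (fun t : T => `|x - t|) by apply: (measurableT_comp (@normr_measurable R setT)).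
have mln : measurable_fun D (fun t : T => (ln `|x - t|)%:E).
  apply/measurable_EFinP; apply: measurable_funTS.
  exact: (measurableT_comp (@measurable_ln R)).
have mll : measurable_fun setT (fun t : T => log_layers (x - t)).
  by apply: (measurableT_comp (@measurable_log_layers R)).
have bn : bfun D (fun t : T => `|x - t|).
  split => //; have [_ [M hM]] := bfunB (bfun_cst D x) (bfun_id (z 0%N) (z K.-1)).
  by exists M => t Dt; rewrite normr_id; exact: hM.
have ill : (\int[P]_(t in D) log_layers (x - t) <= (2 * C)%:E)%E.
  by apply: integral_log_layers_le => // n; apply: hC; rewrite exprn_gt0.
apply: (@le_integrable _ _ _ P D mD _ (fun t : T => (log_layers (x - t) + `|x - t|%:E)%E)) => //.
  move=> t _; rewrite [leRHS]gee0_abs; first exact: ln_abs_le.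
  by rewrite adde_ge0// log_layers_ge0.
apply: integrableD => //; last exact: (bfun_integrable mD P1 bn).
apply/integrableP; split; first exact: measurable_funTS.
rewrite (eq_integral (fun t : T => log_layers (x - t))); first exact: le_lt_trans ill (ltry _).
by move=> t _; rewrite gee0_abs// log_layers_ge0.
Qed.

Definition potential (x : R) : R := charged (fun t => ln `|x - t|).

Lemma potential_integral (c d : R) (U : R -> R) : c < d -> off_z c d ->
  (forall x, c <= x <= d -> (fun n => Re (cauchy_at n x)) @ \oo --> U x) ->
  leb.-integrable `[c, d] (EFin \o U) /\
  (\int[leb]_(x in `[c, d]) U x)%R = potential d - potential c.
Proof.
move=> cd ncd Uc.
have PS (x : R) : P [set x] = 0%E by exact: (prob_set1 hK hA hp hz PD Pmin Pfin).
have [i1 ->] := log_integral hK hA hp hz PD Pmin Pfin cd ncd Uc (PS c) (PS d) (ln_integrable c) (ln_integrable d).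
split=> //; rewrite /potential /charged /Ex RintegralB//; [|exact: ln_integrable|exact: ln_integrable].
rewrite opprD addrACA -sumrB; congr (_ + _); apply: eq_bigr => j _; by rewrite mulrBr.
Qed.

(** Where [Pi <= 0] the limit of [Re G], which is the derivative of the potential, is [0]. *)
Lemma potential_cst (c d : R) : c < d -> off_z c d -> (forall x, c <= x <= d -> Pi.[x] <= 0) ->
  potential c = potential d.
Proof.
move=> cd ncd Pi0; have [x cx|_ e] := @potential_integral c d (fun=> 0) cd ncd.
  have xz j (jK : (j < K)%N) := off_z_neq ncd cx jK.
  have [_ k2] := cauchy_at_cvg hK hA hp hz PD Pmin Pfin xz.
  have d0 : disc x <= 0.
    by rewrite /disc mulr_le0_ge0 ?Pi0// invr_ge0 sqr_ge0.
  rewrite max_r// in k2.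
  have k3 : (fun n => `|Re (cauchy_at n x)|) @ \oo --> (0 : R).
    rewrite -(@sqrtr0 R); under eq_fun do rewrite -sqrtr_sqr.
    by apply: continuous_cvg; [exact: sqrt_continuous|].
  by apply/norm_cvg0P.
apply/esym/eqP; rewrite -subr_eq0 -e Rintegral_cst ?mul0r//; exact: measurable_itv.
Qed.

End LogPotential.

Section FiniteSums.
Context d (T : measurableType d) (R : realType).
Variables (m : {measure set T -> \bar R}) (D : set T).
Hypothesis mD : measurable D.

Lemma RintegralN (f : T -> R) : m.-integrable D (EFin \o f) ->
  (\int[m]_(x in D) (- f x))%R = - (\int[m]_(x in D) f x)%R.
Proof.
move=> i; rewrite -mulN1r -RintegralZl//.
by apply: eq_Rintegral => x _; rewrite mulN1r.
Qed.

Lemma Rintegral_sum n (f : nat -> T -> R) :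
  (forall j, (j < n)%N -> m.-integrable D (EFin \o f j)) ->
  m.-integrable D (EFin \o (fun x => \sum_(j < n) f j x)) /\
  (\int[m]_(x in D) (\sum_(j < n) f j x))%R = \sum_(j < n) (\int[m]_(x in D) f j x)%R.
Proof.
elim: n => [|n ih] i_f.
  rewrite (_ : (fun x => \sum_(j < 0) f j x) = fun=> 0); last by apply/funext => x; rewrite big_ord0.
  split; first exact: (integrable0 m D).
  by rewrite big_ord0 /Rintegral integral0.
have [i1 e1] := ih (fun j jn => i_f j (ltnW jn)).
have i2 := i_f n (ltnSn n).
rewrite (_ : (fun x => \sum_(j < n.+1) f j x) = (fun x => \sum_(j < n) f j x + f n x)); last first.
  by apply/funext => x; rewrite big_ord_recr.
by split; [exact: (integrableD mD i1 i2)|rewrite RintegralD// e1 big_ord_recr].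
Qed.

End FiniteSums.

(** * Comparison with mixtures of the minimizer and its restrictions *)

Section Mixtures.
Context d (T : measurableType d) (R : realType).
Variables (P : {measure set T -> \bar R}) (E : set T) (mE : measurable E).

Lemma ge0_integral_mrestr (f : T -> \bar R) : measurable_fun setT f -> (forall x, 0 <= f x)%E ->
  (\int[mrestr P mE]_x f x = \int[P]_(x in E) f x)%E.
Proof.
move=> mf f0; have mCE : measurable (~` E) by exact: measurableC.
have null : mrestr P mE (~` E) = 0%E by rewrite /mrestr setICl measure0.
rewrite (ge0_negligible_integral mCE measurableT mf)// setTD setCK.
by apply: eq_measure_integral => B mB BE; exact: (congr1 P (setIidl BE)).
Qed.

Variables s r : {nonneg R}.

(** Total mass one is not imposed here; the application chooses the coefficients accordingly. *)
Definition mixture : {measure set T -> \bar R} :=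
  measure_add (mscale s P) (mscale r (mrestr P mE)).

Lemma mixtureE B : mixture B = (s%:num%:E * P B + r%:num%:E * P (B `&` E))%E.
Proof. by apply: etrans (measure_addE _ _ _) _. Qed.

Lemma ge0_integral_mixture (f : T -> \bar R) : measurable_fun setT f -> (forall x, 0 <= f x)%E ->
  (\int[mixture]_x f x = s%:num%:E * \int[P]_x f x + r%:num%:E * \int[P]_(x in E) f x)%E.
Proof.
move=> mf f0; rewrite ge0_integral_measure_add// ge0_integral_mscale// ge0_integral_mscale//.
by rewrite ge0_integral_mrestr.
Qed.

End Mixtures.

Section MixtureEnergy.
Context d (T : measurableType d) (R : realType).
Variables (P : probability T R) (h : T * T -> \bar R).
Hypotheses (mh : measurable_fun setT h) (h0 : forall y, (0 <= h y)%E).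
Hypothesis hsym : forall x t, h (x, t) = h (t, x).
Variables (E : set T) (mE : measurable E) (s r : {nonneg R}).
Let a x := (\int[P]_t h (x, t))%E.
Let e x := (\int[P]_(t in E) h (x, t))%E.

Let mha x : measurable_fun setT (fun t => h (x, t)).
Proof. exact: measurableT_comp. Qed.

Lemma measurable_potential_section : measurable_fun setT a.
Proof. exact: measurable_fun_fubini_tonelli_F. Qed.

Let m1 : measurable_fun setT (\1_E : T -> R).
Proof. exact: measurable_indic. Qed.

Let measurable_potential_restricted : measurable_fun setT e.
Proof.
rewrite (_ : e = (fun x => \int[P]_t (h (x, t) * (\1_E t)%:E))%E).
  apply: (measurable_fun_fubini_tonelli_F (fun y => h y * (\1_E y.2)%:E)%E) => [|y].
    apply: emeasurable_funM => //; apply/measurable_EFinP.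
    exact: (measurableT_comp m1).
  by rewrite mule_ge0// lee_fin.
apply/funext => x; rewrite /e integral_mkcond; apply: eq_integral => t _.
by rewrite patchE indicE; case: (t \in E); rewrite ?mule1 ?mule0.
Qed.

Let a0 x : (0 <= a x)%E. Proof. exact: integral_ge0. Qed.
Let e0 x : (0 <= e x)%E. Proof. exact: integral_ge0. Qed.

Let arith (s1 r1 : R) (v j q : \bar R) : v \is a fin_num -> j \is a fin_num -> q \is a fin_num ->
  (q <= v)%E ->
  (s1%:E * (s1%:E * v + r1%:E * j) + r1%:E * (s1%:E * j + r1%:E * q) <=
   (s1 ^+ 2 * fine v + 2 * s1 * r1 * fine j + r1 ^+ 2 * fine v)%:E)%E.
Proof.
case: v => [v| |]//; case: j => [j| |]//; case: q => [q| |]// _ _ _; rewrite lee_fin => qv.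
rewrite [leLHS](_ : _ = (s1 * (s1 * v + r1 * j) + r1 * (s1 * j + r1 * q))%:E)// lee_fin /=.
have := ler_wpM2l (sqr_ge0 r1) qv; lra.
Qed.

(** Bilinear expansion. The cross terms agree by symmetry of the kernel and Tonelli; the term over
    [E * E] enters with [r ^ 2], of second order in the application, and is simply bounded by the
    full energy. *)
Lemma mixture_energy : (\int[P]_x a x < +oo)%E ->
  (\int[mixture P mE s r]_x \int[mixture P mE s r]_t h (x, t) <=
   (s%:num ^+ 2 * fine (\int[P]_x a x) + 2 * s%:num * r%:num * fine (\int[P]_(x in E) a x) +
    r%:num ^+ 2 * fine (\int[P]_x a x))%:E)%E.
Proof.
move=> afin.
have ma := measurable_potential_section.
have -> : (\int[mixture P mE s r]_x \int[mixture P mE s r]_t h (x, t) =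
   \int[mixture P mE s r]_x (s%:num%:E * a x + r%:num%:E * e x))%E.
  by apply: eq_integral => x _; rewrite ge0_integral_mixture.
have fin_le (u : \bar R) : (0 <= u)%E -> (u <= \int[P]_x a x)%E -> u \is a fin_num.
  by move=> u0 ua; rewrite ge0_fin_numE// (le_lt_trans ua).
have Ea : (\int[P]_(x in E) a x <= \int[P]_x a x)%E by apply: ge0_subset_integral.
have ea x : (e x <= a x)%E by apply: ge0_subset_integral.
have Ee : (\int[P]_(x in E) e x <= \int[P]_x a x)%E.
  by apply: le_trans Ea; apply: ge0_le_integral => //; by [exact: measurable_funTS|move=> x _; exact: ea].
have fubini : (\int[P]_x e x = \int[P]_(x in E) a x)%E.
  transitivity (\int[P]_x \int[P]_t (h (x, t) * (\1_E t)%:E))%E.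
    apply: eq_integral => x _; rewrite /e integral_mkcond; apply: eq_integral => t _.
    by rewrite patchE indicE; case: (t \in E); rewrite ?mule1 ?mule0.
  rewrite (@fubini_tonelli _ _ _ _ _ P P (fun y => h y * (\1_E y.2)%:E)%E); last 2 first.
  - apply: emeasurable_funM => //; apply/measurable_EFinP.
    exact: (measurableT_comp m1).
  - by move=> y; rewrite mule_ge0// lee_fin.
  rewrite [RHS]integral_mkcond; apply: eq_integral => t _; rewrite patchE.
  case: ifPn => tE; first by apply: eq_integral => x _; rewrite indicE/= tE mule1 hsym.
  by rewrite integral0_eq// => x _; rewrite indicE/= (negbTE tE) mule0.
have s0 : (0 <= s%:num%:E :> \bar R)%E by rewrite lee_fin.
have r0 : (0 <= r%:num%:E :> \bar R)%E by rewrite lee_fin.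
have mix f c0 : (0 <= c0%:E :> \bar R)%E -> measurable_fun setT f -> (forall x, 0 <= f x)%E ->
    (\int[P]_x (c0%:E * f x) = c0%:E * \int[P]_x f x)%E /\
    (\int[P]_(x in E) (c0%:E * f x) = c0%:E * \int[P]_(x in E) f x)%E.
  move=> c00 mf f0; split; apply: ge0_integralZl => //; exact: measurable_funTS.
have msa : measurable_fun setT (fun x => s%:num%:E * a x)%E by exact: measurable_funeM.
have mre : measurable_fun setT (fun x => r%:num%:E * e x)%E by exact: measurable_funeM.
rewrite ge0_integral_mixture; last 2 first.
- exact: emeasurable_funD.
- by move=> x; rewrite adde_ge0// mule_ge0.
rewrite ge0_integralD//; [|by move=> x _; rewrite mule_ge0|by move=> x _; rewrite mule_ge0].
rewrite (ge0_integralD _ mE); [|by move=> x _; rewrite mule_ge0|exact: measurable_funTS|by move=> x _; rewrite mule_ge0|exact: measurable_funTS].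
rewrite (mix a _ s0 ma a0).1 (mix a _ s0 ma a0).2 (mix e _ r0 measurable_potential_restricted e0).1 (mix e _ r0 measurable_potential_restricted e0).2 fubini.
have V0 : (0 <= \int[P]_x a x)%E by apply: integral_ge0 => x _; exact: a0.
have J0 : (0 <= \int[P]_(x in E) a x)%E by apply: integral_ge0 => x _; exact: a0.
have Q0 : (0 <= \int[P]_(x in E) e x)%E by apply: integral_ge0 => x _; exact: e0.
have Vf := fin_le _ V0 (lexx _); have Jf := fin_le _ J0 Ea; have Qf := fin_le _ Q0 Ee.
exact: arith.
Qed.

End MixtureEnergy.

(** * Equality of the potential on all bands of the support *)

Section EquilibriumConstant.
Context (R : realType) (K : nat) (A : R) (z pw : nat -> R).
Hypotheses (hK : (2 <= K)%N) (hA : 0 < A).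
Hypothesis hp : forall i : nat, (i < K)%N -> 0 < pw i.
Hypothesis hz : forall i : nat, (i.+1 < K)%N -> z i < z i.+1.
Local Notation w := (weightw K A z pw).
Local Notation T := (measurableTypeR R).
Local Notation D := (`[z 0%N, z K.-1]%classic : set T).
Variable P : probability T R.
Hypothesis PD : P (~` D) = 0%E.
Hypothesis Pmin : forall nu : {measure set T -> \bar R},
  unit_measure_on (z 0%N) (z K.-1) nu -> (wenergy w P <= wenergy w nu)%E.
Hypothesis Pfin : (wenergy w P < +oo)%E.
Local Notation Pi := (loop_poly K z pw (moment K z P)).
Local Notation charged := (charged K z pw P).
Local Notation off_z := (off_z K z).

Let mD : measurable D.
Proof. exact: measurable_itv. Qed.
Let P1 : P D = 1%E.
Proof. exact: prob_carrier1. Qed.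

Variable c : R.
Hypotheses (c0 : 0 <= c)
  (kc : forall x t, D x -> D t -> (0 <= log_kernel w x t + c%:E)%E).

Let h : T * T -> \bar R := (fun y => (log_kernel w y.1 y.2 + c%:E)%E) \_ (D `*` D).
Let a x := (\int[P]_t h (x, t))%E.

Let mkern := measurable_log_kernel K A z pw.
Let mh : measurable_fun setT h.
Proof. exact: measurable_shifted. Qed.
Let h0 y : (0 <= h y)%E.
Proof. by apply: shifted_ge0 => x t; exact: kc. Qed.

Let hsym x t : h (x, t) = h (t, x).
Proof.
rewrite /h !patchE !in_setX/= [(x \in _) && _]andbC; case: ifP => // _.
rewrite /log_kernel eq_sym distrC; congr (_ + _)%E.
by rewrite orbAC mulrAC.
Qed.

Let V := fine (wenergy w P) + c.

Let energyE : (\int[P]_x a x = V%:E)%E.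
Proof.
rewrite /a -(energy_shift_patch mD PD mkern c0 kc) /V EFinD fineK//.
exact: (wenergy_fin_num hK hA hp hz).
Qed.

Let V_le u : (wenergy w P <= u)%E -> (V%:E <= u + c%:E)%E.
Proof.
move=> le; rewrite /V EFinD fineK; first exact: leeD2r.
exact: (wenergy_fin_num hK hA hp hz PD Pfin).
Qed.

(** With [m = P(E)] and [J] the right-hand side, the competitor [(1 - s) P + (s / m) P|_E] changes
    the energy by at most [2 s (J / m - V) + O(s ^ 2)], so minimality forces [J / m >= V]. *)
Lemma energy_le_section (E : set T) : measurable E -> E `<=` D ->
  (P E * V%:E <= \int[P]_(x in E) a x)%E.
Proof.
move=> mE ED.
have ma : measurable_fun setT a by exact: measurable_potential_section.
have a0 x : (0 <= a x)%E by exact: integral_ge0.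
have JV : (\int[P]_(x in E) a x <= V%:E)%E.
  by rewrite -energyE; apply: ge0_subset_integral.
have Jfin : (\int[P]_(x in E) a x)%E \is a fin_num.
  rewrite ge0_fin_numE; first exact: le_lt_trans JV (ltry _).
  by apply: integral_ge0 => x _; exact: a0.
pose J := fine (\int[P]_(x in E) a x).
have JE : (\int[P]_(x in E) a x)%E = J%:E by rewrite fineK.
pose m := fine (P E); have mE' : P E = m%:E by rewrite fineK// fin_num_measure.
have m0 : 0 <= m by rewrite fine_ge0.
have V0 : 0 <= V by rewrite -lee_fin -energyE integral_ge0.
have J0 : 0 <= J by rewrite fine_ge0// integral_ge0.
rewrite JE mE' -EFinM lee_fin.
have [m00|mpos] := eqVneq m 0; first by rewrite m00 mul0r.
have {m0 mpos}m0 : 0 < m by rewrite lt_neqAle eq_sym mpos.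
have key s : 0 <= s -> s <= 1 -> V <= (1 - s) ^+ 2 * V + 2 * (1 - s) * (s / m) * J + (s / m) ^+ 2 * V.
  move=> s0 s1; have s1' : 0 <= 1 - s by rewrite subr_ge0.
  have r0 : 0 <= s / m by rewrite divr_ge0// ltW.
  pose nu := mixture P mE (NngNum s1') (NngNum r0).
  have nu1 : nu setT = 1%E.
    rewrite /nu mixtureE/= setTI probability_setT mule1 mE' -EFinM -EFinD; congr EFin.
    by field; rewrite gt_eqF.
  have nuD : nu (~` D) = 0%E.
    rewrite /nu mixtureE/= PD (_ : ~` D `&` E = set0) ?measure0 ?mule0 ?adde0//.
    by apply/seteqP; split => // x [nDx /ED].
  have [Q QE] := unit_measure_probability nu1.
  have QD : Q (~` D) = 0%E by rewrite QE.
  have le1 := Pmin (conj nu1 nuD).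
  have e1 : (wenergy w nu + c%:E = \int[nu]_x \int[nu]_t h (x, t))%E.
    rewrite (@eq_wenergy R w nu Q); last by move=> B _; exact/esym/QE.
    rewrite /wenergy (energy_shift_patch mD QD mkern c0 kc) -/h.
    transitivity (\int[nu]_x \int[Q]_t h (x, t))%E; first by apply: eq_measure_integral => B _ _; exact: QE.
    by apply: eq_integral => x _; apply: eq_measure_integral => B _ _; exact: QE.
  have eV : (\int[P]_x \int[P]_t h (x, t) = V%:E)%E := energyE.
  have eJ : (\int[P]_(x in E) \int[P]_t h (x, t) = J%:E)%E := JE.
  have afin : (\int[P]_x \int[P]_t h (x, t) < +oo)%E by rewrite eV ltry.
  have mix := mixture_energy mh h0 hsym mE (NngNum s1') (NngNum r0) afin.
  rewrite eV eJ /= in mix.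
  have le2 := V_le le1.
  by rewrite e1 in le2; have := le_trans le2 mix; rewrite lee_fin.
rewrite leNgt; apply/negP => lt1.
(* [q] bounds the coefficient of [s ^ 2]; for [s <= dl / q] the linear gain [2 s dl] outweighs that
   term. *)
pose q := V + V / m ^+ 2 + 1; have q0 : 0 < q by rewrite ltr_wpDl// addr_ge0// divr_ge0// sqr_ge0.
pose dl := V - J / m; have dl0 : 0 < dl by rewrite subr_gt0 ltr_pdivrMr// mulrC.
pose s := Num.min 1 (dl / q).
have s0 : 0 < s by rewrite lt_min ltr01 divr_gt0.
have s1 : s <= 1 by rewrite ge_min lexx.
have s2 : s * q <= dl by rewrite -ler_pdivlMr// ge_min lexx orbT.
have := key s (ltW s0) s1.
have -> : (1 - s) ^+ 2 * V + 2 * (1 - s) * (s / m) * J + (s / m) ^+ 2 * V =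
   V - s * (2 * dl - s * (V - 2 * (J / m) + V / m ^+ 2)).
  by rewrite /dl; field; rewrite gt_eqF.
have Jm : 0 <= J / m by rewrite divr_ge0// ltW.
have : 0 < 2 * dl - s * (V - 2 * (J / m) + V / m ^+ 2).
  have : s * (V - 2 * (J / m) + V / m ^+ 2) <= s * q.
    by rewrite ler_wpM2l ?(ltW s0)// /q; lra.
  lra.
move=> h1; have := mulr_gt0 s0 h1; lra.
Qed.

(** Collects what does not depend on [x] in the integrated kernel: [ln A] from both weights, the
    mean of the weight at [t], and the shift [c]. *)
Definition robin_shift : R := 2 * ln A + (\sum_(j < K) pw j * Ex P D (fun t : T => ln `|z j - t|)) - c.

Let lnM3 (u v e : R) : 0 < u -> 0 < v -> 0 < e -> ln (u * v * e) = ln u + ln v + ln e.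
Proof. by move=> u0 v0 e0; rewrite lnM ?posrE ?mulr_gt0// lnM ?posrE. Qed.

(** Outside the null set formed by [x] and the [z_j] the kernel is minus a sum of logarithms, which
    is integrated term by term. *)
Lemma section_potential (x : R) : D x -> (forall j, (j < K)%N -> x != z j) ->
  a x = (- potential K z pw P x - robin_shift)%:E.
Proof.
move=> Dx xz.
have PS (y : R) : P [set y] = 0%E by exact: (prob_set1 hK hA hp hz PD Pmin Pfin).
have iln (y : R) : P.-integrable D (fun t : T => (ln `|y - t|)%:E).
  exact: (ln_integrable hK hA hp hz PD Pmin Pfin).
pose g (t : T) : R := - ln `|x - t| + (- (ln (w x) + ln A - c) + - \sum_(j < K) pw j * ln `|z j - t|).
have [isum sumE] := @Rintegral_sum _ _ _ P D mD K (fun j t => pw j * ln `|z j - t|)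
  (fun j _ => integrableZl mD (pw j) (iln (z j))).
have icst : P.-integrable D (fun t : T => (- (ln (w x) + ln A - c))%:E).
  exact: (bfun_integrable mD P1 (bfun_cst D _)).
have i2 : P.-integrable D (fun t : T => (- (ln (w x) + ln A - c) + - \sum_(j < K) pw j * ln `|z j - t|)%:E).
  exact: (integrableD mD icst (integrableN isum)).
have i1 : P.-integrable D (fun t : T => (- ln `|x - t|)%:E) by exact: (integrableN (iln x)).
have ig : P.-integrable D (EFin \o g) by exact: (integrableD mD i1 i2).
have -> : a x = (\int[P]_(t in D) (g t)%:E)%E.
  rewrite /a (ge0_integral_carrier mD PD)//; last exact: measurableT_comp.
  pose N : set T := [set x] `|` \bigcup_(j in [set j | (j < K)%N]) [set z j].
  have N0 : P.-negligible N.
    apply: negligibleU; first by apply/negligibleP; [exact: measurable_set1|exact: PS].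
    apply: (@negligibleS _ T _ P (\bigcup_j [set z j])); first by move=> y [j _ yj]; exists j.
    by apply: negligible_bigcup => j; apply/negligibleP; [exact: measurable_set1|exact: PS].
  apply: ae_eq_integral => //.
  - by apply: measurable_funTS; exact: measurableT_comp.
  - exact: (measurable_int _ ig).
  apply: negligibleS N0 => t /= nt; apply: contrapT => Nt; apply: nt => Dt.
  have tx : x != t by apply/eqP => e; apply: Nt; left.
  have tz j : (j < K)%N -> t != z j by move=> jK; apply/eqP => e; apply: Nt; right; exists j.
  have wx := weightw_neq0 pw hA xz; have wt := weightw_neq0 pw hA tz.
  have wx0 := weightw_gt0 hA wx; have wt0 := weightw_gt0 hA wt.
  rewrite /h patchE mem_set// /log_kernel/= (negbTE tx) (negbTE wx) (negbTE wt)/= -EFinD; congr EFin.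
  have xt0 : 0 < `|x - t| by rewrite normr_gt0 subr_eq0.
  rewrite lnM3// (ln_weightw pw hA tz) /g.
  have -> : \sum_(j < K) pw j * ln `|z j - t| = \sum_(j < K) pw j * ln `|t - z j|.
    by apply: eq_bigr => j _; rewrite distrC.
  ring.
rewrite -[LHS]fineK; last exact: integrable_fin_num.
congr EFin; rewrite -/(Rintegral _ _ _) /g RintegralD// RintegralD//; last exact: (integrableN isum).
rewrite (_ : (\int[P]_(_ in D) (- (ln (w x) + ln A - c)))%R = - (ln (w x) + ln A - c)); last exact: (Ex_cst mD P1 _).
rewrite /potential /charged /robin_shift (ln_weightw pw hA xz).
have ms j : (\int[P]_(t in D) (pw j * ln `|z j - t|))%R = pw j * Ex P D (fun t : T => ln `|z j - t|).
  by rewrite RintegralZl//; exact: iln.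
have sumE' : (\int[P]_(t in D) (\sum_(j < K) pw j * ln `|z j - t|))%R =
    \sum_(j < K) pw j * Ex P D (fun t : T => ln `|z j - t|).
  by rewrite sumE; apply: eq_bigr => j _; exact: ms.
rewrite (RintegralN mD (iln x)) (RintegralN mD isum) sumE'.
rewrite -/(Ex P D _); move: (\sum_(j < K) _) (\sum_(j < K) _) (Ex _ _ _) => s1 s2 e1.
lra.
Qed.

(** On the band [a] is a constant [f]. The lower bounds of [energy_le_section] on the band and on
    the rest of [D] add up to [V], the exact total, so both are equalities and [f = V]. *)
Lemma potential_const (u v : R) : u < v -> off_z u v -> `[u, v]%classic `<=` D ->
  (forall x, u <= x <= v -> Pi.[x] <= 0) -> (0 < P `[u, v]%classic)%E ->
  potential K z pw P u = - V - robin_shift.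
Proof.
move=> uv nuv uvD Pi0 Ppos.
pose E : set T := `[u, v]%classic; have mE : measurable E by exact: measurable_itv.
have ma : measurable_fun setT a by exact: measurable_potential_section.
have a0 x : (0 <= a x)%E by exact: integral_ge0.
pose f := - potential K z pw P u - robin_shift.
have af x : E x -> a x = f%:E.
  move=> Ex; have := Ex; rewrite /E /= in_itv/= => uxv.
  have xz j (jK : (j < K)%N) := off_z_neq nuv uxv jK.
  rewrite section_potential//; last exact: uvD.
  have /andP[ux xv] := uxv; congr (- _ - _)%:E.
  move: ux; rewrite le_eqVlt => /predU1P[<-//|ux].
  apply/esym; apply: (potential_cst hK hA hp hz PD Pmin Pfin ux).
    by move=> j jK /andP[h1 h2]; apply: (nuv j jK); rewrite h1 (le_trans h2).
  by move=> y /andP[h1 h2]; apply: Pi0; rewrite h1 (le_trans h2).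
have JE : (\int[P]_(x in E) a x = P E * f%:E)%E.
  rewrite (eq_integral (fun=> f%:E)); last by move=> x; rewrite inE => /af.
  by rewrite integral_cst// muleC.
have m1 := energy_le_section mE uvD.
have mDE : measurable (D `\` E) by exact: measurableD.
have m2 := energy_le_section mDE (@subDsetl _ D E).
pose m := fine (P E); have mE' : P E = m%:E by rewrite fineK// fin_num_measure.
have PDE : P (D `\` E) = (1 - m)%:E.
  have PDfin : (P D < +oo)%E by rewrite P1 ltry.
  apply: (etrans (measureD mD mE PDfin)).
  by rewrite (setIidr uvD) [X in (X - _)%E]P1 [X in (_ - X)%E]mE'.
have tot : (\int[P]_(x in D `\` E) a x = (V - m * f)%:E)%E.
  have : (\int[P]_x a x = \int[P]_(x in D `\` E) a x + \int[P]_(x in E) a x)%E.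
    rewrite (ge0_integral_carrier mD PD)// -ge0_integral_setU//.
    - by rewrite setUC setDUK.
    - exact: measurable_funTS.
    - by apply/disj_setPS => x [[_ nE] /nE].
  rewrite energyE JE mE' -EFinM => e.
  by rewrite EFinB e addeK.
rewrite JE mE' -!EFinM lee_fin in m1; rewrite tot PDE -EFinM lee_fin in m2.
have m0 : 0 < m by rewrite -lte_fin -mE'.
have : f = V.
  apply/eqP; rewrite eq_le; apply/andP; split; last by rewrite -(ler_pM2l m0).
  by rewrite -(ler_pM2l m0); lra.
by rewrite /f => <-; ring.
Qed.

End EquilibriumConstant.

Section UnionIntegrals.
Context d (T : measurableType d) (R : realType).
Variables (m : {measure set T -> \bar R}) (f : T -> R).

Let setU_diff (X Y : set T) : X `|` Y = X `|` (Y `\` X).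
Proof.
apply/seteqP; split => x [Xx|Yx]; [by left| |by left|by right; exact: Yx.1].
by have [Xx|nX] := pselect (X x); [left|right].
Qed.

Lemma integrable_union (X Y : set T) : measurable X -> measurable Y ->
  m.-integrable X (EFin \o f) -> m.-integrable Y (EFin \o f) ->
  m.-integrable (X `|` Y) (EFin \o f).
Proof.
move=> mX mY /integrableP[mfX fX] iY.
have mYX : measurable (Y `\` X) by exact: measurableD.
have /integrableP[mfY fY] := integrableS mY mYX (@subDsetl _ Y X) iY.
have e : X `|` Y = X `|` (Y `\` X) by exact: setU_diff.
have mfU : measurable_fun (X `|` (Y `\` X)) (EFin \o f) by apply/measurable_funU.
rewrite e; apply/integrableP; split=> //.
rewrite ge0_integral_setU//.
- exact: lte_add_pinfty.
- exact: measurableT_comp.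
- by apply/disj_setPS => x [Xx [_ /(_ Xx)]].
Qed.

Lemma Rintegral_union_null (X Y : set T) : measurable X -> measurable Y ->
  m.-integrable X (EFin \o f) -> m.-integrable Y (EFin \o f) -> m (X `&` Y) = 0%E ->
  (\int[m]_(x in X `|` Y) f x = \int[m]_(x in X) f x + \int[m]_(x in Y) f x)%R.
Proof.
move=> mX mY iX iY XY0; have mXY : measurable (X `&` Y) by exact: measurableI.
have mYX : measurable (Y `\` X) by exact: measurableD.
have e : X `|` Y = X `|` (Y `\` X) by exact: setU_diff.
have eY : (\int[m]_(x in Y) f x = \int[m]_(x in Y `\` X) f x)%R.
  rewrite /Rintegral (negligible_integral mXY mY iY XY0); congr fine; congr (integral _ _ _).
  by apply/seteqP; split => x [Yx nX]; split => //; [move=> Xx; apply: nX; split|move=> [Xx _]; exact: nX].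
rewrite e eY Rintegral_setU//; first by rewrite -e; exact: integrable_union.
by apply/disj_setPS => x [Xx [_ /(_ Xx)]].
Qed.

End UnionIntegrals.

(** * Principal values from a primitive *)

Section PrincipalValues.
Context (R : realType) (K : nat) (z : nat -> R).
Local Notation leb := (lebesgue_measure : {measure set (measurableTypeR R) -> \bar R}).
Local Notation off_z := (off_z K z).
Let Dpv (lo hi eps : R) : set R :=
  `[lo, hi] `\` \bigcup_(j in [set j : nat | (j < K)%N]) open_itv (z j - eps) (z j + eps).

Let mDpv lo hi eps : measurable (Dpv lo hi eps : set (measurableTypeR R)).
Proof.
apply: measurableD; first exact: measurable_itv.
by apply: bigcup_measurable => j _; exact: measurable_itv.
Qed.

(** The truncated domains overlap at most in the point [mid], a null set. *)
Lemma pv_integral_cat (f : R -> R) (lo mid hi v1 v2 : R) : lo <= mid -> mid <= hi ->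
  pv_integral_is K z f lo mid v1 -> pv_integral_is K z f mid hi v2 ->
  pv_integral_is K z f lo hi (v1 + v2).
Proof.
move=> lm mh [i1 c1] [i2 c2].
have e eps : Dpv lo hi eps = Dpv lo mid eps `|` Dpv mid hi eps.
  rewrite /Dpv -setDUl; congr (_ `\` _); apply/seteqP; split => x /=; rewrite !in_itv/=.
    by move=> /andP[-> ->]; rewrite !andbT/=; apply/orP; exact: le_total.
  by case=> /andP[h1 h2]; rewrite ?h1 ?h2 ?(le_trans h2)// ?(le_trans lm).
have null eps : leb (Dpv lo mid eps `&` Dpv mid hi eps) = 0%E.
  apply/eqP; rewrite -measure_le0 -(lebesgue_measure_set1 mid); apply: le_measure; rewrite ?inE.
  - by apply: measurableI; exact: mDpv.
  - exact: measurable_set1.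
  - move=> x [[/= h1 _] [/= h2 _]]; apply/eqP; rewrite eq_le.
    by move: h1 h2; rewrite !in_itv/= => /andP[_ ->] /andP[-> _].
split.
  near=> eps; rewrite -/(Dpv _ _ _) e; apply: integrable_union; try exact: mDpv.
  - by near: eps; exact: i1.
  - by near: eps; exact: i2.
apply: cvg_trans (cvgD c1 c2); apply: near_eq_cvg; near=> eps.
rewrite -/(Dpv _ _ _) -/(Dpv lo mid eps) -/(Dpv lo hi eps) e (Rintegral_union_null _ _ _ _ (null eps))//; try exact: mDpv.
- by near: eps; exact: i1.
- by near: eps; exact: i2.
Unshelve. all: by end_near. Qed.

(** [W] is a primitive of [f] off the [z_j]. Removing a symmetric interval about [z_k] leaves the
    increment of [W] minus [W (z_k + s) - W (z_k - s)], which tends to [0] by hypothesis. *)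
Lemma pv_integral_single (f W : R -> R) (lo hi : R) (k : nat) : (k < K)%N -> lo < z k < hi ->
  (forall j, (j < K)%N -> j != k -> z j < lo \/ hi < z j) ->
  (forall c d, lo <= c -> c < d -> d <= hi -> off_z c d ->
     leb.-integrable `[c, d] (EFin \o f) /\ (\int[leb]_(x in `[c, d]) f x)%R = W d - W c) ->
  (W (z k + s) - W (z k - s)) @[s --> 0^'+] --> (0 : R) ->
  pv_integral_is K z f lo hi (W hi - W lo).
Proof.
move=> kK /andP[lz zh] out fW W0.
have [h1 h10 hh1] := off_z_ball K z lo; have [h2 h20 hh2] := off_z_ball K z hi.
(* For radii below [h], the intervals removed around the other [z_j] miss [[lo, hi]] and the one
   around [z_k] stays inside. *)
pose h := Num.min (Num.min h1 h2) (Num.min (z k - lo) (hi - z k)).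
have h0 : 0 < h by rewrite !lt_min h10 h20 !subr_gt0 lz.
have [q1 q2 q3 q4] : [/\ h <= h1, h <= h2, h <= z k - lo & h <= hi - z k].
  by split; rewrite /h !ge_min ?lexx ?orbT.
have small s : 0 < s -> s < h ->
    [/\ Dpv lo hi s = `[lo, z k - s]%classic `|` `[z k + s, hi]%classic,
        lo < z k - s, z k + s < hi, off_z lo (z k - s) & off_z (z k + s) hi].
  move=> s0 sh; have ls : lo < z k - s by lra.
  have sh' : z k + s < hi by lra.
  have away j : (j < K)%N -> j != k -> z j + s < lo \/ hi < z j - s.
    move=> jK jk; have [zl|hz] := out j jK jk; [left|right].
      have := hh1 j jK; rewrite gt_eqF// => /(_ isT); rewrite gtr0_norm ?subr_gt0//; lra.
    have := hh2 j jK; rewrite lt_eqF// => /(_ isT); rewrite ltr0_norm ?subr_lt0//; lra.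
  split=> //.
  - apply/seteqP; split => x.
      move=> [/=]; rewrite !in_itv/= => /andP[lx xh] nx.
      have nz : ~ (z k - s < x < z k + s).
        by move=> xz; apply: nx; exists k => //; rewrite /open_itv /= in_itv.
      have [xz|zx] := leP x (z k - s); [left|right]; rewrite /= ?in_itv/= ?lx ?xh ?andbT//=.
      by rewrite leNgt; apply/negP => xz; apply: nz; rewrite zx.
    move=> hx; have /andP[lx xh] : lo <= x <= hi.
      by case: hx; rewrite /= in_itv/= => /andP[u1 u2]; apply/andP; split; lra.
    split; first by rewrite /= in_itv/= lx.
    move=> [j /= jK]; rewrite /open_itv /= in_itv/= => /andP[u1 u2].
    have [jk|jk] := eqVneq j k; last by have [] := away j jK jk; lra.
    by move: u1 u2; rewrite jk; case: hx; rewrite /= in_itv/= => /andP[]; lra.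
  - move=> j jK /andP[u1 u2]; have [jk|jk] := eqVneq j k; last by have [] := away j jK jk; lra.
    by move: u2; rewrite jk; lra.
  - move=> j jK /andP[u1 u2]; have [jk|jk] := eqVneq j k; last by have [] := away j jK jk; lra.
    by move: u1; rewrite jk; lra.
have ints s : 0 < s -> s < h -> leb.-integrable (Dpv lo hi s) (EFin \o f) /\
    (\int[leb]_(x in Dpv lo hi s) f x)%R = (W hi - W lo) - (W (z k + s) - W (z k - s)).
  move=> s0 sh; have [-> l1 l2 o1 o2] := small s s0 sh.
  have m1 : measurable (`[lo, z k - s]%classic : set (measurableTypeR R)) by exact: measurable_itv.
  have m2 : measurable (`[z k + s, hi]%classic : set (measurableTypeR R)) by exact: measurable_itv.
  have [i1 e1] : leb.-integrable `[lo, z k - s] (EFin \o f) /\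
      (\int[leb]_(x in `[lo, (z k - s)%R]) f x)%R = W (z k - s) - W lo by apply: fW => //; lra.
  have [i2 e2] : leb.-integrable `[z k + s, hi] (EFin \o f) /\
      (\int[leb]_(x in `[(z k + s)%R, hi]) f x)%R = W hi - W (z k + s) by apply: fW => //; lra.
  split; first exact: integrable_union.
  rewrite Rintegral_union_null// ?e1 ?e2; first by ring.
  rewrite (_ : _ `&` _ = set0) ?measure0//.
  by apply/seteqP; split => // x [/=]; rewrite !in_itv/= => /andP[_ u1] /andP[u2 _]; lra.
split.
  near=> s; rewrite -/(Dpv _ _ _); apply: (ints s _ _).1; near: s.
  - exact: nbhs_right_gt.
  - exact: nbhs_right_lt.
have lim : ((W hi - W lo) - (W (z k + s) - W (z k - s))) @[s --> 0^'+] --> (W hi - W lo).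
  by rewrite -[X in _ --> X]subr0; apply: cvgB; [exact: cvg_cst|exact: W0].
apply: cvg_trans lim; apply: near_eq_cvg; near=> s.
rewrite -/(Dpv _ _ _); apply/esym; apply: (ints s _ _).2; near: s.
- exact: nbhs_right_gt.
- exact: nbhs_right_lt.
Unshelve. all: by end_near. Qed.

End PrincipalValues.

(** * The potential near a zero of the weight *)

Section PotentialAtZeros.
Context (R : realType) (K : nat) (A : R) (z pw : nat -> R).
Hypotheses (hK : (2 <= K)%N) (hA : 0 < A).
Hypothesis hp : forall i : nat, (i < K)%N -> 0 < pw i.
Hypothesis hz : forall i : nat, (i.+1 < K)%N -> z i < z i.+1.
Local Notation w := (weightw K A z pw).
Local Notation T := (measurableTypeR R).
Local Notation D := (`[z 0%N, z K.-1]%classic : set T).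
Variable P : probability T R.
Hypothesis PD : P (~` D) = 0%E.
Hypothesis Pmin : forall nu : {measure set T -> \bar R},
  unit_measure_on (z 0%N) (z K.-1) nu -> (wenergy w P <= wenergy w nu)%E.
Hypothesis Pfin : (wenergy w P < +oo)%E.
Local Notation charged := (charged K z pw P).

Let mD : measurable D.
Proof. exact: measurable_itv. Qed.

Let ln_sub_le (u v h : R) : 0 < h -> h <= u -> h <= v -> `|ln u - ln v| <= `|u - v| / h.
Proof.
move=> h0; wlog uv : u v / u <= v => [H hu hv|hu hv].
  by have [uv|/ltW vu] := leP u v; [exact: H|rewrite distrC (distrC u); exact: H].
have u0 : 0 < u by exact: lt_le_trans hu.
have v0 : 0 < v by exact: lt_le_trans hv.
rewrite distrC (distrC u) !ger0_norm ?subr_ge0//; last by rewrite ler_ln ?posrE.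
rewrite -ln_div ?posrE//; have -> : v / u = 1 + (v - u) / u by field; rewrite gt_eqF.
apply: (le_trans (le_ln1Dx _)); first by rewrite (lt_le_trans (ltrN10 R))// divr_ge0 ?subr_ge0// ltW.
by rewrite ler_wpM2l ?subr_ge0// lef_pV2 ?posrE.
Qed.

(** The mass lies at distance at least [2 h] from [c], so [|x - t|] and [|y - t|] are at least [h],
    where the logarithm has Lipschitz constant [1 / h]. *)
Lemma Ex_ln_lipschitz (c h x y : R) : 0 < h -> P `]c - 2 * h, c + 2 * h[%classic = 0%E ->
  `|x - c| <= h -> `|y - c| <= h ->
  `|Ex P D (fun t : T => ln `|x - t|) - Ex P D (fun t : T => ln `|y - t|)| <= `|x - y| / h.
Proof.
move=> h0 Pnull xc yc.
have iln (u : R) : P.-integrable D (fun t : T => (ln `|u - t|)%:E).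
  exact: (ln_integrable hK hA hp hz PD Pmin Pfin).
rewrite -RintegralB//; [|exact: iln|exact: iln].
have id_ : P.-integrable D (EFin \o (fun t : T => ln `|x - t| - ln `|y - t|)).
  exact: (integrableB mD (iln x) (iln y)).
have mN : measurable (`]c - 2 * h, c + 2 * h[%classic : set T) by exact: measurable_itv.
have mDN : measurable (D `\` `]c - 2 * h, c + 2 * h[ : set T) by exact: measurableD.
rewrite /Rintegral (negligible_integral mN mD id_ Pnull) -/(Rintegral _ _ _).
have idN := integrableS mD mDN (@subDsetl _ D _) id_.
apply: (le_trans (le_normr_Rintegral mDN idN)).
have PDN : (P (D `\` `](c - 2 * h)%R, (c + 2 * h)%R[%classic) <= 1)%E by exact: probability_le1.
have icst : P.-integrable (D `\` `]c - 2 * h, c + 2 * h[ : set T) (EFin \o (fun=> `|x - y| / h)).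
  exact: (@integrable_bounded _ _ _ P _ mDN (le_lt_trans PDN (ltry _)) (fun=> `|x - y| / h) `| `|x - y| / h | (measurable_cst _) (fun _ _ => lexx _)).
apply: (@le_trans _ _ (\int[P]_(t in D `\` `]c - 2 * h, c + 2 * h[) (`|x - y| / h))%R).
  apply: le_Rintegral => //; first exact: (integrable_norm idN).
  move=> t [_ /=]; rewrite in_itv/= => /negP; rewrite negb_and -!leNgt => tc.
  have far u : `|u - c| <= h -> h <= `|u - t|.
    rewrite ler_norml => /andP[u1 u2]; case/orP: tc => tc.
      by apply: le_trans (ler_norm _); lra.
    by rewrite distrC; apply: le_trans (ler_norm _); lra.
  apply: (le_trans (ln_sub_le h0 (far x xc) (far y yc))).
  rewrite ler_wpM2r ?invr_ge0 ?(ltW h0)//.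
  by apply: (le_trans (ler_dist_dist _ _)); rewrite opprB addrA subrK.
rewrite Rintegral_cst// -[leRHS]mulr1 ler_wpM2l ?divr_ge0 ?normr_ge0 ?(ltW h0)//.
by rewrite -lee_fin fineK// fin_num_measure.
Qed.

(** Only the charge at [z_k] is singular there, and its logarithms at [z_k + s] and [z_k - s]
    coincide; all other terms are continuous. *)
Lemma potential_symmetric_limit k : (k < K)%N ->
  (potential K z pw P (z k + s) - potential K z pw P (z k - s)) @[s --> 0^'+] --> (0 : R).
Proof.
move=> kK; have [h' h0' [_ Pnull']] := prob_ball_z hK hA hp hz PD Pmin Pfin kK.
pose h := h' / 2; have h0 : 0 < h by rewrite divr_gt0.
have Pnull : P `]z k - 2 * h, z k + 2 * h[%classic = 0%E.
  by have -> : 2 * h = h' by rewrite /h; field.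
have id0 : (fun s : R => s) s @[s --> 0^'+] --> (0 : R) by apply: cvg_at_right_filter; exact: cvg_id.
pose L (x : R) := Ex P D (fun t : T => ln `|x - t|).
have cL : (L (z k + s) - L (z k - s)) @[s --> 0^'+] --> (0 : R).
  apply: (@squeeze_cvgr _ _ _ _ (fun s => - (s * (2 / h))) (fun s => s * (2 / h))).
  - near=> s; have s0 : 0 < s by near: s; exact: nbhs_right_gt.
    have sh : s < h by near: s; exact: nbhs_right_lt.
    rewrite -ler_norml.
    have -> : s * (2 / h) = `|z k + s - (z k - s)| / h.
      by rewrite (_ : z k + s - (z k - s) = 2 * s); [rewrite gtr0_norm ?mulr_gt0//; field; rewrite gt_eqF|ring].
    apply: (Ex_ln_lipschitz h0 Pnull).
    - by rewrite addrAC subrr add0r gtr0_norm// ltW.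
    - by rewrite addrAC subrr add0r normrN gtr0_norm// ltW.
  - by rewrite -[X in _ --> X]oppr0 -[X in - X](mul0r (2 / h)); apply: cvgN; apply: cvgM; [|exact: cvg_cst].
  - by rewrite -[X in _ --> X](mul0r (2 / h)); apply: cvgM; [|exact: cvg_cst].
rewrite (_ : (fun s => _) = (fun s => (L (z k + s) - L (z k - s)) +
    \sum_(j < K) (pw j * (ln `|z k + s - z j| - ln `|z k - s - z j|)))); last first.
  apply/funext => s; rewrite /potential /charged opprD addrACA -sumrB; congr (_ + _).
  by apply: eq_bigr => j _; rewrite mulrBr.
have h00 : 0 + \sum_(j < K) (0 : R) = 0 by rewrite big1 ?addr0.
rewrite -[X in _ --> X]h00.
apply: cvgD; first exact: cL.
apply: (cvg_big add_continuous) => j _.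
have [jk|jk] := eqVneq (nat_of_ord j) k.
  rewrite jk (_ : (fun s => _) = fun=> 0); first exact: cvg_cst.
  by apply/funext => s; rewrite addrAC subrr add0r addrAC subrr add0r normrN subrr mulr0.
have zz : z k - z j != 0 by rewrite subr_eq0; apply/eqP => /(z_inj hz kK (ltn_ord j)) e; rewrite e eqxx in jk.
have lnc (u : R -> R) : u s @[s --> 0^'+] --> z k - z j -> ln `|u s| @[s --> 0^'+] --> ln `|z k - z j|.
  move=> uc; have nc : `|u s| @[s --> 0^'+] --> `|z k - z j| by exact: cvg_norm.
  have lc : {for `|z k - z j|, continuous (@ln R)} by apply: continuous_ln; rewrite normr_gt0.
  by apply: continuous_cvg; [exact: lc|exact: nc].
have e0 : pw j * (ln `|z k - z j| - ln `|z k - z j|) = 0 by rewrite subrr mulr0.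
rewrite -[X in _ --> X]e0; apply: cvgM; first exact: cvg_cst.
have e1 : z k + 0 - z j = z k - z j by rewrite addr0.
have e2 : z k - 0 - z j = z k - z j by rewrite subr0.
apply: cvgB; [apply: (lnc (fun s => z k + s - z j))|apply: (lnc (fun s => z k - s - z j))].
- rewrite -[X in _ --> X]e1; apply: cvgB; last exact: cvg_cst.
  by apply: cvgD; [exact: cvg_cst|].
- rewrite -[X in _ --> X]e2; apply: cvgB; last exact: cvg_cst.
  by apply: cvgB; [exact: cvg_cst|].
Unshelve. all: by end_near. Qed.

End PotentialAtZeros.

(** * Structure of the equilibrium measure *)

Section SelectedIndices.
Context (n : nat) (real : pred nat).

(** In the application these are the gaps carrying a band, in increasing order; the rejected ones
    contain a double root. *)
Definition selected := [seq j <- iota 0 n | real j].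
Definition rejected := [seq j <- iota 0 n | ~~ real j].
Definition sel (l : nat) := nth 0%N selected l.

Lemma mem_selected j : (j \in selected) = real j && (j < n)%N.
Proof. by rewrite mem_filter mem_iota add0n. Qed.

Lemma mem_rejected j : (j \in rejected) = ~~ real j && (j < n)%N.
Proof. by rewrite mem_filter mem_iota add0n. Qed.

Lemma size_selected : (size selected <= n)%N.
Proof. by rewrite size_filter (leq_trans (count_size _ _))// size_iota. Qed.

Lemma size_rejected : (size rejected = n - size selected)%N.
Proof.
have h : (size selected + size rejected = n)%N.
  by rewrite !size_filter -[RHS](size_iota 0 n) -(count_predC real).
by rewrite -[in RHS]h addKn.
Qed.

Lemma sel_in l : (l < size selected)%N -> real (sel l) && (sel l < n)%N.
Proof. by move=> lL; rewrite -mem_selected mem_nth. Qed.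

Lemma sel_lt l m : (l < m)%N -> (m < size selected)%N -> (sel l < sel m)%N.
Proof.
move=> lm mL; have s : sorted ltn selected.
  by apply: sorted_filter; [exact: ltn_trans|exact: iota_ltn_sorted].
by apply: (sorted_ltn_nth ltn_trans 0%N s) => //; rewrite inE//; exact: ltn_trans mL.
Qed.

Lemma selP j : real j -> (j < n)%N -> exists2 l, (l < size selected)%N & sel l = j.
Proof.
move=> rj jn; have js : j \in selected by rewrite mem_selected rj.
by exists (index j selected); [rewrite index_mem|rewrite /sel nth_index].
Qed.

Lemma sel_between l j : (0 < l)%N -> (l < size selected)%N -> (sel l.-1 < j < sel l)%N -> ~~ real j.
Proof.
move=> l0 lL /andP[h1 h2]; apply/negP => rj.
have /andP[_ ln] := sel_in lL.
have [m mL e] := selP rj (ltn_trans h2 ln).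
have [ml|lm] := ltnP m l.
  have [m1|m1] := ltnP m l.-1; last by move: h1; rewrite -e (_ : m = l.-1) ?ltnn//; lia.
  by have := sel_lt m1 (leq_ltn_trans (leq_pred _) lL); rewrite e; lia.
move: lm; rewrite leq_eqVlt => /predU1P[lm|lm]; first by move: h2; rewrite -e lm ltnn.
by have := sel_lt lm mL; rewrite e; lia.
Qed.

(** Signs of products over the gaps are parities of the number of indices to the right of a point;
    this count turns them into the exponent [L - l]. The disjunctions cover the two ends of the
    list. *)
Lemma count_selected k l : (l <= size selected)%N ->
  (l = 0 \/ sel l.-1 < k)%N -> (l = size selected \/ k <= sel l)%N ->
  count (leq k) selected = (size selected - l)%N.
Proof.
move=> lL lo hi; rewrite -[in LHS](cat_take_drop l selected) count_cat.
have c1 : count (leq k) (take l selected) = 0%N.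
  apply/eqP; rewrite -leqn0 leqNgt -has_count; apply/negP => /hasP[x xt kx].
  have [i il ex] := nthP 0%N xt; rewrite size_take_min in il.
  have {}il : (i < l)%N by apply: leq_trans il _; exact: geq_minl.
  move: ex; rewrite nth_take// -/(sel i) => ex.
  case: lo => [l0|lo]; first by rewrite l0 in il.
  have [il1|il1] := ltnP i l.-1.
    have l1L : (l.-1 < size selected)%N by lia.
    by have := sel_lt il1 l1L; lia.
  have e : i = l.-1 by lia.
  by move: lo; rewrite -e ex; lia.
have c2 : count (leq k) (drop l selected) = size (drop l selected).
  apply/eqP; rewrite -all_count; apply/allP => x xd.
  have [i il ex] := nthP 0%N xd; rewrite size_drop in il.
  move: ex; rewrite nth_drop -/(sel _) => ex.
  case: hi => [l0|hi]; first by rewrite l0 subnn in il.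
  rewrite -ex; move: il; case: i {ex} => [|i] il; first by rewrite addn0.
  apply: (leq_trans hi); apply: ltnW; apply: sel_lt; first by rewrite -[X in (X < _)%N]addn0 ltn_add2l.
  by rewrite -ltn_subRL.
by rewrite c1 c2 size_drop.
Qed.

Lemma count_rejected k : (k <= n)%N ->
  (count (leq k) selected + count (leq k) rejected = n - k)%N.
Proof.
move=> kn; have e : (count (leq k) (iota 0 n) = n - k)%N.
  rewrite -{1}(subnKC kn) iotaD count_cat add0n.
  rewrite (_ : count _ (iota 0 k) = 0%N); last first.
    by apply/eqP; rewrite -leqn0 leqNgt -has_count; apply/hasPn => x; rewrite mem_iota -ltnNge.
  rewrite add0n -[RHS](size_iota k); apply/eqP; rewrite -all_count.
  by apply/allP => x; rewrite mem_iota => /andP[].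
rewrite -e /selected /rejected; elim: (iota 0 n) => //= x s ih; case: (real x) => /=; lia.
Qed.

Lemma prod_selected (R : comPzRingType) (F : nat -> R) :
  \prod_(j < n) F j = (\prod_(l < size selected) F (sel l)) * \prod_(j <- rejected) F j.
Proof.
rewrite -(big_mkord xpredT (fun l => F (sel l))) -(big_nth 0%N xpredT F).
rewrite -(big_mkord xpredT F) /index_iota subn0 /selected /rejected !big_filter.
by rewrite [LHS](bigID real).
Qed.

Lemma prod_seq_sign (R : realType) (s : seq nat) (k : nat) (f : nat -> R) :
  (forall m, m \in s -> if (k <= m)%N then f m < 0 else 0 < f m) ->
  0 < (-1) ^+ (count (leq k) s) * \prod_(m <- s) f m.
Proof.
move=> h; have := @prod_sign R nat s (fun m => m \in s) (leq k) f h.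
rewrite -!big_seq; congr (0 < (-1) ^+ _ * _).
by elim: s {h} => [|x s ih]; rewrite ?big_nil// big_cons ih.
Qed.

Lemma sign_add_sub (R : pzRingType) m l : (l <= m)%N -> (-1) ^+ (m + l) = (-1) ^+ (m - l) :> R.
Proof.
move=> lm; rewrite -[in LHS](subnK lm) -addnA addnn exprD.
by rewrite -mul2n exprM sqrrN expr1n expr1n mulr1.
Qed.

End SelectedIndices.

(** * Bands, density, and values of the polynomial at the zeros of the weight *)

Section Structure.
Context (R : realType) (K : nat) (A : R) (z pw : nat -> R).
Hypotheses (hK : (2 <= K)%N) (hA : 0 < A).
Hypothesis hp : forall i : nat, (i < K)%N -> 0 < pw i.
Hypothesis hz : forall i : nat, (i.+1 < K)%N -> z i < z i.+1.
Local Notation w := (weightw K A z pw).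
Local Notation T := (measurableTypeR R).
Local Notation D := (`[z 0%N, z K.-1]%classic : set T).
Local Notation leb := (lebesgue_measure : {measure set T -> \bar R}).
Variable P : probability T R.
Hypothesis PD : P (~` D) = 0%E.
Hypothesis Pmin : forall nu : {measure set T -> \bar R},
  unit_measure_on (z 0%N) (z K.-1) nu -> (wenergy w P <= wenergy w nu)%E.
Hypothesis Pfin : (wenergy w P < +oo)%E.
Local Notation Pi := (loop_poly K z pw (moment K z P)).
Local Notation Az := (zpoly K z).
Local Notation Bz := (bpoly K z pw).
Local Notation cauchy_at := (cauchy_at K z pw P).
Local Notation disc := (disc K z pw P).
Local Notation density := (density K z pw P).
Local Notation off_z := (off_z K z).

Let mD : measurable D.
Proof. exact: measurable_itv. Qed.
Let P1 : P D = 1%E.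
Proof. exact: prob_carrier1. Qed.
Variables al be : nat -> R.
Hypothesis hab : forall j, (j < K.-1)%N -> [/\ z j < al j, al j <= be j & be j < z j.+1].
Hypothesis PiE : forall x,
  Pi.[x] = (1 + \sum_(j < K) pw j) ^+ 2 * \prod_(j < K.-1) ((x - al j) * (x - be j)).

Local Notation n := K.-1.
Local Notation ptot := (\sum_(j < K) pw j).
Let real : pred nat := fun j => al j < be j.
Local Notation L := (size (selected n real)).
Local Notation idx := (sel n real).
Local Notation es := (rejected n real).
(** The polynomial [P] of the theorem: each double root is taken once, so that [Q ^ 2] collects them
    in [Pi]. *)
Let Q : {poly R} := \prod_(j <- es) ('X - (al j)%:P).
Let Rf x := \prod_(l < L) ((x - al (idx l)) * (x - be (idx l))).

Let nK : n.+1 = K.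
Proof. by rewrite prednK//; lia. Qed.

Let p1 : 0 < 1 + ptot.
Proof. by rewrite ltr_pwDl// sumr_ge0// => j _; rewrite ltW// hp. Qed.

Let zlt i j : (i < K)%N -> (j < K)%N -> z i < z j -> (i < j)%N.
Proof.
move=> iK jK; apply: contraTT; rewrite -leqNgt -leNgt => ji.
by apply: (z_le hz); rewrite ji.
Qed.

Let sel_ok l : (l < L)%N -> al (idx l) < be (idx l) /\ (idx l < n)%N.
Proof. by move=> /sel_in /andP[]. Qed.

Let hes m : m \in es -> (m < n)%N /\ be m = al m.
Proof.
rewrite mem_rejected => /andP[nr mn]; split=> //; have [_ h _] := hab mn.
by apply/eqP; rewrite eq_le h andbT leNgt.
Qed.

Let QE x : Q.[x] = \prod_(j <- es) (x - al j).
Proof. by rewrite horner_prod; apply: eq_bigr => j _; rewrite hornerXsubC. Qed.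

Let PiQ x : Pi.[x] = (1 + ptot) ^+ 2 * (Rf x * Q.[x] ^+ 2).
Proof.
rewrite PiE (@prod_selected n real R (fun j => (x - al j) * (x - be j))); congr (_ * (_ * _)).
rewrite QE -prodrXl !big_seq; apply: eq_bigr => j /hes[_ ->]; by rewrite expr2.
Qed.

Let be_al i j : (i < j)%N -> (j < n)%N -> be i < al j.
Proof. by move=> ij jn; apply: (be_lt_al hK hA hp hz Pfin hab); rewrite ij. Qed.

Let signQ x k : (forall m, (m < n)%N -> ~~ real m -> if (k <= m)%N then x < al m else al m < x) ->
  0 < (-1) ^+ (count (leq k) es) * Q.[x].
Proof.
move=> h; rewrite QE; apply: prod_seq_sign => m; rewrite mem_rejected => /andP[nr mn].
by have := h m mn nr; case: ifP => _ h'; rewrite ?subr_lt0 ?subr_gt0.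
Qed.

Let signA x i : (i < n)%N -> (forall m, (m < K)%N -> if (i < m)%N then x < z m else z m < x) ->
  0 < (-1) ^+ (n - i) * Az.[x].
Proof.
move=> iN h; have -> : (n - i = \sum_(m < K) (i < m))%N by rewrite sum_ltn_ord; lia.
rewrite horner_zpoly; apply: prod_sign => m _; have := h m (ltn_ord m).
by case: ifP => _ h'; rewrite ?subr_lt0 ?subr_gt0.
Qed.

(** Among the [n - k] gaps from index [k] on, [L - l] carry a band and the others are counted in
    [es]. The parity of [n - k] is the sign of [zpoly] or [bpoly], that of the count in [es] the
    sign of [Q]; their product leaves [(-1) ^ (L - l)]. *)
Let cE k l : (k <= n)%N -> (l <= L)%N -> (l = 0 \/ idx l.-1 < k)%N -> (l = L \/ k <= idx l)%N ->
  (n - k = count (leq k) es + (L - l))%N.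
Proof.
by move=> kn lL lo hi; rewrite -(count_rejected real kn) (count_selected lL lo hi) addnC.
Qed.

Let endpoints j : (j < n)%N -> Pi.[al j] = 0 /\ Pi.[be j] = 0.
Proof.
by move=> jn; split; rewrite PiE [X in _ * X](bigD1 (Ordinal jn))//= subrr ?mulr0 !mul0r ?mulr0.
Qed.

Let Pi_le0 l x : (l < L)%N -> al (idx l) <= x <= be (idx l) -> Pi.[x] <= 0.
Proof.
move=> lL /andP[ax xb]; have [ab iN] := sel_ok lL; have [e1 e2] := endpoints iN.
move: ax; rewrite le_eqVlt => /predU1P[<-|ax]; first by rewrite e1.
move: xb; rewrite le_eqVlt => /predU1P[->|xb]; first by rewrite e2.
by apply/ltW/(loop_poly_lt0 hK hA hp hz Pfin hab PiE iN); rewrite ax.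
Qed.

(** Without a band [Pi] would be nonnegative on the whole line and [P] would have no mass. *)
Let L_gt0 : (0 < L)%N.
Proof.
rewrite lt0n; apply/eqP => L0.
have ge0 x : 0 <= Pi.[x].
  apply: (loop_poly_ge0 hp hab PiE) => j jn /andP[h1 h2].
  have rj : real j by exact: lt_trans h2.
  by have [l] := selP rj jn; rewrite L0.
have Pn : P `](z 0%N - 1), (z n + 1)[%classic = 0%E.
  by apply: (prob_itv_ge0 hK hA hp hz PD Pmin Pfin) => x _; exact: ge0.
have : (P D <= P `](z 0%N - 1)%R, (z n + 1)%R[%classic)%E.
  apply: le_measure; rewrite ?inE; [exact: mD|exact: measurable_itv|].
  by move=> x; rewrite /= !in_itv/= => /andP[h1 h2]; apply/andP; split; lra.
by rewrite P1 [X in (_ <= X)%E]Pn lee_fin ler10.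
Qed.

Let region_of l j : (l < L)%N -> (j < K)%N ->
  (z j <= al (idx l) -> (j <= idx l)%N) /\ (be (idx l) <= z j -> (idx l < j)%N).
Proof.
move=> lL jK; have [ab iN] := sel_ok lL; have [h1 h2 h3] := hab iN.
have iK : ((idx l).+1 < K)%N by rewrite -nK ltnS.
split=> h.
  by rewrite -ltnS; apply: zlt => //; apply: le_lt_trans h _; exact: le_lt_trans h3.
by apply: zlt => //; [exact: ltnW|apply: lt_le_trans h; exact: lt_le_trans h2].
Qed.

Let sgn2 m : ((-1) ^+ m * (-1) ^+ m = 1 :> R).
Proof. by rewrite -expr2 sqrr_sign. Qed.

(** [density] is a square root, hence an absolute value; the signs [u] of [Q] and [u v] of [zpoly]
    on the band turn it into the signed formula. *)
Lemma prob_selected l (E : set T) : (l < L)%N -> measurable E ->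
  E `<=` `[al (idx l), be (idx l)]%classic ->
  P E = (\int[leb]_(x in E)
    ((-1) ^+ (L + l.+1 + 1) * ((1 + ptot) * Num.sqrt `|Rf x| * Q.[x]) / (pi * \prod_(j < K) (x - z j)))%:E)%E.
Proof.
move=> lL mE Esub; have [ab iN] := sel_ok lL; have [h1 h2 h3] := hab iN.
set i := idx l in iN ab h1 h2 h3 Esub *.
have nab : off_z (al i) (be i).
  move=> j jK /andP[u1 u2]; have [_ v2] := region_of lL jK.
  have v1 : (i < j)%N by apply: zlt => //; [by rewrite -nK ltnW|exact: lt_le_trans u1].
  by have : (j < i.+1)%N by [apply: zlt => //; [by rewrite -nK ltnS|exact: le_lt_trans h3]]; rewrite ltnS leqNgt v1.
rewrite (prob_density hK hA hp hz PD Pmin Pfin ab nab mE Esub).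
apply: eq_integral => x; rewrite inE => /Esub; rewrite /= in_itv/= => xab; congr EFin.
have /andP[ax xb] := xab.
have sQ : 0 < (-1) ^+ (count (leq i) es) * Q.[x].
  apply: signQ => m mn nr; case: leqP => im.
    have {}im : (i < m)%N.
      rewrite ltn_neqAle im andbT; apply/eqP => e; move: nr; rewrite -e; by rewrite /real ab.
    exact: le_lt_trans xb (be_al im mn).
  have [_ am _] := hab mn; exact: lt_le_trans (le_lt_trans am (be_al im iN)) ax.
have sA : 0 < (-1) ^+ (n - i) * Az.[x].
  apply: signA => // m mK; case: ltnP => im.
    apply: le_lt_trans xb (lt_le_trans h3 _); apply: (z_le hz); by rewrite im.
  apply: lt_le_trans ax; apply: le_lt_trans h1; apply: (z_le hz); rewrite im; exact: leq_trans iN (leq_pred _).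
have ce : (n - i = count (leq i) es + (L - l))%N.
  apply: cE; [exact: ltnW|exact: ltnW| |by right].
  case: l lL @i {ab iN h1 h2 h3 Esub nab xab ax xb sQ sA} => [|l'] lL; first by left.
  by right; apply: sel_lt.
rewrite ce exprD in sA.
(* [l] counts from [0], so the exponent [L + (l + 1) + 1] has the parity of [L - l]. *)
have eL : (-1) ^+ (L + l.+1 + 1) = (-1) ^+ (L - l) :> R.
  by rewrite addn1 addnS !exprS !mulN1r opprK sign_add_sub// ltnW.
rewrite eL -horner_zpoly /density /disc.
have Q0 : Q.[x] != 0 by apply: contraTneq sQ => ->; rewrite mulr0 ltxx.
have A0 : Az.[x] != 0 by apply: contraTneq sA => ->; rewrite mulr0 ltxx.
have Pi0 : Pi.[x] <= 0 by apply: (Pi_le0 lL).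
have Q2 : 0 < Q.[x] ^+ 2 by rewrite exprn_even_gt0.
have Rf0 : Rf x <= 0.
  by move: Pi0; rewrite PiQ pmulr_rle0 ?exprn_gt0// pmulr_lle0.
move: (count _ _) (L - l)%N sQ sA => c1 c2.
set u := (-1) ^+ c1; set v := (-1) ^+ c2 => sQ sA.
have uu : u * u = 1 by exact: sgn2. have vv : v * v = 1 by exact: sgn2.
rewrite max_l; last by rewrite oppr_ge0 mulr_le0_ge0// invr_ge0 sqr_ge0.
have -> : - (Pi.[x] / Az.[x] ^+ 2) = ((1 + ptot) * (u * Q.[x]) / (u * v * Az.[x])) ^+ 2 * `|Rf x|.
  rewrite PiQ ler0_norm// !exprMn exprVn !exprMn !expr2 uu vv !mul1r; field; exact: A0.
rewrite sqrtrM ?sqr_ge0// sqrtr_sqr ger0_norm; last first.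
  by apply: divr_ge0; [apply: mulr_ge0; exact: ltW|exact: ltW].
have uv0 : u != 0 /\ v != 0.
  by split; apply/eqP => e0; [move: uu; rewrite e0|move: vv; rewrite e0]; rewrite mul0r => /esym/eqP; rewrite oner_eq0.
have pi0 : (pi : R) != 0 by rewrite gt_eqF ?pi_gt0.
have vi : v^-1 = v by apply: (mulfI uv0.2); rewrite mulfV ?uv0.2// vv.
have ui : u^-1 = u by apply: (mulfI uv0.1); rewrite mulfV ?uv0.1// uu.
rewrite !invfM vi ui.
transitivity (u * u * (v * ((1 + ptot) * Num.sqrt `|Rf x| * Q.[x]) * (pi^-1 * Az.[x]^-1))); first by ring.
by rewrite uu mul1r.
Qed.

(** [bpoly (z_j) ^ 2 = Pi (z_j)] determines [Q (z_j)] up to sign, and the sign follows by counting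
    the double roots and the [z_m] to the right of [z_j]. *)
Lemma rejected_poly_z j l : (j < K)%N -> (l <= L)%N ->
  (l = 0%N \/ be (idx l.-1) <= z j) -> (l = L \/ z j <= al (idx l)) ->
  Q.[z j] = (-1) ^+ (L + l) * (pw j * \prod_(m < K | nat_of_ord m != j) (z j - z m)) /
    ((1 + ptot) * Num.sqrt `|Rf (z j)|).
Proof.
move=> jK lL lo hi.
have jn : (j <= n)%N by rewrite -ltnS nK.
have sQ : 0 < (-1) ^+ (count (leq j) es) * Q.[z j].
  apply: signQ => m mn nr; have [h1 h2 h3] := hab mn; case: leqP => jm.
    by apply: le_lt_trans h1; apply: (z_le hz); rewrite jm ltnW// -nK ltnS.
  by apply: (le_lt_trans h2); apply: (lt_le_trans h3); apply: (z_le hz); rewrite jm.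
have sB : 0 < (-1) ^+ (n - j) * Bz.[z j] by exact: (bpoly_z_sign hK hA hp hz Pfin).
have ce : (n - j = count (leq j) es + (L - l))%N.
  apply: cE => //.
    case: lo => [->|lo]; first by left.
    have [->|l0] := posnP l; first by left.
    have l1 : (l.-1 < L)%N by rewrite prednK.
    by right; exact: (region_of l1 jK).2.
  case: hi => [->|hi]; first by left.
  have [->|lL'] := eqVneq l L; first by left.
  have {}lL' : (l < L)%N by rewrite ltn_neqAle lL'.
  by right; exact: (region_of lL' jK).1.
rewrite ce exprD in sB.
have eL : (-1) ^+ (L + l) = (-1) ^+ (L - l) :> R.
  exact: sign_add_sub.
rewrite eL -(horner_bpoly_z z pw jK).
have PB : Bz.[z j] ^+ 2 = (1 + ptot) ^+ 2 * (Rf (z j) * Q.[z j] ^+ 2).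
  by rewrite -PiQ horner_loop_poly_z.
have Q0 : Q.[z j] != 0 by apply: contraTneq sQ => ->; rewrite mulr0 ltxx.
have Q2 : 0 < Q.[z j] ^+ 2 by rewrite exprn_even_gt0.
have Rf0 : 0 < Rf (z j).
  have : 0 < Pi.[z j] by exact: loop_poly_z_gt0.
  by rewrite PiQ pmulr_rgt0 ?exprn_gt0// pmulr_lgt0.
rewrite (gtr0_norm Rf0).
have s0 : 0 < Num.sqrt (Rf (z j)) by rewrite sqrtr_gt0.
have s2 : Num.sqrt (Rf (z j)) ^+ 2 = Rf (z j) by rewrite sqr_sqrtr// ltW.
move: (count _ _) (L - l)%N sQ sB => c1 c2.
set u := (-1) ^+ c1; set v := (-1) ^+ c2 => sQ sB.
have uu : u * u = 1 by exact: sgn2. have vv : v * v = 1 by exact: sgn2.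
have key : u * v * Bz.[z j] = (1 + ptot) * Num.sqrt (Rf (z j)) * (u * Q.[z j]).
  have h0 : 0 <= (1 + ptot) * Num.sqrt (Rf (z j)) * (u * Q.[z j]).
    by apply: mulr_ge0; [apply: mulr_ge0; exact: ltW|exact: ltW].
  apply/eqP; rewrite -(eqrXn2 (isT : (0 < 2)%N) (ltW sB) h0).
  by rewrite !exprMn PB s2 !expr2 uu vv; apply/eqP; ring.
have key2 : v * Bz.[z j] = (1 + ptot) * Num.sqrt (Rf (z j)) * Q.[z j].
  have u0 : u != 0 by apply: contraTneq sQ => ->; rewrite mul0r ltxx.
  apply: (mulfI u0); rewrite mulrA key; ring.
by rewrite key2 mulrC mulKf// gt_eqF// mulr_gt0.
Qed.

Let f (x : R) := Num.sqrt `|Rf x| * Q.[x] / \prod_(j < K) (x - z j).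
(** The factor between the integrand of the theorem and the limit of [Re G] in the gap to the left
    of band [l]. *)
Let kap l : R := (-1) ^+ (L - l) / (1 + ptot).
Let W l x := kap l * potential K z pw P x.

(** The constant [kap l] is the same for all cells of a gap: across a double root [Q] and the sign
    [(-1) ^ (n - k - 1)] change together. *)
Let gap_integrand l k x : (0 < l)%N -> (l < L)%N -> (idx l.-1 <= k)%N -> (k.+1 <= idx l)%N ->
  be k <= x <= al k.+1 -> (forall j, (j < K)%N -> x != z j) ->
  f x = kap l * ((-1) ^+ (n - k.+1) * Num.sqrt Pi.[x] / Az.[x]).
Proof.
move=> l0 lL ik kj /andP[bx xa] xz.
have [_ jn] := sel_ok lL; have k1n : (k.+1 < n)%N by exact: leq_ltn_trans jn.
have kn := ltnW k1n.
have A0 : Az.[x] != 0 by exact: zpoly_neq0.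
rewrite /f -horner_zpoly.
have [Pi0|Pi0] := eqVneq Pi.[x] 0.
  rewrite Pi0 sqrtr0 mulr0 mul0r mulr0; move: Pi0; rewrite PiQ => /eqP.
  rewrite mulf_eq0 sqrf_eq0 (gt_eqF p1)/= mulf_eq0 sqrf_eq0 => /orP[/eqP->|/eqP->].
    by rewrite normr0 sqrtr0 !mul0r.
  by rewrite mulr0 mul0r.
have [_ e2] := endpoints kn; have [e1 _] := endpoints k1n.
have {}bx : be k < x by rewrite lt_neqAle bx andbT; apply: contra_neq Pi0 => <-.
have {}xa : x < al k.+1 by rewrite lt_neqAle xa andbT; apply: contra_neq Pi0 => ->.
have sQ : 0 < (-1) ^+ (count (leq k.+1) es) * Q.[x].
  apply: signQ => m mn nr; case: ltnP => km.
    apply: (lt_le_trans xa); move: km; rewrite leq_eqVlt => /predU1P[->//|km].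
    have [_ h _] := hab k1n; exact: le_trans h (ltW (be_al km mn)).
  apply: le_lt_trans bx; move: km; rewrite leq_eqVlt => /predU1P[->|km]; first by have [_ h _] := hab kn.
  have [_ h _] := hab mn; have [_ h' _] := hab kn.
  exact: le_trans (le_trans h (ltW (be_al km kn))) h'.
have ce : (n - k.+1 = count (leq k.+1) es + (L - l))%N.
  exact: (cE kn (ltnW lL) (or_intror ik) (or_intror kj)).
rewrite ce exprD /kap.
have Q2 : 0 < Q.[x] ^+ 2 by rewrite exprn_even_gt0//=; apply: contraTneq sQ => ->; rewrite mulr0 ltxx.
have Pige : 0 <= Pi.[x].
  apply: (loop_poly_ge0 hp hab PiE) => m mn /andP[u1 u2].
  have [mk|km] := leqP m k.
    move: mk; rewrite leq_eqVlt => /predU1P[e|mk]; first by move: u2; rewrite e ltNge (ltW bx).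
    have [_ h' _] := hab kn.
    by move: (lt_trans (lt_trans u2 (lt_le_trans (be_al mk kn) h')) bx); rewrite ltxx.
  move: km; rewrite leq_eqVlt => /predU1P[e|km]; first by move: u1; rewrite -e ltNge (ltW xa).
  have [_ h' _] := hab k1n.
  by move: (lt_trans u1 (lt_le_trans xa (le_trans h' (ltW (be_al km mn))))); rewrite ltxx.
have Rf0 : 0 <= Rf x.
  by move: Pige; rewrite PiQ pmulr_rge0 ?exprn_gt0// pmulr_lge0.
move: (count _ _) (L - l)%N sQ => c1 c2.
set u := (-1) ^+ c1; set v := (-1) ^+ c2 => sQ.
have uu : u * u = 1 by exact: sgn2. have vv : v * v = 1 by exact: sgn2.
rewrite ger0_norm//.
have -> : Pi.[x] = ((1 + ptot) * (u * Q.[x])) ^+ 2 * Rf x.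
  by rewrite PiQ !exprMn !expr2 uu; ring.
rewrite sqrtrM ?sqr_ge0// sqrtr_sqr ger0_norm; last by rewrite mulr_ge0 ?(ltW p1) ?(ltW sQ).
have -> : v / (1 + ptot) * (u * v * ((1 + ptot) * (u * Q.[x]) * Num.sqrt (Rf x)) / Az.[x]) =
   (u * u) * (v * v) * (Num.sqrt (Rf x) * Q.[x] / Az.[x]).
  by field; rewrite A0 gt_eqF.
by rewrite uu vv !mul1r.
Qed.

Let pv_step l k : (0 < l)%N -> (l < L)%N -> (idx l.-1 <= k)%N -> (k.+1 <= idx l)%N ->
  pv_integral_is K z f (be k) (al k.+1) (W l (al k.+1) - W l (be k)).
Proof.
move=> l0 lL ik kj.
have [_ jn] := sel_ok lL; have k1n : (k.+1 < n)%N by exact: leq_ltn_trans jn.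
have kn := ltnW k1n.
have [zk Pnull Pn0 [e1 e2]] := loop_poly_region hK hA hp hz PD Pmin Pfin hab PiE k1n.
have k1K : (k.+1 < K)%N by rewrite -nK ltnW.
have [a1 a2 a3] := hab kn; have [b1 b2 b3] := hab k1n.
apply: (pv_integral_single k1K zk).
- move=> j jK; rewrite neq_ltn => /orP[jk|kj'].
    left; apply: lt_le_trans a2; apply: le_lt_trans a1; apply: (z_le hz).
    by rewrite -ltnS jk ltnW.
  right; apply: (le_lt_trans b2); apply: (lt_le_trans b3); apply: (z_le hz); by rewrite kj'.
- move=> c d bc cd da ncd.
  have U_lim x : c <= x <= d -> (fun m => Re (cauchy_at m x)) @ \oo -->
      (-1) ^+ (n - k.+1) * Num.sqrt Pi.[x] / Az.[x].
    move=> xcd; have xz j (jK : (j < K)%N) := off_z_neq ncd xcd jK.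
    have /andP[cx xd] := xcd.
    apply: (gap_cauchy_limit hK hA hp hz PD Pmin Pfin Pnull k1K zk) => //.
    + by rewrite (le_trans bc)// (le_trans xd).
    + exact: xz.
    + by case=> ->.
  have [iU eU] := potential_integral hK hA hp hz PD Pmin Pfin cd ncd U_lim.
  have mcd : measurable (`[c, d]%classic : set T) by exact: measurable_itv.
  have fU x : x \in (`[c, d]%classic : set T) -> f x = kap l * ((-1) ^+ (n - k.+1) * Num.sqrt Pi.[x] / Az.[x]).
    rewrite inE /= in_itv/= => xcd; have /andP[cx xd] := xcd.
    apply: gap_integrand => //; first by rewrite (le_trans bc)// (le_trans xd).
    by move=> j jK; exact: off_z_neq xcd jK.
  split.
    have := integrableZl mcd (kap l) iU; apply: eq_integrable => // x xcd /=.
    by rewrite fU.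
  rewrite (eq_Rintegral _ (fun x xcd => fU x xcd)) RintegralZl// eU /W; ring.
- rewrite /W -[X in _ --> X](mulr0 (kap l)).
  rewrite (_ : (fun s => _) = (fun s => kap l * (potential K z pw P (z k.+1 + s) - potential K z pw P (z k.+1 - s)))).
    by apply: cvgM; [exact: cvg_cst|exact: (potential_symmetric_limit hK hA hp hz PD Pmin Pfin k1K)].
  by apply/funext => s; rewrite mulrBr.
Qed.

(** The value given by [potential_const] does not involve the band, and the potential is constant
    along each band. *)
Lemma potential_selected : exists v, forall l, (l < L)%N ->
  potential K z pw P (al (idx l)) = v /\ potential K z pw P (be (idx l)) = v.
Proof.
have [c c0 kc] := log_kernel_lbound hK hA hp hz.
exists (- (fine (wenergy w P) + c) - robin_shift K A z pw P c) => l lL.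
have [ab iN] := sel_ok lL; have [h1 h2 h3] := hab iN.
set i := idx l in iN ab h1 h2 h3 *.
have iK : (i.+1 < K)%N by rewrite -nK ltnS.
have nab : off_z (al i) (be i).
  move=> j jK /andP[u1 u2].
  have v1 : (i < j)%N by apply: zlt => //; [exact: ltnW|exact: lt_le_trans u1].
  by have : (j < i.+1)%N by [apply: zlt => //; exact: le_lt_trans h3]; rewrite ltnS leqNgt v1.
have sub : `[al i, be i]%classic `<=` D.
  move=> x; rewrite /= !in_itv/= => /andP[u1 u2]; apply/andP; split.
    apply: le_trans u1; apply: le_trans (ltW h1); apply: (z_le hz); by rewrite leq0n ltnW.
  apply: (le_trans u2); apply: (le_trans (ltW h3)); apply: (z_le hz); by rewrite iN/= -[X in (_ < X)%N]nK ltnSn.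
have Pi0 x : al i <= x <= be i -> Pi.[x] <= 0 by exact: Pi_le0.
have Ppos : (0 < P `[al i, be i]%classic)%E.
  have : msupport P ((al i + be i) / 2).
    rewrite (msupport_prob hK hA hp hz PD Pmin Pfin hab PiE); exists i; first by rewrite /= iN ab.
    by rewrite /= in_itv/=; apply/andP; split; lra.
  have e0 : 0 < (be i - al i) / 2 by rewrite divr_gt0 ?subr_gt0.
  move=> /(_ _ e0) pos; apply: (lt_le_trans pos); apply: le_measure; rewrite ?inE.
  - exact: measurable_itv.
  - exact: measurable_itv.
  - by move=> x; rewrite /open_itv /= !in_itv/= => /andP[u1 u2]; apply/andP; split; lra.
have e1 := potential_const hK hA hp hz PD Pmin Pfin c0 kc ab nab sub Pi0 Ppos.
split=> //; rewrite -e1; apply/esym.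
exact: (potential_cst hK hA hp hz PD Pmin Pfin ab nab Pi0).
Qed.

(** Neighbouring cells meet at a double root, where [al = be], so their principal values add up. The
    increments of [W] telescope to a multiple of the difference of the potentials on two bands,
    which is [0]. *)
Lemma pv_gap_eq0 l : (1 <= l)%N -> (l < L)%N ->
  pv_integral_is K z f (be (idx l.-1)) (al (idx l)) 0.
Proof.
move=> l0 lL; have l1 : (l.-1 < L)%N by exact: leq_ltn_trans (leq_pred _) lL.
have ij : (idx l.-1 < idx l)%N by apply: sel_lt; rewrite ?prednK.
have [_ jn] := sel_ok lL.
have key m : (idx l.-1 + m.+1 <= idx l)%N ->
    pv_integral_is K z f (be (idx l.-1)) (al (idx l.-1 + m.+1)) (W l (al (idx l.-1 + m.+1)) - W l (be (idx l.-1))).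
  elim: m => [|m ih] hm; first by rewrite addn1; apply: pv_step => //; rewrite -addn1.
  rewrite addnS in hm *; have hm' := ltnW hm.
  have lt0 : (idx l.-1 < idx l.-1 + m.+1)%N by rewrite -[X in (X < _)%N]addn0 ltn_add2l.
  have nr : ~~ real (idx l.-1 + m.+1) by apply: (sel_between l0 lL); rewrite lt0.
  have [mn ebe] : (idx l.-1 + m.+1 < n)%N /\ be (idx l.-1 + m.+1) = al (idx l.-1 + m.+1).
    by apply: hes; rewrite mem_rejected nr/= (leq_trans hm)// ltnW.
  have s2 := @pv_step l (idx l.-1 + m.+1)%N l0 lL (leq_addr _ _) hm.
  rewrite ebe in s2.
  have := pv_integral_cat _ _ (ih hm') s2.
  have -> : W l (al (idx l.-1 + m.+1)) - W l (be (idx l.-1)) +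
    (W l (al (idx l.-1 + m.+1).+1) - W l (al (idx l.-1 + m.+1))) =
    W l (al (idx l.-1 + m.+1).+1) - W l (be (idx l.-1)) by ring.
  apply.
  - by apply: ltW; apply: be_al.
  - by rewrite -ebe; apply: ltW; apply: be_al => //; exact: leq_ltn_trans hm jn.
have [v hv] := potential_selected.
have := key (idx l - (idx l.-1).+1)%N; rewrite addnS -addSn (subnKC ij) => /(_ (leqnn _)).
by rewrite /W (hv l lL).1 (hv l.-1 l1).2 subrr.
Qed.

Theorem equilibrium_structure : exists (L : nat) (Q : {poly R}) (al bl : nat -> R),
  let Rf := fun x : R => \prod_(l < L) ((x - al l) * (x - bl l)) in
  (1 <= L <= K.-1)%N /\ Q \is monic /\ size Q = (K - L)%N /\
  z 0%N < al 0%N /\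
  (forall l : nat, (l < L)%N -> al l < bl l) /\
  (forall l : nat, (l.+1 < L)%N -> bl l < al l.+1) /\
  bl L.-1 < z K.-1 /\
  (forall l j : nat, (l < L)%N -> (j < K)%N -> ~ (al l <= z j <= bl l)) /\
  msupport P = \bigcup_(l in [set l : nat | (l < L)%N]) `[al l, bl l]%classic /\
  (forall l : nat, (l < L)%N ->
    forall E : set (measurableTypeR R), measurable E ->
      E `<=` `[al l, bl l]%classic ->
      P E = (\int[lebesgue_measure]_(x in E)
               ((-1) ^+ (L + l.+1 + 1) *
                ((1 + ptot) * Num.sqrt `|Rf x| * Q.[x]) /
                (pi * \prod_(j < K) (x - z j)))%:E)%E) /\
  (forall j l : nat, (j < K)%N -> (l <= L)%N ->
    (l = 0%N \/ bl l.-1 <= z j) -> (l = L \/ z j <= al l) ->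
    Q.[z j] = (-1) ^+ (L + l) *
              (pw j * \prod_(m < K | nat_of_ord m != j) (z j - z m)) /
              ((1 + ptot) * Num.sqrt `|Rf (z j)|)) /\
  (forall l : nat, (1 <= l)%N -> (l < L)%N ->
    pv_integral_is K z
      (fun x : R => Num.sqrt `|Rf x| * Q.[x] / \prod_(j < K) (x - z j))
      (bl l.-1) (al l) 0).
Proof.
exists L, Q, (fun l => al (idx l)), (fun l => be (idx l)) => /=.
split; first by rewrite L_gt0 size_selected.
split; first exact: monic_prod_XsubC.
split; first by rewrite size_prod_XsubC size_rejected -[in RHS]nK subSn// size_selected.
split.
  have [_ iN] := sel_ok L_gt0; have [h _ _] := hab iN.
  by apply: le_lt_trans h; apply: (z_le hz); rewrite leq0n (leq_trans iN)// leq_pred.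
split; first by move=> l /sel_ok[].
split.
  move=> l lL; apply: be_al; first exact: sel_lt.
  by have [] := sel_ok lL.
split.
  have l1 : (L.-1 < L)%N by rewrite (prednK L_gt0).
  have [_ iN] := sel_ok l1; have [_ _ h] := hab iN.
  by apply: (lt_le_trans h); apply: (z_le hz); rewrite iN/= -[X in (_ < X)%N]nK ltnSn.
split.
  move=> l j lL jK /andP[u1 u2]; have [ab iN] := sel_ok lL; have [h1 h2 h3] := hab iN.
  have v1 : (idx l < j)%N by apply: zlt => //; [by rewrite -nK ltnW|exact: lt_le_trans u1].
  by have : (j < (idx l).+1)%N by [apply: zlt => //; [by rewrite -nK ltnS|exact: le_lt_trans h3]]; rewrite ltnS leqNgt v1.
split.
  rewrite (msupport_prob hK hA hp hz PD Pmin Pfin hab PiE); apply/seteqP; split => x.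
    by move=> [j /= /andP[jn rj] xj]; have [l lL e] := selP (real := real) rj jn; exists l => //=; rewrite e.
  by move=> [l /= lL xl]; have [ab iN] := sel_ok lL; exists (idx l) => //=; rewrite iN ab.
split; first by move=> l lL E mE Esub; exact: prob_selected.
split; first by move=> j l jK lL lo hi; exact: rejected_poly_z.
by move=> l l0 lL; exact: pv_gap_eq0.
Qed.

End Structure.

Theorem theorem2p1 (R : realType) (K : nat) (A : R) (z pw : nat -> R)
  (hK : (2 <= K)%N) (hA : 0 < A)
  (hp : forall i : nat, (i < K)%N -> 0 < pw i)
  (hz : forall i : nat, (i.+1 < K)%N -> z i < z i.+1) :
  let w := weightw K A z pw in
  let a := z 0%N in
  let b := z K.-1 in
  let ptot := \sum_(i < K) pw i in
  (exists mu : {measure set (measurableTypeR R) -> \bar R},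
      is_weighted_equilibrium a b w mu) /\
  forall mu : {measure set (measurableTypeR R) -> \bar R},
    is_weighted_equilibrium a b w mu ->
    exists (L : nat) (P : {poly R}) (al bl : nat -> R),
      let Rf := fun x : R => \prod_(l < L) ((x - al l) * (x - bl l)) in
      (* 1 <= L <= K-1, P monic of degree K-L-1 *)
      (1 <= L <= K.-1)%N /\ P \is monic /\ size P = (K - L)%N /\
      (* a < a_1 < b_1 < a_2 < ... < a_L < b_L < b  (0-based indices here) *)
      a < al 0%N /\
      (forall l : nat, (l < L)%N -> al l < bl l) /\
      (forall l : nat, (l.+1 < L)%N -> bl l < al l.+1) /\
      bl L.-1 < b /\
      (* the intervals avoid Z *)
      (forall l j : nat, (l < L)%N -> (j < K)%N -> ~ (al l <= z j <= bl l)) /\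
      (* support *)
      msupport mu = \bigcup_(l in [set l : nat | (l < L)%N]) `[al l, bl l]%classic /\
      (* density on the (l+1)-th interval, sign (-1)^{L + (l+1) + 1} *)
      (forall l : nat, (l < L)%N ->
        forall E : set (measurableTypeR R), measurable E ->
          E `<=` `[al l, bl l]%classic ->
          mu E = (\int[lebesgue_measure]_(x in E)
                   ((-1) ^+ (L + l.+1 + 1) *
                    ((1 + ptot) * Num.sqrt `|Rf x| * P.[x]) /
                    (pi * \prod_(j < K) (x - z j)))%:E)%E) /\
      (* values of P at the z_j; gap number l is [b_l, a_{l+1}] with
         b_0 = -oo, a_{L+1} = +oo, i.e. [bl (l-1), al l] in 0-based indices *)
      (forall j l : nat, (j < K)%N -> (l <= L)%N ->
        (l = 0%N \/ bl l.-1 <= z j) -> (l = L \/ z j <= al l) ->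
        P.[z j] = (-1) ^+ (L + l) *
                  (pw j * \prod_(m < K | nat_of_ord m != j) (z j - z m)) /
                  ((1 + ptot) * Num.sqrt `|Rf (z j)|)) /\
      (* principal value integrals over the inner gaps [b_l, a_{l+1}], l = 1..L-1 *)
      (forall l : nat, (1 <= l)%N -> (l < L)%N ->
        pv_integral_is K z
          (fun x : R => Num.sqrt `|Rf x| * P.[x] / \prod_(j < K) (x - z j))
          (bl l.-1) (al l) 0).
Proof.
move=> w a b ptot; split; first exact: (exists_weighted_equilibrium hK hA hp hz).
move=> mu [[mu1 muD] muMin].
(* The results above concern a [probability]; the given measure of mass one is replaced by one with
   the same value on every set. *)
have [P PE] := unit_measure_probability mu1.
have PD : P (~` `[z 0%N, z K.-1]) = 0%E by rewrite PE.
have eE : wenergy w P = wenergy w mu by apply: eq_wenergy => B _; exact: PE.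
have Pmin (nu : {measure set (measurableTypeR R) -> \bar R}) :
    unit_measure_on (z 0%N) (z K.-1) nu -> (wenergy w P <= wenergy w nu)%E.
  by rewrite eE; exact: muMin.
(* Comparison with one measure of finite energy makes the minimum finite. *)
have Pfin : (wenergy w P < +oo)%E.
  have [nu nu1 nufin] := exists_finite_energy hK hA hp hz.
  exact: le_lt_trans (Pmin nu nu1) nufin.
have [al [be [hab PiE]]] := loop_poly_factor hK hA hp hz PD Pmin Pfin.
have [L [Q [al' [bl' H]]]] := equilibrium_structure hK hA hp hz PD Pmin Pfin hab PiE.
have sE : msupport P = msupport mu.
  have PE' (B : set (measurableTypeR R)) : (P : {measure set (measurableTypeR R) -> \bar R}) B = mu B := PE B.
  by apply/seteqP; split => x hx e e0; [rewrite -PE'|rewrite PE']; exact: hx.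
exists L, Q, al', bl'; move: H; rewrite /= sE.
move=> [? [? [? [? [? [? [? [? [? [dens rest]]]]]]]]]].
by do 9![split=> //]; split=> // l lL E mE Esub; rewrite -PE; exact: dens.
Qed.
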